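(* The simplicial complexes $T_1,T_2,T_3$, and $T_{j,n}$ ($1\le j\le 6$, $n\ge 0$) defined in the context satisfy the following. (i) $T_1\cup T_{4,n}$, $T_{1,m}\cup T_{4,n}$, $T_2\cup T_{5,n}$, $T_{2,m}\cup T_{5,n}$, $T_3\cup T_{6,n}$, $T_{3,m}\cup T_{6,n}$ triangulate the $3$-sphere $S^3$ for $m,n\ge 0$. (ii) $T_2\cup T_{4,n}$, $T_{2,m}\cup T_{4,n}$, $T_3\cup T_{5,n}$, $T_{3,m}\cup T_{5,n}$, $T_1\cup T_{6,n}$, $T_{1,m}\cup T_{6,n}$ triangulate the lens space $L(3,1)$ for $m,n\ge 0$. (iii) $T_3\cup T_{4,n}$, $T_{3,m}\cup T_{4,n}$, $T_1\cup T_{5,n}$, $T_{1,m}\cup T_{5,n}$, $T_2\cup T_{6,n}$, $T_{2,m}\cup T_{6,n}$ triangulate the projective space $\mathbb{RP}^3$ for $m,n\ge 0$. (iv) $T_{4,m}\cup T_{5,n}$, $T_{4,m}\cup T_{6,n}$, $T_{5,m}\cup T_{6,n}$ triangulate the lens space $L(7,2)$ for $m,n\ge 0$. (v) $T_{j,m}\cup T_{j,n}$ triangulates $S^2\times S^1$ for $4\le j\le 6$ and $m\ne n$, $m,n\ge 0$.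
   Context: All simplicial complexes are finite abstract complexes; a pure complex is identified with the set of its facets (maximal faces). A string such as $0123$ denotes the simplex $\{0,1,2,3\}$. $X$ triangulates a space $M$ if $|X|$ is homeomorphic to $M$. For coprime $p,q$, $L(p,q)$ is the quotient of $S^3\subset\mathbb{C}^2$ by the $\mathbb{Z}_p$-action generated by $(z_1,z_2)\mapsto(e^{2\pi i/p}z_1,e^{2\pi i q/p}z_2)$. All vertices $u_{j,n},v_{j,n},w_{j,n}$ ($1\le j\le 6$, $n\ge0$), $q_{n,i},r_{n,i},s_{n,i}$ ($n\ge 0$, $i\in\mathbb{Z}_7$) are pairwise distinct and not in $\mathbb{Z}_7=\{0,\dots,6\}$. On the vertex set $\mathbb{Z}_7$: $T_1=\{0123,1234,2345,3456,0456,0156,0126\}$, $T_2=\{0246,1246,1346,1356,0135,0235,0245\}$, $T_3=\{0145,1245,1256,2356,0236,0346,0134\}$. Writing $u=u_{1,0}$, $v=v_{1,0}$, $w=w_{1,0}$, $T_{1,0}$ has facets $u012,u013,u023,u124,u134,u235,u245$; $v346,v356,v045,v046,v015,v156,v012,v026,v126$; $uv34,uv35,uv45$; and $T'_{1,0}$ is obtained from $T_{1,0}$ by replacing the facets $u012,v012$ with $uw01,uw02,uw12,vw01,vw02,vw12$. For $1\le j\le 3$ and $n\ge 0$, $T_{j,n}$ is the image of $T_{1,0}$ if $0\le n\le 6$, and of $T'_{1,0}$ if $n\ge 7$, under the relabelling $x\mapsto 2^{j-1}x+n\pmod 7$ for $x\in\mathbb{Z}_7$, $u_{1,0}\mapsto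 u_{j,n}$, $v_{1,0}\mapsto v_{j,n}$, $w_{1,0}\mapsto w_{j,n}$. For $n\ge 0$, $T_{4,n}$ is the pure $3$-dimensional complex on $\mathbb{Z}_7\cup\{q_{n,i}:i\in\mathbb{Z}_7\}\cup\{u_{4,n},v_{4,n},w_{4,n}\}$ whose facets, with $u=u_{4,n}$, $v=v_{4,n}$, $w=w_{4,n}$, $q_i=q_{n,i}$ and $i$ running over $\mathbb{Z}_7$ (indices and integer vertices modulo 7), are: $\{w,u,i,i+1\}$, $\{w,i,i+1,q_{i+2}\}$, $\{w,i-1,q_i,q_{i+1}\}$, $\{v,w,q_i,q_{i+1}\}$, $\{v,q_i,i+1,i+2\}$, $\{v,q_i,q_{i+1},i+2\}$, $\{u,v,i,i+1\}$, $\{i-1,q_i,q_{i+1},i+2\}$, $\{i-2,i-1,q_i,i+1\}$, $\{i-1,q_i,i+1,i+2\}$. For $n\ge 0$, $T_{5,n}$ is the image of $T_{4,0}$ under $x\mapsto 2x+n\pmod 7$ ($x\in\mathbb{Z}_7$), $q_{0,i}\mapsto r_{n,i}$, $u_{4,0}\mapsto u_{5,n}$, $v_{4,0}\mapsto v_{5,n}$, $w_{4,0}\mapsto w_{5,n}$; and $T_{6,n}$ is the image of $T_{4,0}$ under $x\mapsto 4x+n\pmod 7$, $q_{0,i}\mapsto s_{n,i}$, $u_{4,0}\mapsto u_{6,n}$, $v_{4,0}\mapsto v_{6,n}$, $w_{4,0}\mapsto w_{6,n}$. *)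

(* Defs.v *)
From HB Require Import structures.
From mathcomp Require Import all_boot all_order all_algebra finmap complex.
From mathcomp Require Import all_classical all_reals all_analysis.

Set Implicit Arguments.
Unset Strict Implicit.
Unset Printing Implicit Defensive.

Import Order.TTheory GRing.Theory Num.Theory.
Import numFieldNormedType.Exports.

Local Open Scope classical_set_scope.
Local Open Scope ring_scope.
Local Open Scope quotient_scope.
Local Open Scope complex_scope.

(* A pure complex with vertices in V is represented by its finite set of       *)
(* facets, so that the union of complexes of equal dimension is fset union.    *)

Definition facets_of (V : choiceType) (s : seq (seq V)) : {fset {fset V}} :=
  [fset [fset x in F]%fset | F : seq V in s]%fset.

Definition relabel (V W : choiceType) (f : V -> W) (K : {fset {fset V}}) :
    {fset {fset W}} :=
  [fset [fset f x | x in F]%fset | F : {fset V} in K]%fset.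

(* Barycentric coordinates.  Since a complex is finite, the topology of |K| is *)
(* the one induced by pointwise convergence.                                   *)
Definition realization (R : realType) (V : choiceType) (K : {fset {fset V}}) :
    set {ptws V -> R} :=
  [set x : {ptws V -> R} | exists2 F : {fset V}, F \in K &
    [/\ forall v, 0 <= x v,
        forall v, v \notin F -> x v = 0 &
        \sum_(v <- F) x v = 1]].

Definition homeomorphic (T U : topologicalType) : Prop :=
  exists (f : T -> U) (g : U -> T),
    [/\ cancel f g, cancel g f, continuous f & continuous g].

Definition triangulates (R : realType) (V : choiceType) (K : {fset {fset V}})
    (M : topologicalType) : Prop :=
  homeomorphic (set_type (@realization R V K)) M.

Definition sphere_set (R : realType) (n : nat) : set 'rV[R]_n.+1 :=
  [set x | \sum_i x 0 i ^+ 2 = 1].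

Definition sphere (R : realType) (n : nat) : topologicalType :=
  set_type (@sphere_set R n).

Definition antipodal (R : realType) (n : nat) : rel (sphere R n) :=
  fun x y => (set_val y == set_val x) || (set_val y == - set_val x).

Lemma antipodal_equiv (R : realType) (n : nat) :
  equiv_class_of (@antipodal R n).
Proof.
split=> [x | x y | y x z]; rewrite /antipodal.
- by rewrite eqxx.
- by rewrite eq_sym -eqr_oppLR [- _ == _]eq_sym.
- by case/orP=> /eqP -> /orP[] /eqP ->; rewrite ?opprK eqxx ?orbT.
Qed.

Canonical antipodal_equivRel (R : realType) (n : nat) :=
  EquivRelPack (@antipodal_equiv R n).

Definition projective_space (R : realType) (n : nat) : topologicalType :=
  quotient_topology {eq_quot @antipodal R n}.

(* R[i]^o carries the topology of the complex modulus. *)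
Definition sphereC2_set (R : realType) : set (R[i]^o * R[i]^o)%type :=
  [set z | `|z.1| ^+ 2 + `|z.2| ^+ 2 = 1].

Definition sphereC2 (R : realType) : topologicalType :=
  set_type (@sphereC2_set R).

Definition expi (R : realType) (t : R) : R[i] := cos t +i* sin t.

(* Two points are related when they lie on the same orbit of the cyclic group  *)
(* generated by (z1, z2) |-> (expi (2 pi / p) z1, expi (2 pi q / p) z2).       *)
Definition lens_rel (R : realType) (p q : nat) : rel (sphereC2 R) :=
  fun x y => `[< exists k : int, set_val y =
    (expi (2 * pi / p%:R) ^ k * (set_val x).1,
     expi (2 * pi * q%:R / p%:R) ^ k * (set_val x).2) >].

Lemma expi_neq0 (R : realType) (t : R) : expi t != 0.
Proof.
apply/eqP => -[c0 s0]; have := cos2Dsin2 t.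
by rewrite c0 s0 expr0n /= addr0 => /esym/eqP; rewrite oner_eq0.
Qed.

Lemma lens_equiv (R : realType) (p q : nat) :
  equiv_class_of (@lens_rel R p q).
Proof.
rewrite /lens_rel; have := expi_neq0 (2 * pi * q%:R / p%:R : R).
have := expi_neq0 (2 * pi / p%:R : R).
move: (expi (2 * pi / p%:R)) (expi (2 * pi * q%:R / p%:R)) => a b a0 b0.
have lensV (x y : sphereC2 R) :
    (exists k : int, set_val y = (a ^ k * (set_val x).1, b ^ k * (set_val x).2)) ->
    exists k : int, set_val x = (a ^ k * (set_val y).1, b ^ k * (set_val y).2).
  move=> [k yE]; exists (- k); rewrite yE /=.
  rewrite !mulrA -(expfzDr _ _ a0) -(expfzDr _ _ b0) addNr !expr0z !mul1r.
  exact: surjective_pairing.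
split=> [x | x y | y x z].
- by apply/asboolP; exists 0; rewrite !expr0z !mul1r; exact: surjective_pairing.
- by apply/asboolP/asboolP; exact: lensV.
- move=> /asboolP[k yE] /asboolP[l zE]; apply/asboolP; exists (l + k).
  by rewrite zE yE /= !mulrA -(expfzDr _ _ a0) -(expfzDr _ _ b0).
Qed.

Canonical lens_equivRel (R : realType) (p q : nat) :=
  EquivRelPack (@lens_equiv R p q).

Definition lens_space (R : realType) (p q : nat) : topologicalType :=
  quotient_topology {eq_quot @lens_rel R p q}.

(* zv i is i in Z/7; uv j n, vv j n, wv j n are u_(j,n), v_(j,n), w_(j,n);     *)
(* qv n i, rv n i, sv n i are q_(n,i), r_(n,i), s_(n,i).                       *)
Inductive vertex : Type :=
  | zv of 'Z_7
  | uv of nat & nat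
  | vv of nat & nat
  | wv of nat & nat
  | qv of nat & 'Z_7
  | rv of nat & 'Z_7
  | sv of nat & 'Z_7.

Definition vertex_encode (x : vertex) : nat * nat * nat * 'Z_7 :=
  match x with
  | zv i => (0, 0, 0, i)%N
  | uv j n => (1, j, n, 0%R)%N
  | vv j n => (2, j, n, 0%R)%N
  | wv j n => (3, j, n, 0%R)%N
  | qv n i => (4, n, 0, i)%N
  | rv n i => (5, n, 0, i)%N
  | sv n i => (6, n, 0, i)%N
  end.

Definition vertex_decode (c : nat * nat * nat * 'Z_7) : vertex :=
  let: (t, a, b, i) := c in
  match t with
  | 0 => zv i
  | 1 => uv a b
  | 2 => vv a b
  | 3 => wv a b
  | 4 => qv a i
  | 5 => rv a i
  | _ => sv a i
  end%N.

Lemma vertex_encodeK : cancel vertex_encode vertex_decode.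
Proof. by case. Qed.

HB.instance Definition _ := Countable.copy vertex (can_type vertex_encodeK).

Definition zn (k : nat) : vertex := zv k%:R.
Coercion zn : nat >-> vertex.

Definition tet (a b c d : vertex) : seq vertex := [:: a; b; c; d].

Definition T1 : {fset {fset vertex}} := facets_of
  [:: tet 0 1 2 3; tet 1 2 3 4; tet 2 3 4 5; tet 3 4 5 6;
      tet 0 4 5 6; tet 0 1 5 6; tet 0 1 2 6]%N.

Definition T2 : {fset {fset vertex}} := facets_of
  [:: tet 0 2 4 6; tet 1 2 4 6; tet 1 3 4 6; tet 1 3 5 6;
      tet 0 1 3 5; tet 0 2 3 5; tet 0 2 4 5]%N.

Definition T3 : {fset {fset vertex}} := facets_of
  [:: tet 0 1 4 5; tet 1 2 4 5; tet 1 2 5 6; tet 2 3 5 6;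
      tet 0 2 3 6; tet 0 3 4 6; tet 0 1 3 4]%N.

Definition T1_0 : {fset {fset vertex}} :=
  let u := uv 1 0 in let v := vv 1 0 in
  facets_of
  [:: tet u 0 1 2; tet u 0 1 3; tet u 0 2 3; tet u 1 2 4;
      tet u 1 3 4; tet u 2 3 5; tet u 2 4 5;
      tet v 3 4 6; tet v 3 5 6; tet v 0 4 5; tet v 0 4 6;
      tet v 0 1 5; tet v 1 5 6; tet v 0 1 2; tet v 0 2 6;
      tet v 1 2 6;
      tet u v 3 4; tet u v 3 5; tet u v 4 5]%N.

Definition T1_0' : {fset {fset vertex}} :=
  let u := uv 1 0 in let v := vv 1 0 in let w := wv 1 0 in
  ((T1_0 `\` facets_of [:: tet u 0 1 2; tet v 0 1 2]%N)
   `|` facets_of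
   [:: tet u w 0 1; tet u w 0 2; tet u w 1 2;
       tet v w 0 1; tet v w 0 2; tet v w 1 2]%N)%fset.

Definition T4 (n : nat) : {fset {fset vertex}} :=
  let u := uv 4 n in let v := vv 4 n in let w := wv 4 n in
  let q := qv n in let z := zv in
  facets_of (flatten [seq
  [:: tet w u (z i) (z (i + 1));
      tet w (z i) (z (i + 1)) (q (i + 2));
      tet w (z (i - 1)) (q i) (q (i + 1));
      tet v w (q i) (q (i + 1));
      tet v (q i) (z (i + 1)) (z (i + 2));
      tet v (q i) (q (i + 1)) (z (i + 2));
      tet u v (z i) (z (i + 1));
      tet (z (i - 1)) (q i) (q (i + 1)) (z (i + 2));
      tet (z (i - 2)) (z (i - 1)) (q i) (z (i + 1));
      tet (z (i - 1)) (q i) (z (i + 1)) (z (i + 2))]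
  | i <- enum 'Z_7]).

(* The relabelling x |-> a x + n on Z/7, u_(_,_) |-> u_(j,n), and likewise for *)
(* v, w, and q_(_,i) |-> q' i.                                                 *)
Definition relabel_vertex (j n : nat) (a : 'Z_7) (q' : 'Z_7 -> vertex)
    (x : vertex) : vertex :=
  match x with
  | zv i => zv (a * i + n%:R)
  | uv _ _ => uv j n
  | vv _ _ => vv j n
  | wv _ _ => wv j n
  | qv _ i => q' i
  | _ => x
  end.

(* T j n is T_{j,n} for 1 <= j <= 6, and empty for the other values of j; the  *)
(* first three do not involve the vertices q_(_,i).                            *)
Definition T (j n : nat) : {fset {fset vertex}} :=
  match j with
  | 1 | 2 | 3 =>
      relabel (relabel_vertex j n (2 ^+ j.-1)%R (qv n))
        (if (n <= 6)%N then T1_0 else T1_0')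
  | 4 => T4 n
  | 5 => relabel (relabel_vertex 5 n 2%R (rv n)) (T4 0)
  | 6 => relabel (relabel_vertex 6 n 4%R (sv n)) (T4 0)
  | _ => fset0
  end%N.

(* Main.v *)
From HB Require Import structures.
Require Import Defs.
From mathcomp Require Import all_boot all_order all_algebra finmap.
From mathcomp Require Import all_classical all_reals all_analysis.
From mathcomp Require Import complex.
From mathcomp Require Import zify ring lra.

(** The unions of the theorem reduce to eleven explicit finite complexes.
    The complexes [T4], [T5] and [T6] have a cyclic symmetry of order 7 that
    absorbs the shift by [n], and they are obtained from each other by
    multiplying the integers modulo 7 by 2.  So a union is determined, up to the
    names of its vertices, by the quotient of two powers of 2 modulo 7 and by the
    choice between [T_j], [T_(j,0)] and [T_(j,7)] where [j <= 3]
    ([triangulates_ball_ring], [triangulates_two_rings]).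

    Each of the eleven complexes is connected by bistellar flips to a standard
    triangulation of the manifold in question.  Flips preserve the homeomorphism
    type; they are realized by explicit piecewise linear maps ([flip_mapP]).  The
    lens spaces and the projective space are quotients of spheres, and flips are
    made upstairs, equivariantly.  A complex with a free action of the finite
    group [G] has the vertex set [nat * G], on which [G] acts by translation of
    the second factor ([deck]), and is given by one facet of each orbit
    ([orbits]).  A flip of the quotient lifts to flips of all the translates of a
    face; it induces an equivariant homeomorphism of the realizations
    ([flip_equivalent]).  After the last flip, forgetting [G] maps the cover onto
    a complex on [nat], and the fibres are the orbits provided that distinct
    facets are matched over their common vertices by a single translation
    ([evenly_covered], [forget_fiber]).

    Thus a triangulation of [M], or of the quotient of [M] by an equivalence
    relation, results from a list of flips and a continuous map from the compact
    space [M] onto the realization of the initial complex, under which [G] induces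
    the relation ([triangulates_flips], [triangulates_flips_quotient]).  A
    continuous bijection from a compact space to a Hausdorff space is a
    homeomorphism, so maps are needed in this direction only.  The initial maps
    are as follows.
    - For the sphere and the projective space, the radial projection to the
      boundary of the cross-polytope ([sphere_to_cross]), where the antipodal map
      exchanges opposite vertices.
    - For the lens space [L(p, q)], the sphere in the complex plane squared is the
      join of two circles, which are replaced by regular polygons with [2 p]
      sides ([sphereC2_to_join]).  Multiplication by roots of unity rotates the
      polygons ([lens_relP]).
    - For the product of a 2-sphere and a circle, the staircase triangulation of
      the product of an octahedron and a square.  Its points are the monotone
      couplings of the pairs of points of the factors ([product_param_range]).

    The lists of flips and the tables that identify the final complexes are
    checked by computation ([certifies]). *)

Set Implicit Arguments.
Unset Strict Implicit.
Unset Printing Implicit Defensive.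

Import Order.TTheory GRing.Theory Num.Theory.
Import numFieldNormedType.Exports.

Local Open Scope classical_set_scope.
Local Open Scope ring_scope.

(** * Continuous maps into realizations *)

(** A closed subset of a compact space has a compact, hence closed, image in a
    Hausdorff space, so the inverse of a continuous bijection is continuous. *)
Lemma compact_to_hausdorff (X Y : topologicalType) (f : X -> Y) :
  compact [set: X] -> hausdorff_space Y -> continuous f -> injective f ->
  range f = setT -> homeomorphic Y X.
Proof.
move=> cX hY cf fI fT.
have /choice[g gK] : forall y, exists x, f x = y.
  move=> y; have [x _ <-] : range f y by rewrite fT.
  by exists x.
exists g, f; split=> //; first by move=> x; apply: fI; rewrite gK.
apply/continuous_closedP => C cC.
have -> : g @^-1` C = f @` C.
  apply/seteqP; split=> [y Cgy|_ [x Cx <-]] /=; first by exists (g y).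
  by rewrite (_ : g (f x) = x)//; apply: fI; rewrite gK.
apply: compact_closed => //; apply: continuous_compact.
  exact: continuous_subspaceT.
by apply: (subclosed_compact cC cX).
Qed.

Lemma continuous_ptws (R : realType) (V : choiceType) (X : topologicalType)
    (f : X -> {ptws V -> R}) :
  (forall v, continuous (fun x => f x v)) -> continuous f.
Proof.
move=> cf x; apply/cvg_sup => v U [/= _ [[W oW <-] /= Wfx]] /filterS; apply.
by apply: (cf v x); apply: open_nbhs_nbhs.
Qed.

Lemma ptws_eval_continuous (R : realType) (V : choiceType) (v : V) :
  continuous (fun x : {ptws V -> R} => x v).
Proof. exact: (@proj_continuous V (fun=> R : topologicalType) v). Qed.

Lemma set_type_hausdorff (X : topologicalType) (A : set X) :
  hausdorff_space X -> hausdorff_space (set_type A).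
Proof.
rewrite !open_hausdorff => hX x y xy.
have /hX[[U W] /= [Ux Wy] [oU oW UW]] : set_val x != set_val y.
  by apply: contra xy => /eqP/val_inj ->.
exists (set_val @^-1` U, set_val @^-1` W) => /=.
  by rewrite !inE in Ux Wy *.
split; [by exists U | by exists W|].
by apply/eqP; rewrite -preimage_setI (eqP UW) preimage_set0.
Qed.

Lemma realization_hausdorff (R : realType) (V : choiceType)
    (K : {fset {fset V}}) : hausdorff_space (set_type (@realization R V K)).
Proof.
apply: set_type_hausdorff; apply: hausdorff_product => _.
exact: Rhausdorff.
Qed.

Section Triangulation.
Variables (R : realType) (V : choiceType) (K : {fset {fset V}}).

Lemma corestrict (X : topologicalType) (F : X -> {ptws V -> R}) :
  continuous F -> range F = realization K ->
  exists2 f : X -> set_type (@realization R V K),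
    continuous f & (forall x, set_val (f x) = F x) /\ range f = setT.
Proof.
move=> cF FK.
have Fx x : F x \in realization K by rewrite -FK inE; exists x.
exists (fun x => SigSub (Fx x)); first exact: continuous_comp_initial.
split=> //; apply/seteqP; split=> // y _.
have [x _ Fxy] : range F (set_val y) by rewrite FK; exact: set_valP.
exists x => //.
by apply: val_inj.
Qed.

Lemma triangulates_bij (M : topologicalType) (F : M -> {ptws V -> R}) :
  compact [set: M] -> continuous F -> injective F -> range F = realization K ->
  triangulates R K M.
Proof.
move=> cM cF Fi /(corestrict cF)[f cf [fF fT]].
apply: (compact_to_hausdorff cM _ cf) => //; first exact: realization_hausdorff.
by move=> x y fxy; apply: Fi; rewrite -!fF fxy.
Qed.

(** The map descends to a continuous bijection on the quotient, which is compact
    as an image of a compact space. *)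
Lemma triangulates_quotient (W : topologicalType) (e : equiv_rel W)
    (F : W -> {ptws V -> R}) :
  compact [set: W] -> continuous F -> (forall x y, F x = F y <-> e x y) ->
  range F = realization K ->
  triangulates R K (quotient_topology {eq_quot e}%qT).
Proof.
move=> cW cF Fe FK.
have FE : {homo F : a b / \pi_(quotient_topology {eq_quot e}%qT)%qT a
    == \pi_(quotient_topology {eq_quot e}%qT)%qT b >-> a == b}.
  by move=> a b /eqP/eqmodP ab; apply/eqP/Fe.
have reprE x : F (repr (\pi_(quotient_topology {eq_quot e}%qT)%qT x)) = F x.
  by apply/eqP/FE; rewrite reprK.
apply: (@triangulates_bij (quotient_topology {eq_quot e}%qT) (F \o repr)).
- have -> : [set: quotient_topology {eq_quot e}%qT] =
    range \pi_(quotient_topology {eq_quot e}%qT)%qT.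
    apply/seteqP; split=> // q _; exists (repr q) => //; exact: reprK.
  apply: continuous_compact => //; apply: continuous_subspaceT.
  exact: pi_continuous.
- exact: repr_comp_continuous.
- by move=> p q /= /Fe/eqmodP; rewrite !reprK.
- rewrite -FK; apply/seteqP; split=> _ [x _ <-]; first by exists (repr x).
  by exists (\pi_(quotient_topology {eq_quot e}%qT)%qT x) => //=; exact: reprE.
Qed.

End Triangulation.

Section Continuity.
Variables (R : realType) (X : topologicalType).

Lemma continuous_add (f g : X -> R) :
  continuous f -> continuous g -> continuous (fun x => f x + g x).
Proof. by move=> cf cg x; apply: cvgD; [exact: cf|exact: cg]. Qed.

Lemma continuous_opp (f : X -> R) : continuous f -> continuous (fun x => - f x).
Proof. by move=> cf x; apply: cvgN; exact: cf. Qed.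

Lemma continuous_mul (f g : X -> R) :
  continuous f -> continuous g -> continuous (fun x => f x * g x).
Proof. by move=> cf cg x; apply: cvgM; [exact: cf|exact: cg]. Qed.

Lemma continuous_const (c : R) : continuous (fun _ : X => c).
Proof. by move=> x; exact: cvg_cst. Qed.

Lemma continuous_sum (I : Type) (r : seq I) (f : I -> X -> R) :
  (forall i, continuous (f i)) -> continuous (fun x => \sum_(i <- r) f i x).
Proof.
move=> cf x; elim: r => [|i r IH].
  rewrite (_ : (fun y => _) = fun=> 0); first exact: cvg_cst.
  by apply/funext => y; rewrite big_nil.
rewrite (_ : (fun y => _) = fun y => f i y + \sum_(j <- r) f j y).
  by apply: cvgD; [exact: cf|exact: IH].
by apply/funext => y; rewrite big_cons.
Qed.

Lemma continuous_minr (f g : X -> R) :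
  continuous f -> continuous g -> continuous (fun x => Num.min (f x) (g x)).
Proof.
by move=> cf cg x; apply: (@continuous_min R X f g); [exact: cf|exact: cg].
Qed.

Lemma continuous_maxr (f g : X -> R) :
  continuous f -> continuous g -> continuous (fun x => Num.max (f x) (g x)).
Proof.
by move=> cf cg x; apply: (@continuous_max R X f g); [exact: cf|exact: cg].
Qed.

Lemma continuous_norm (f : X -> R) :
  continuous f -> continuous (fun x => `|f x|).
Proof. by move=> cf x; apply: continuous_comp; [exact: cf|exact: norm_continuous]. Qed.

Lemma continuous_div (f g : X -> R) : continuous f -> continuous g ->
  (forall x, g x != 0) -> continuous (fun x => f x / g x).
Proof.
move=> cf cg g0; apply: continuous_mul => // x.
by apply: continuousV => //; exact: cg.
Qed.

Lemma continuous_bigmin (I : Type) (r : seq I) (f : I -> X -> R) :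
  (forall i, continuous (f i)) ->
  continuous (fun x => \big[Num.min/1]_(i <- r) f i x).
Proof.
move=> cf; elim: r => [|i r IH] x.
  rewrite (_ : (fun y => _) = fun=> 1); first exact: cvg_cst.
  by apply/funext => y; rewrite big_nil.
rewrite (_ : (fun y => _) = fun y => Num.min (f i y) (\big[Num.min/1]_(j <- r) f j y)).
  by apply: continuous_minr => // {}x; exact: IH.
by apply/funext => y; rewrite big_cons.
Qed.

End Continuity.

(** * Bistellar flips *)

Section FlipMap.
Variables (R : realType) (V : choiceType).
Implicit Types (K : {fset {fset V}}) (F s t : {fset V}) (x : V -> R).

(** The initial value 1 bounds the coordinates of every point of a realization. *)
Definition coord_min s x : R := \big[Num.min/1]_(v <- s) x v.

Definition barycenter s (v : V) : R := (v \in s)%:R / #|` s|%:R.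

Lemma le_coord_min s x (c : R) :
  (c <= coord_min s x) = (c <= 1) && all (fun v => c <= x v) s.
Proof.
rewrite /coord_min; elim: (s : seq V) => [|v r IH] /=.
  by rewrite big_nil andbT.
by rewrite big_cons le_min IH andbCA.
Qed.

Lemma coord_min_le s x v : v \in s -> coord_min s x <= x v.
Proof.
by move=> vs; have := lexx (coord_min s x);
  rewrite le_coord_min => /andP[_ /allP]; apply.
Qed.

Lemma coord_min_le1 s x : coord_min s x <= 1.
Proof. by have := lexx (coord_min s x); rewrite le_coord_min => /andP[]. Qed.

Lemma coord_min_ge0 s x : (forall v, 0 <= x v) -> 0 <= coord_min s x.
Proof.
by move=> x0; rewrite le_coord_min ler01; apply/allP => v _; exact: x0.
Qed.

Lemma coord_min_eq0 s x v :
  (forall v, 0 <= x v) -> v \in s -> x v = 0 -> coord_min s x = 0.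
Proof.
move=> x0 vs xv; apply/eqP; rewrite eq_le coord_min_ge0 // andbT -xv.
exact: coord_min_le.
Qed.

Lemma coord_min_attained s x :
  s != fset0 -> (forall v, x v <= 1) -> exists2 v, v \in s & x v = coord_min s x.
Proof.
move=> s0 x1; rewrite /coord_min.
have : forall r : seq V, (r == [::]) = false ->
    exists2 v, v \in r & x v = \big[Num.min/1]_(v <- r) x v.
  elim=> [//|a r IH] _; rewrite big_cons.
  have [r0|/negbTE/IH[v vr vE]] := eqVneq r [::].
    by exists a; rewrite ?mem_head // r0 big_nil min_l.
  have [le|lt] := leP (x a) (\big[Num.min/1]_(v <- r) x v).
    by exists a; rewrite ?mem_head.
  by exists v; rewrite ?inE ?vr ?orbT.
apply; apply/negbTE; apply: contra s0 => /eqP s0; apply/eqP/fsetP => v.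
by rewrite (_ : (v \in s) = (v \in (s : seq V))) // s0.
Qed.

Lemma barycenter_ge0 s v : 0 <= barycenter s v.
Proof. by rewrite /barycenter divr_ge0. Qed.

Lemma barycenter_sum s F :
  s != fset0 -> (s `<=` F)%fset -> \sum_(v <- F) barycenter s v = 1.
Proof.
move=> s0 sF; rewrite -(big_fset_incl _ sF); last first.
  by move=> v _ /negbTE vs; rewrite /barycenter vs mul0r.
rewrite (eq_big_seq (fun=> #|` s|%:R^-1)); last first.
  by move=> v vs; rewrite /barycenter vs mul1r.
rewrite big_const_seq count_predT iter_addr_0 -[LHS]mulr_natr mulVf //.
by rewrite pnatr_eq0 cardfs_eq0.
Qed.

Variables (I : finType).
Implicit Types (S T : I -> {fset V}).

(** A bistellar flip replaces, inside the simplex spanned by two disjoint faces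
    [S] and [T], the facets that miss one vertex of [T] by the facets that miss
    one vertex of [S].  Both sets of facets triangulate a ball, and they are
    exchanged by sliding a point along the segment from the barycentre of [S] to
    that of [T] until a coordinate over [S] vanishes.  A family of flips is done
    at once, because flips have to be made equivariantly. *)
Definition flip_map S T (x : V -> R) : V -> R := fun v =>
  x v + \sum_i #|` S i|%:R * coord_min (S i) x *
    (barycenter (T i) v - barycenter (S i) v).

(** The condition is used twice, also with the two complexes and the two families
    exchanged. The last clause separates the members of the family: a point that
    one flip moves is fixed by all the others. *)
Definition half_flip K K' S T :=
  [/\ forall i, S i != fset0 /\ [disjoint S i & T i]%fset,
      forall F, F \in K ->
        F \in K' /\ (forall i, ~~ (S i `<=` F)%fset /\ ~~ (T i `<=` F)%fset) \/
        exists i u, u \in T i /\ F = ((S i `|` T i) `\ u)%fset,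
      forall i u, u \in S i -> ((S i `|` T i) `\ u)%fset \in K' &
      forall i j, i != j ->
        ~~ (S j `<=` S i `|` T i)%fset /\ ~~ (T j `<=` S i `|` T i)%fset].

Lemma flip_map_id S T x :
  (forall i, coord_min (S i) x = 0) -> flip_map S T x = x.
Proof.
move=> m0; apply/funext => v; rewrite /flip_map big1 ?addr0 // => i _.
by rewrite m0 mulr0 mul0r.
Qed.

Lemma flip_map_single S T x i :
  (forall j, j != i -> coord_min (S j) x = 0) -> forall v,
  flip_map S T x v = x v + #|` S i|%:R * coord_min (S i) x *
    (barycenter (T i) v - barycenter (S i) v).
Proof.
move=> m0 v; rewrite /flip_map (bigD1 i) //= big1 ?addr0 // => j ji.
by rewrite m0 // mulr0 mul0r.
Qed.

Lemma coord_min_not_sub s F x :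
  (forall v, 0 <= x v) -> (forall v, v \notin F -> x v = 0) ->
  ~~ (s `<=` F)%fset -> coord_min s x = 0.
Proof.
move=> x0 xF /fsubsetPn[v vs vF]; apply: (coord_min_eq0 x0 vs); exact: xF.
Qed.

(** Let [m] be the least coordinate of the point over [S i]. The flip subtracts
    [m] over [S i], which makes a coordinate vanish there, and spreads the mass
    evenly over [T i], where the least coordinate was 0. The flip back therefore
    moves the same mass along the same segment. *)
Lemma flip_mapP K K' S T x :
  half_flip K K' S T -> (forall i, T i != fset0) -> realization K x ->
  realization K' (flip_map S T x) /\ flip_map T S (flip_map S T x) = x.
Proof.
move=> [S0 Kcases K'S indep] T0 [F FK [x0 xF x1]].
have [[FK' nST]|[i [u [uT FE]]]] := Kcases _ FK.
  have e : flip_map S T x = x.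
    by apply: flip_map_id => i; apply: (coord_min_not_sub x0 xF); case: (nST i).
  rewrite e; split; first by exists F.
  by apply: flip_map_id => i; apply: (coord_min_not_sub x0 xF); case: (nST i).
have [Si0 dST] := S0 i.
have xU v : v \notin (S i `|` T i)%fset -> x v = 0.
  by move=> vU; apply: xF; rewrite FE in_fsetD1 negb_and vU orbT.
have xu : x u = 0 by apply: xF; rewrite FE in_fsetD1 eqxx.
have le1 v : x v <= 1.
  have [vF|/xF ->] := boolP (v \in F); last exact: ler01.
  by rewrite -x1 (big_fsetD1 v) //= lerDl sumr_ge0.
have m0 j : j != i -> coord_min (S j) x = 0.
  rewrite eq_sym => ij; apply: (coord_min_not_sub x0 xU).
  by case: (indep _ _ ij).
have [a aS am] := coord_min_attained Si0 le1.
set m := coord_min (S i) x in am *.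
have mge0 : 0 <= m by apply: coord_min_ge0.
have nS : #|` S i|%:R != 0 :> R by rewrite pnatr_eq0 cardfs_eq0.
have nT : #|` T i|%:R != 0 :> R by rewrite pnatr_eq0 cardfs_eq0.
have inT v : v \in S i -> v \in T i = false.
  by move=> vS; apply/negbTE; apply: (fdisjointP dST).
set y := flip_map S T x.
have yE v : y v = x v + #|` S i|%:R * m *
    (barycenter (T i) v - barycenter (S i) v) by exact: flip_map_single.
have yS v : v \in S i -> y v = x v - m.
  move=> vS; rewrite yE /barycenter vS inT // mul0r sub0r mul1r.
  by rewrite mulrN mulrAC mulfV // mul1r.
have yT v : v \notin S i -> y v = x v + #|` S i|%:R * m * barycenter (T i) v.
  by move=> /negbTE vS; rewrite yE {2}/barycenter vS mul0r subr0.
have y0 v : 0 <= y v.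
  have [vS|vS] := boolP (v \in S i).
    by rewrite yS // subr_ge0 coord_min_le.
  by rewrite yT // addr_ge0 // mulr_ge0 ?mulr_ge0 ?barycenter_ge0.
have aU : a \in (S i `|` T i)%fset by rewrite in_fsetU aS.
have ya : y a = 0 by rewrite yS // am subrr.
have yU v : v \notin (S i `|` T i)%fset -> y v = 0.
  move=> vU; move: (vU); rewrite in_fsetU negb_or => /andP[vS vT].
  by rewrite yT // (xU _ vU) /barycenter (negbTE vT) mul0r mulr0 addr0.
have uU : u \in (S i `|` T i)%fset by rewrite in_fsetU uT orbT.
have ysum : \sum_(v <- (S i `|` T i)%fset) y v = 1.
  rewrite (eq_bigr _ (fun v _ => yE v)) big_split /= -mulr_sumr sumrB.
  rewrite !barycenter_sum ?fsubsetUl ?fsubsetUr // subrr mulr0 addr0.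
  by rewrite (big_fsetD1 u) //= xu add0r -FE.
split.
  exists ((S i `|` T i) `\ a)%fset; [exact: K'S | split=> //].
    by move=> v; rewrite in_fsetD1 negb_and negbK => /orP[/eqP -> //|/yU].
  by move: ysum; rewrite (big_fsetD1 a) //= ya add0r.
have n0 j : j != i -> coord_min (T j) y = 0.
  rewrite eq_sym => ij; apply: (coord_min_not_sub y0 yU).
  by case: (indep _ _ ij).
have uS : u \notin S i by apply/negP => /inT; rewrite uT.
have minT : #|` T i|%:R * coord_min (T i) y = #|` S i|%:R * m.
  have vT v : v \in T i -> y v = x v + #|` S i|%:R * m / #|` T i|%:R.
    move=> vT; rewrite yT; last by apply/negP => /inT; rewrite vT.
    by rewrite /barycenter vT mul1r.
  have ->: coord_min (T i) y = #|` S i|%:R * m / #|` T i|%:R; last first.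
    by rewrite mulrC divfK.
  apply/eqP; rewrite eq_le; apply/andP; split.
    by have := coord_min_le y uT; rewrite (vT _ uT) xu add0r.
  have yle1 v : y v <= 1.
    have [vU|/yU -> //] := boolP (v \in (S i `|` T i)%fset).
    by rewrite -ysum (big_fsetD1 v) //= lerDl sumr_ge0.
  have [b bT <-] := coord_min_attained (T0 i) yle1.
  by rewrite vT // lerDr.
apply/funext => v; rewrite (flip_map_single _ n0) minT yE -addrA.
by rewrite -mulrDr -[X in _ * (_ + X)]opprB subrr mulr0 addr0.
Qed.

Lemma flip_map_continuous S T :
  continuous (flip_map S T : {ptws V -> R} -> {ptws V -> R}).
Proof.
have cm s : continuous (coord_min s : {ptws V -> R} -> R).
  by apply: continuous_bigmin => v; exact: ptws_eval_continuous.
apply: continuous_ptws => v; apply: (@continuous_add R {ptws V -> R}).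
  exact: ptws_eval_continuous.
apply: (@continuous_sum R {ptws V -> R}) => i.
apply: (@continuous_mul R {ptws V -> R}); last exact: continuous_const.
apply: (@continuous_mul R {ptws V -> R}); first exact: continuous_const.
exact: cm.
Qed.

Lemma flip_map_equivariant S T (f : V -> V) (h : I -> I) x :
  injective f -> bijective h ->
  (forall i, S (h i) = [fset f v | v in S i]%fset) ->
  (forall i, T (h i) = [fset f v | v in T i]%fset) ->
  flip_map S T (x \o f) = flip_map S T x \o f.
Proof.
move=> fI hB hS hT; apply/funext => v; rewrite /flip_map /=; congr (_ + _).
rewrite [RHS](reindex h) /=; last exact: onW_bij.
have barE s : barycenter [fset f v | v in s]%fset (f v) = barycenter s v.
  by rewrite /barycenter mem_imfset // card_imfset.
apply: eq_bigr => i _; rewrite hS hT !barE card_imfset //; congr (_ * _ * _).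
apply/le_anti; rewrite !le_coord_min !coord_min_le1 /=; apply/andP; split.
  by apply/allP => _ /imfsetP[w /= wS ->]; exact: coord_min_le (x \o f) _ wS.
by apply/allP => w wS; apply: coord_min_le; apply/imfsetP; exists w.
Qed.

End FlipMap.

(** * Complexes with a free group action *)

Section OrbitComplex.
Variables (R : realType) (G : finZmodType).
Notation V := (nat * G)%type.
Implicit Types (v : V) (s t F : seq V) (L : seq (seq V)) (x : V -> R) (g : G).

Definition deck g (v : V) : V := (v.1, v.2 + g).

Lemma deck_inj g : injective (deck g).
Proof. by move=> [i a] [j b] [-> /addIr ->]. Qed.

Lemma deckD g h v : deck g (deck h v) = deck (h + g) v.
Proof. by rewrite /deck /= addrA. Qed.

Lemma deck0 v : deck 0 v = v.
Proof. by rewrite /deck addr0 -surjective_pairing. Qed.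

Definition translate g s : {fset V} := [fset x in map (deck g) s]%fset.

Lemma in_translate g s v : (v \in translate g s) = (deck (- g) v \in s).
Proof.
rewrite /translate in_fset /=; apply/mapP/idP => [[w ws ->]|vs].
  by rewrite deckD subrr deck0.
by exists (deck (- g) v) => //; rewrite deckD addNr deck0.
Qed.

Lemma translateD g h s :
  translate (g + h) s = [fset deck h v | v in translate g s]%fset.
Proof.
apply/fsetP => v; have -> : (v \in translate (g + h) s) =
    (deck (- h) v \in translate g s).
  by rewrite !in_translate deckD opprD addrC.
apply/idP/imfsetP => [vs|[w /= ws ->]].
  by exists (deck (- h) v) => //=; rewrite deckD addNr deck0.
by rewrite deckD subrr deck0.
Qed.

(** A list of facets over [nat * G] stands for the complex formed by all their
    translates, so one entry describes a whole orbit. *)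
Definition orbits L : {fset {fset V}} :=
  facets_of [seq map (deck g) F | F <- L, g <- enum G].

Lemma orbitsP L (A : {fset V}) :
  reflect (exists F g, F \in L /\ A = translate g F) (A \in orbits L).
Proof.
rewrite /orbits /facets_of.
apply: (iffP (imfsetP _ _ _ _)) => [[_ /= /allpairsP[[F g] /= [FL _ ->]] ->]|].
  by exists F, g.
move=> [F [g [FL ->]]]; exists (map (deck g) F) => //=.
by apply/allpairsP; exists (F, g) => /=; rewrite mem_enum.
Qed.

(** Commuting with the deck translations makes the map pass to the orbit spaces. *)
Definition equivalent (K K' : {fset {fset V}}) :=
  exists phi : {ptws V -> R} -> {ptws V -> R}, [/\ continuous phi,
    phi @` realization K = realization K',
    forall x y, realization K x -> realization K y -> phi x = phi y -> x = y &
    forall g x, phi (x \o deck g) = phi x \o deck g].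

Lemma equivalent_refl K : equivalent K K.
Proof. by exists id; split=> //; [move=> x; exact: cvg_id|exact: image_id]. Qed.

Lemma equivalent_trans K2 K1 K3 :
  equivalent K1 K2 -> equivalent K2 K3 -> equivalent K1 K3.
Proof.
move=> [f [cf fK fI fG]] [h [ch hK hI hG]]; exists (h \o f); split.
- by move=> x; apply: continuous_comp; [exact: cf|exact: ch].
- by rewrite -image_comp fK.
- move=> x y Kx Ky /= fxy; apply: fI => //; apply: hI => //; rewrite -fK.
    by exists x.
  by exists y.
- by move=> g x /=; rewrite fG hG.
Qed.

(** Matching the first vertex of [s] leaves few translations to try. *)
Definition contains s F : bool :=
  if s is v :: _ then
    has (fun w => (w.1 == v.1) && all (fun u => deck (w.2 - v.2) u \in F) s) F
  else true.

Lemma containsP s F :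
  reflect (exists g, forall v, v \in s -> deck g v \in F) (contains s F).
Proof.
case: s => [|[i a] s]; first by apply: ReflectT; exists 0.
apply: (iffP hasP) => [[w wF /andP[_ /allP sF]]|[g gF]].
  by exists (w.2 - a).
exists (deck g (i, a)); first by apply: gF; rewrite mem_head.
by rewrite eqxx; apply/allP => v /gF; rewrite /= addrC addKr.
Qed.

(** Facets are compared up to translation only. *)
Definition same_facet s F := contains s F && (size F == size s).

(** A flip of the quotient lifts to the family of flips of all the translates of
    a pair of faces [s], [t].  Distinct names over [s ++ t] keep the translates
    apart; the other tests say that the facets around [s] are those of the
    boundary of the simplex [s ++ t], and that [t] is not yet a face. *)
Definition flip (st : seq V * seq V) L : option (seq (seq V)) :=
  let: (s, t) := st in
  let old := [seq rem v (s ++ t) | v <- t] in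
  let new := [seq rem v (s ++ t) | v <- s] in
  let B := [seq F <- L | contains s F] in
  let A := [seq F <- L | ~~ contains s F] in
  if [&& uniq (map fst (s ++ t)), s != [::], t != [::],
         all (fun F => ~~ contains t F) A,
         all (fun F => has (same_facet^~ F) old) B &
         all (fun F => has (same_facet F) B) old]
  then Some (new ++ A) else None.

(** Facets are stored up to translation, so a facet has to be moved onto [s]
    before its other vertices can be compared with those of another facet. *)
Definition align s F : seq V :=
  if s is v :: _ then
    if [seq w <- F | w.1 == v.1] is w :: _ then map (deck (v.2 - w.2)) F else F
  else F.

(** For a flip at [s] these vertices span the new face. *)
Definition opposite s L : seq V :=
  undup (flatten [seq [seq v <- align s F | v \notin s] |
    F <- [seq F <- L | contains s F]]).

(** A flip is recorded by the face that it removes.  A facet is removed by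
    adding a new vertex, which then comes fifth. *)
Fixpoint flips (c : seq (seq V)) L : option (seq (seq V)) :=
  if c is f :: c' then
    let st := if size f == 5 then (take 4 f, drop 4 f) else (f, opposite f L) in
    if flip st L is Some L' then flips c' L' else None
  else Some L.

Lemma same_facetP s F : uniq s -> same_facet s F ->
  exists g, forall h, translate h F = translate (g + h) s.
Proof.
move=> us /andP[/containsP[g sF] /eqP szF]; exists g => h.
have us' : uniq (map (deck g) s) by rewrite map_inj_uniq //; exact: deck_inj.
have sF' : {subset map (deck g) s <= F} by move=> _ /mapP[v vs ->]; exact: sF.
have [|_ FE] := uniq_min_size us' sF'; first by rewrite size_map szF.
apply/fsetP => v; rewrite !in_translate -FE.
apply/mapP/idP => [[w ws]|vs].
  by rewrite opprD addrC -deckD => ->; rewrite deckD subrr deck0.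
exists (deck (- (g + h)) v) => //; rewrite deckD; congr (deck _ v).
by rewrite opprD addrAC addNr add0r.
Qed.

Section Flip.
Variables (s t : seq V) (L L' : seq (seq V)).
Hypothesis stL : flip (s, t) L = Some L'.

Let S g := translate g s.
Let T g := translate g t.
Let A := [seq F <- L | ~~ contains s F].
Let new := [seq rem v (s ++ t) | v <- s].

Let checks : [/\ uniq (map fst (s ++ t)), s != [::] & t != [::]] /\
  [/\ all (fun F => ~~ contains t F) A,
    all (fun F => has (same_facet^~ F) [seq rem v (s ++ t) | v <- t])
      [seq F <- L | contains s F],
    all (fun F => has (same_facet F) [seq F <- L | contains s F])
      [seq rem v (s ++ t) | v <- t] &
    L' = new ++ A].
Proof.
by move: stL; rewrite /flip -/A -/new; case: ifP => // /and5P[? ? ? ? /andP[? ?]] [<-].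
Qed.

Let Vuniq : uniq (s ++ t).
Proof. by case: checks => -[/map_uniq]. Qed.

Let fst_inj v w : v \in s ++ t -> w \in s ++ t -> v.1 = w.1 -> v = w.
Proof.
case: checks => -[u _ _] _; elim: (s ++ t) u => //= a r IH /andP[ar ur].
rewrite !inE => /predU1P[->|vr] /predU1P[->|wr] // e; last exact: IH.
  by case/mapP: ar; exists w.
by case/mapP: ar; exists v.
Qed.

Let in_ST g v : (v \in S g `|` T g)%fset = (deck (- g) v \in s ++ t).
Proof. by rewrite in_fsetU !in_translate mem_cat. Qed.

Let translate_rem g v : v \in s ++ t ->
  translate g (rem v (s ++ t)) = ((S g `|` T g) `\ deck g v)%fset.
Proof.
move=> vst; apply/fsetP => w; rewrite in_fsetD1 in_ST in_translate.
rewrite (rem_filter _ Vuniq) mem_filter /=; congr (~~ _ && _).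
by rewrite -(inj_eq (@deck_inj g)) deckD addNr deck0.
Qed.

(** Two vertices of a translate of [s ++ t] with the same name coincide, so
    another translate has no vertex in common with it. *)
Let nsub g h u : g != h -> u \in s ++ t -> deck h u \notin (S g `|` T g)%fset.
Proof.
move=> gh ust; rewrite in_ST; apply/negP => vst.
have := fst_inj vst ust erefl; case: u {vst ust} => i a [] /eqP.
by rewrite -addrA -[X in _ == X]addr0 (inj_eq (addrI a)) subr_eq0 eq_sym (negbTE gh).
Qed.

Let S_neq0 g : S g != fset0.
Proof.
case: checks => -[_ + _] _; rewrite /S; case: (s) => // v s' _.
by apply/fset0Pn; exists (deck g v); rewrite in_translate deckD subrr deck0 mem_head.
Qed.

Let T_neq0 g : T g != fset0.
Proof.
case: checks => -[_ _ +] _; rewrite /T; case: (t) => // v t' _.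
by apply/fset0Pn; exists (deck g v); rewrite in_translate deckD subrr deck0 mem_head.
Qed.

Let ST_disjoint g : [disjoint S g & T g]%fset.
Proof.
apply/fdisjointP => v; rewrite !in_translate => vs; apply/negP => vt.
move: Vuniq; rewrite cat_uniq => /and3P[_ /hasPn/(_ _ vt) /=].
by rewrite vs.
Qed.

Let sub_contains r F g h : (translate g r `<=` translate h F)%fset -> contains r F.
Proof.
move=> /fsubsetP sub; apply/containsP; exists (g - h) => v vr.
have /sub : deck g v \in translate g r.
  by rewrite in_translate deckD subrr deck0.
by rewrite in_translate deckD.
Qed.

Let indep g h : g != h ->
  ~~ (S h `<=` S g `|` T g)%fset /\ ~~ (T h `<=` S g `|` T g)%fset.
Proof.
move=> gh; split; apply/fsubsetPn.
  have /fset0Pn[v vS] := S_neq0 h; exists v => //.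
  rewrite in_translate in vS; rewrite -[v]deck0 -(addNr h) -deckD.
  by apply: nsub => //; rewrite mem_cat vS.
have /fset0Pn[v vT] := T_neq0 h; exists v => //.
rewrite in_translate in vT; rewrite -[v]deck0 -(addNr h) -deckD.
by apply: nsub => //; rewrite mem_cat vT orbT.
Qed.

Let avoid F g h : F \in A ->
  ~~ (S g `<=` translate h F)%fset /\ ~~ (T g `<=` translate h F)%fset.
Proof.
case: checks => _ [/allP At _ _ _] FA; split.
  by move: FA; rewrite mem_filter => /andP[+ _]; apply: contra; exact: sub_contains.
by apply: contra (At _ FA); exact: sub_contains.
Qed.

Let rem_uniq v : uniq (rem v (s ++ t)).
Proof. exact: rem_uniq. Qed.

Let half_ST : half_flip (orbits L) (orbits L') S T.
Proof.
have [_ [_ /allP Bold _ L'E]] := checks; split=> //.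
- move=> _ /orbitsP[F [g [FL ->]]]; have [sF|nsF] := boolP (contains s F).
    right; have /Bold/hasP[_ /mapP[v vt ->] /(same_facetP (rem_uniq v))[h hE]] :
      F \in [seq F <- L | contains s F] by rewrite mem_filter sF.
    exists (h + g), (deck (h + g) v); split.
      by rewrite in_translate deckD subrr deck0.
    by rewrite hE translate_rem // mem_cat vt orbT.
  have FA : F \in A by rewrite mem_filter nsF.
  left; split; last by move=> h; exact: avoid.
  by apply/orbitsP; exists F, g; rewrite L'E mem_cat FA orbT.
- move=> g v; rewrite in_translate => vs; apply/orbitsP.
  exists (rem (deck (- g) v) (s ++ t)), g; split.
    by rewrite L'E mem_cat; apply/orP; left; apply/mapP; exists (deck (- g) v).
  by rewrite translate_rem ?mem_cat ?vs // deckD addNr deck0.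
Qed.

Let half_TS : half_flip (orbits L') (orbits L) T S.
Proof.
have [_ [_ _ /allP oldB L'E]] := checks; split=> //.
- by move=> g; split=> //; rewrite fdisjoint_sym.
- move=> _ /orbitsP[F [g [+ ->]]]; rewrite L'E mem_cat => /orP[/mapP[v vs ->]|FA].
    right; exists g, (deck g v); split.
      by rewrite in_translate deckD subrr deck0.
    by rewrite fsetUC translate_rem // mem_cat vs.
  left; split; last by move=> h; have [] := avoid h g FA.
  by apply/orbitsP; exists F, g; move: FA; rewrite mem_filter => /andP[].
- move=> g v; rewrite in_translate => vt; rewrite fsetUC.
  have /oldB/hasP[F FB /(same_facetP (rem_uniq _))[h hE]] :
    rem (deck (- g) v) (s ++ t) \in [seq rem v (s ++ t) | v <- t].
    by apply/mapP; exists (deck (- g) v).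
  apply/orbitsP; exists F, (g - h); split.
    by move: FB; rewrite mem_filter => /andP[].
  rewrite hE [h + _]addrC subrK translate_rem ?mem_cat ?vt ?orbT //.
  by rewrite deckD addNr deck0.
- by move=> g h gh; rewrite fsetUC; have [] := indep gh.
Qed.

Lemma flip_equivalent : equivalent (orbits L) (orbits L').
Proof.
exists (flip_map S T); split; first exact: flip_map_continuous.
- apply/seteqP; split=> [_ [x Kx <-]|y Ky].
    by have [] := flip_mapP half_ST T_neq0 Kx.
  have [Kx <-] := flip_mapP half_TS S_neq0 Ky.
  by exists (flip_map T S y).
- move=> x y Kx Ky xy.
  have [_ <-] := flip_mapP half_ST T_neq0 Kx.
  by have [_ <-] := flip_mapP half_ST T_neq0 Ky; rewrite xy.
- move=> g x; apply: (@flip_map_equivariant _ _ _ _ _ _ (fun h => h + g)).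
  + exact: deck_inj.
  + by exists (fun h => h - g) => h; rewrite ?addrK ?subrK.
  + by move=> h; exact: translateD.
  + by move=> h; exact: translateD.
Qed.

End Flip.

End OrbitComplex.

(** * Passing to the quotient by the group *)

Section Quotient.
Variables (R : realType) (G : finZmodType).
Notation V := (nat * G)%type.
Implicit Types (v u : V) (F : seq V) (x y : V -> R) (g : G).

Lemma flips_equivalent (c : seq (seq V)) (L L' : seq (seq V)) :
  flips c L = Some L' -> equivalent R (orbits L) (orbits L').
Proof.
elim: c L => [|f c IH] L; first by case=> <-; exact: equivalent_refl.
rewrite /flips -/flips; case: (if _ then _ else _) => s t.
case E : (flip (s, t) L) => [L1|] // e.
exact: equivalent_trans (flip_equivalent R E) (IH _ e).
Qed.

Lemma realization_deck (L : seq (seq V)) (x : {ptws V -> R}) g :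
  realization (orbits L) x -> realization (orbits L) (x \o deck g).
Proof.
move=> [_ /orbitsP[F [h [FL ->]]] [x0 xF x1]].
have gF v : (deck g v \in translate h F) = (v \in translate (h - g) F).
  by rewrite !in_translate deckD opprB.
exists (translate (h - g) F); first by apply/orbitsP; exists F, (h - g).
split=> [v|v vF|] /=; [exact: x0|by apply: xF; rewrite gF|].
rewrite -x1 (_ : translate h F = [fset deck g v | v in translate (h - g) F]%fset).
  by rewrite [RHS]big_imfset //= => v u _ _; exact: deck_inj.
by rewrite -translateD subrK.
Qed.

(** The translation that matches two facets is the same at all their common
    vertex names, so that facets of the quotient meet as their lifts do. *)
Definition evenly_covered (L : seq (seq V)) : bool :=
  all (fun F => uniq (map fst F)) L &&
  all (fun F => all (fun F' => constant [seq p.2.2 - p.1.2 |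
    p <- [seq p <- [seq (v, v') | v <- F, v' <- F'] | p.1.1 == p.2.1]]) L) L.

Variables (W : choiceType) (name : nat -> W) (L : seq (seq V)).
Hypothesis sepL : evenly_covered L.
Hypothesis name_inj : {in flatten [seq map fst F | F <- L] &, injective name}.

Let K := facets_of [seq [seq name v.1 | v <- F] | F <- L].

Let U : {fset V} :=
  [fset v in [seq (i, g) | i <- flatten [seq map fst F | F <- L], g <- enum G]]%fset.

(** The coordinates of all the vertices over a vertex of the quotient are added
    up. The sum has at most one nonzero term on the points of a complex whose
    facets have distinct names. *)
Definition forget (x : {ptws V -> R}) : {ptws W -> R} :=
  fun w => \sum_(v <- U) (name v.1 == w)%:R * x v.

Let inU F g v : F \in L -> v \in translate g F -> v \in U.
Proof.
move=> FL; rewrite in_translate => vF; rewrite in_fset /=.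
apply/allpairsPdep; exists v.1, v.2; split; rewrite ?mem_enum //;
  last exact: surjective_pairing.
apply/flattenP; exists (map fst F); first exact: map_f.
by apply/mapP; exists (deck (- g) v).
Qed.

Let fst_inj F g v u : F \in L -> v \in translate g F -> u \in translate g F ->
  name v.1 = name u.1 -> v = u.
Proof.
move=> FL; rewrite !in_translate => vF uF /name_inj vu.
have idF w : deck (- g) w \in F -> w.1 \in flatten [seq map fst F | F <- L].
  move=> wF; apply/flattenP; exists (map fst F); first exact: map_f.
  by apply/mapP; exists (deck (- g) w).
have {}vu := vu (idF _ vF) (idF _ uF).
have /andP[/allP/(_ _ FL) uF1 _] := sepL.
apply: (@deck_inj _ (- g)); move: vF uF uF1; rewrite /deck /= vu.
elim: F {FL idF} => //= a r IH; rewrite !inE.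
move=> /predU1P[va|vr] /predU1P[ua|ur] /andP[ar]; last exact: IH.
- by rewrite va ua.
- by case/mapP: ar; exists (u.1, u.2 - g); rewrite -?va.
- by case/mapP: ar; exists (u.1, v.2 - g); rewrite -?ua.
Qed.

Let forgetE F g x v : F \in L -> (forall u, u \notin translate g F -> x u = 0) ->
  v \in translate g F -> forget x (name v.1) = x v.
Proof.
move=> FL x0 vF; rewrite /forget (big_fsetD1 v) /=; last exact: inU vF.
rewrite eqxx mul1r big_seq big1 ?addr0 // => u.
rewrite in_fsetD1 => /andP[uv _].
have [uF|/x0 ->] := boolP (u \in translate g F); last by rewrite mulr0.
by case: eqP => [/(fst_inj FL uF vF) e|_]; [rewrite e eqxx in uv|rewrite mul0r].
Qed.

Let forget0 F g x w : (forall u, u \notin translate g F -> x u = 0) ->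
  (forall v, v \in translate g F -> name v.1 <> w) -> forget x w = 0.
Proof.
move=> x0 nw; rewrite /forget big1 // => u _.
have [/nw/eqP/negbTE ->|/x0 ->] := boolP (u \in translate g F).
  by rewrite mul0r.
by rewrite mulr0.
Qed.

Let forget_ge0 x : (forall v, 0 <= x v) -> forall w, 0 <= forget x w.
Proof. by move=> x0 w; apply: sumr_ge0 => v _; rewrite mulr_ge0. Qed.

Let image_facet F g : [fset name v.1 | v in translate g F]%fset =
  [fset w in [seq name v.1 | v <- F]]%fset.
Proof.
apply/fsetP => w; rewrite in_fset /=; apply/imfsetP/mapP => [[v /= vF ->]|[v vF ->]].
  by exists (deck (- g) v) => //; rewrite -in_translate.
by exists (deck g v) => //=; rewrite in_translate deckD subrr deck0.
Qed.

Lemma forget_continuous : continuous forget.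
Proof.
apply: continuous_ptws => w; apply: (@continuous_sum R {ptws V -> R}) => v.
apply: (@continuous_mul R {ptws V -> R}); first exact: continuous_const.
exact: ptws_eval_continuous.
Qed.

Lemma forget_image : forget @` realization (orbits L) = realization K.
Proof.
apply/seteqP; split=> [_ [x [_ /orbitsP[F [g [FL ->]]] [x0 xF x1]] <-]|y].
  exists [fset w in [seq name v.1 | v <- F]]%fset.
    by apply/imfsetP; exists [seq name v.1 | v <- F] => //=; apply: map_f.
  split; first exact: forget_ge0.
    move=> w; rewrite -(image_facet F g) => wF; apply: (forget0 xF) => v vF vw.
    by case/imfsetP: wF; exists v.
  rewrite -(image_facet F g) big_imfset /=; last by move=> v u vF uF; exact: (fst_inj FL vF uF).
  by rewrite -x1; apply: eq_big_seq => v vF; exact: (forgetE FL xF).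
move=> [_ /imfsetP[_ /= /mapP[F FL ->] ->] [y0 yF y1]].
pose x v : R := if v \in translate 0 F then y (name v.1) else 0.
have xF v : v \notin translate 0 F -> x v = 0 by rewrite /x => /negbTE ->.
have xE v : v \in translate 0 F -> x v = y (name v.1) by rewrite /x => ->.
exists x.
  exists (translate 0 F); first by apply/orbitsP; exists F, 0.
  split=> //; first by move=> v; rewrite /x; case: ifP.
  rewrite -y1 -(image_facet F 0) [RHS]big_imfset /=; last first.
    by move=> v u vF uF; exact: (fst_inj FL vF uF).
  by apply: eq_big_seq => v; exact: xE.
apply/funext => w; have [/imfsetP[v /= vF ->]|wF] :=
  boolP (w \in [fset name v.1 | v in translate 0 F]%fset).
  by rewrite (forgetE FL xF vF) xE.
rewrite yF -?(image_facet F 0) //; apply: (forget0 xF) => v vF vw.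
by case/imfsetP: wF; exists v.
Qed.

Let evenly_coveredP F F' v u v' u' : F \in L -> F' \in L ->
  v \in F -> u \in F -> v' \in F' -> u' \in F' ->
  v.1 = v'.1 -> u.1 = u'.1 -> v'.2 - v.2 = u'.2 - u.2.
Proof.
move=> FL F'L vF uF v'F u'F vv uu.
have /andP[_ /allP/(_ _ FL)/allP/(_ _ F'L)] := sepL.
set s := map _ _ => /(constantP 0)[d sd].
have in_s a b : a \in F -> b \in F' -> a.1 = b.1 -> b.2 - a.2 \in s.
  move=> aF bF ab; apply/mapP; exists (a, b) => //.
  by rewrite mem_filter /= ab eqxx; apply/allpairsP; exists (a, b).
have := in_s _ _ vF v'F vv; have := in_s _ _ uF u'F uu.
by rewrite sd => /nseqP[-> _] /nseqP[-> _].
Qed.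

(** If two points have the same image, their supports have the same names. The
    facets that contain the points differ over these names by one translation, and
    this translation carries the one point to the other. *)
Lemma forget_fiber x y : realization (orbits L) x -> realization (orbits L) y ->
  forget x = forget y <-> exists g, y = x \o deck g.
Proof.
move=> [_ /orbitsP[F [g [FL ->]]] [x0 xF x1]].
move=> [_ /orbitsP[F' [g' [F'L ->]]] [y0 yF y1]].
split=> [xy|[h yE]]; last first.
  have yF2 v : v \notin translate (g - h) F -> y v = 0.
    rewrite in_translate yE /= => vF; apply: xF; rewrite in_translate deckD.
    by move: vF; rewrite opprB.
  apply/funext => w; have [/imfsetP[v /= vF ->]|wF] :=
    boolP (w \in [fset name v.1 | v in translate g F]%fset).
    rewrite (forgetE FL xF vF) -[v.1]/((deck (- h) v).1) (forgetE FL yF2).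
      by rewrite yE /= deckD addNr deck0.
    by move: vF; rewrite !in_translate deckD opprB addKr.
  rewrite (forget0 xF) ?(forget0 yF2) // => v vF vw; case/imfsetP: wF.
    by exists (deck h v) => //=; move: vF; rewrite !in_translate deckD opprB.
  by exists v.
have memN k H v : v \in translate k H -> deck (- k) v \in H by rewrite in_translate.
have name1 v v' : v \in translate g F -> v' \in translate g' F' ->
    name v.1 = name v'.1 -> v.1 = v'.1.
  move=> /memN vF /memN vF'; apply: name_inj.
    by apply/flattenP; exists (map fst F); [exact: map_f|exact: (map_f fst vF)].
  by apply/flattenP; exists (map fst F'); [exact: map_f|exact: (map_f fst vF')].
have [h hP] : exists h, forall v v', v \in translate g F ->
    v' \in translate g' F' -> v.1 = v'.1 -> v = deck h v'.
  have [[v [v' [vF v'F vv]]]|none] := pselect (exists v v',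
      [/\ v \in translate g F, v' \in translate g' F' & v.1 = v'.1]); last first.
    by exists 0 => v v' vF v'F vv; case: none; exists v, v'.
  exists (v.2 - v'.2) => u u' uF u'F uu; rewrite [LHS]surjective_pairing.
  congr (_, _) => //.
  have /= := evenly_coveredP FL F'L (memN _ _ _ vF) (memN _ _ _ uF) (memN _ _ _ v'F)
    (memN _ _ _ u'F) vv uu.
  rewrite !opprD !opprK addrACA [RHS]addrACA => /addIr vu.
  by rewrite -[v.2 - _]opprB vu opprB addrC subrK.
exists h; apply/funext => w /=.
have [wF'|wF'] := boolP (w \in translate g' F').
  rewrite -(forgetE F'L yF wF') -xy.
  have [wF|wF] := boolP (deck h w \in translate g F).
    by rewrite -(forgetE FL xF wF).
  rewrite xF // (forget0 xF) // => v vF /(name1 _ _ vF wF') vw.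
  by rewrite -(hP _ _ vF wF' vw) vF in wF.
rewrite yF //; have [wF|/xF -> //] := boolP (deck h w \in translate g F).
rewrite -(forgetE FL xF wF) xy (forget0 yF) // => v' v'F e.
have := hP _ _ wF v'F (name1 _ _ wF v'F (esym e)).
by move/deck_inj => wv; rewrite wv v'F in wF'.
Qed.

End Quotient.

Section Transport.
Variables (R : realType) (G : finZmodType) (M : topologicalType).
Variables (L0 L : seq (seq (nat * G))) (c : seq (seq (nat * G))).
Variable F0 : M -> {ptws (nat * G)%type -> R}.
Hypotheses (F0c : continuous F0) (F0K : range F0 = realization (orbits L0)).
Hypotheses (cL : flips c L0 = Some L) (covL : evenly_covered L).
Variables (W : choiceType) (name : nat -> W).
Hypothesis name_inj : {in flatten [seq map fst F | F <- L] &, injective name}.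

Let K := facets_of [seq [seq name v.1 | v <- F] | F <- L].

(** The flips and the passage to the quotient are absorbed by one continuous map,
    so a triangulation of [M] results from a single map [F0] on [M] that has the
    right image and the right fibres. *)
Let transport : exists F : M -> {ptws W -> R}, [/\ continuous F,
  range F = realization K &
  forall x y, F x = F y <-> exists g, F0 y = F0 x \o deck g].
Proof.
have [phi [phic phiK phiI phiG]] := flips_equivalent R cL.
pose pr := forget (R := R) name L.
have F0in x : realization (orbits L0) (F0 x) by rewrite -F0K; exists x.
have phiin x : realization (orbits L) (phi (F0 x)) by rewrite -phiK; exists (F0 x).
exists (fun x => pr (phi (F0 x))); split.
- move=> x; apply: (@continuous_comp _ _ _ F0 (pr \o phi)); first exact: F0c.
  apply: continuous_comp; [exact: phic|exact: forget_continuous].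
- rewrite -(forget_image R covL name_inj) -phiK -F0K.
  by rewrite !image_comp.
- move=> x y; rewrite (forget_fiber covL name_inj) //.
  split=> -[g e]; exists g; last by rewrite e phiG.
  by apply: phiI; rewrite ?phiG //; exact: realization_deck.
Qed.

Lemma triangulates_flips : (forall g : G, g = 0) -> compact [set: M] ->
  injective F0 -> triangulates R K M.
Proof.
move=> G0 cM F0i; have [F [Fc FK Fxy]] := transport.
apply: (triangulates_bij cM Fc) => // x y /Fxy[g e]; apply: F0i; rewrite e.
by apply/funext => v /=; rewrite (G0 g) deck0.
Qed.

Lemma triangulates_flips_quotient (e : equiv_rel M) : compact [set: M] ->
  (forall x y, e x y <-> exists g, F0 y = F0 x \o deck g) ->
  triangulates R K (quotient_topology {eq_quot e}%qT).
Proof.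
move=> cM eP; have [F [Fc FK Fxy]] := transport.
by apply: (triangulates_quotient cM Fc) => // x y; rewrite Fxy eP.
Qed.

End Transport.

(** * Spheres as boundaries of cross-polytopes *)

Lemma compact_set_type (X : topologicalType) (A : set X) :
  compact A -> compact [set: set_type A].
Proof.
have [->|/set0P[a Aa]] := eqVneq A set0.
  move=> _; rewrite (_ : [set: _] = set0); first exact: compact0.
  by apply/seteqP; split=> // x; have := set_valP x.
move=> cA; pose a' : set_type A := SigSub (mem_set Aa).
have := (iffRL (@subspace_valL_continuousP' X A (set_type A) a' id)) (fun x => cvg_id).
move=> /continuous_compact/(_ cA); congr compact.
apply/seteqP; split=> // x _; exists (set_val x); first exact: set_valP.
exact: (congr1 (fun f => f x) (valLK a' (@id (set_type A)))).
Qed.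

Section Sphere.
Variables (R : realType) (n : nat).

Lemma coordinate_continuous (i : 'I_n.+1) :
  continuous (fun x : sphere R n => set_val x 0 i : R).
Proof.
move=> x; apply: (@continuous_comp _ _ _ (fun y : sphere R n => set_val y : 'rV[R]_n.+1)
  (fun M : 'rV[R]_n.+1 => M 0 i)).
  exact: initial_continuous.
exact: coord_continuous.
Qed.

Lemma sphere_compact : compact [set: sphere R n].
Proof.
apply: compact_set_type.
have c : compact [set v : 'rV[R]_n.+1 | forall i, [set` `[-1, 1]] (v ord0 i : R)].
  apply: (@rV_compact _ _ (fun=> [set` `[-1 : R, 1]])) => _.
  exact: segment_compact.
apply: subclosed_compact _ c _.
  rewrite (_ : @sphere_set R n =
    (fun v : 'rV[R]_n.+1 => \sum_i v 0 i ^+ 2) @^-1` [set 1]); last by [].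
  apply: preimage_closed; last exact: closed_eq.
  move=> v _; apply: (@continuous_sum R 'rV[R]_n.+1) => i {}v.
  apply: (@continuous_comp _ _ _ (fun M : 'rV[R]_n.+1 => M 0 i) (fun y => y ^+ 2)).
    exact: coord_continuous.
  exact: exprn_continuous.
move=> v /= v1 i /=; rewrite in_itv /= -ler_norml -(@ler_pXn2r _ 2) ?nnegrE //.
rewrite expr1n real_normK ?num_real // -v1 (bigD1 i) //= lerDl.
by apply: sumr_ge0 => j _; exact: sqr_ge0.
Qed.

End Sphere.

Fixpoint signs n : seq (seq bool) :=
  if n is m.+1 then [seq b :: s | b <- [:: false; true], s <- signs m] else [:: [::]].

Definition cross_facets (V : Type) n (e : nat -> bool -> V) : seq (seq V) :=
  [seq [seq e i (nth false s i) | i <- iota 0 n] | s <- signs n].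

Lemma cross_facetsP (V : eqType) n (e : nat -> bool -> V) F :
  F \in cross_facets n e <->
  exists s : nat -> bool, F = [seq e i (s i) | i <- iota 0 n].
Proof.
have signsE (s : nat -> bool) m k : [seq s i | i <- iota k m] \in signs m.
  elim: m k => [|m IH] k //; rewrite [signs _]/(allpairs cons _ (signs m)).
  by apply/allpairsP; exists (s k, [seq s i | i <- iota k.+1 m]); split=> //=; case: (s k).
split=> [/mapP[s _ ->]|[s ->]]; first by exists (nth false s).
apply/mapP; exists [seq s i | i <- iota 0 n] => //; apply/eq_in_map => i.
by rewrite mem_iota => /andP[_ ilt]; rewrite (nth_map 0%N) ?size_iota // nth_iota.
Qed.

Section Cross.
Variables (R : realType) (n : nat) (V : choiceType) (e : nat -> bool -> V).
Hypothesis e_inj : forall i j a b, (i < n.+1)%N -> (j < n.+1)%N ->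
  e i a = e j b -> i = j /\ a = b.
Variable K : {fset {fset V}}.
Hypothesis KP : forall A, A \in K <-> exists s : nat -> bool,
  A = [fset x in [seq e i (s i) | i <- iota 0 n.+1]]%fset.

Implicit Types (z : sphere R n) (i : 'I_n.+1) (b : bool).

Let crd z i : R := set_val z 0 i.

Definition signed b (t : R) : R := if b then - t else t.

Let size1 z : R := \sum_i `|crd z i|.

(** The radial projection to the boundary of the cross-polytope, in barycentric
    coordinates: the vertex [e i false] receives the positive part of the
    coordinate [i], the vertex [e i true] the negative part. *)
Definition sphere_to_cross z : {ptws V -> R} := fun v =>
  (\sum_(p : 'I_n.+1 * bool)
    (v == e p.1 p.2)%:R * Num.max (signed p.2 (crd z p.1)) 0) / size1 z.

Let sumsq z : \sum_i crd z i ^+ 2 = 1.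
Proof. exact: (set_valP z). Qed.

Let size1_gt0 z : 0 < size1 z.
Proof.
rewrite lt_neqAle sumr_ge0 // andbT eq_sym; apply/negP => /eqP/psumr_eq0P s0.
have := sumsq z; rewrite big1 => [/eqP|i _]; first by rewrite eq_sym oner_eq0.
have /eqP := s0 (fun i _ => normr_ge0 _) i isT.
by rewrite normr_eq0 => /eqP ->; rewrite expr0n.
Qed.

Let stcE z i b : sphere_to_cross z (e i b) = Num.max (signed b (crd z i)) 0 / size1 z.
Proof.
rewrite /sphere_to_cross (bigD1 (i, b)) //= eqxx mul1r big1 ?addr0 // => -[j c] /= ne.
case: eqP => [/(e_inj (ltn_ord _) (ltn_ord _))[/val_inj ij bc]|]; last by rewrite mul0r.
by rewrite ij bc eqxx in ne.
Qed.

Let stc0 z v : (forall i b, v <> e i b) -> sphere_to_cross z v = 0.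
Proof.
move=> nv; rewrite /sphere_to_cross big1 ?mul0r // => -[i b] _ /=.
by case: eqP => [/nv//|_]; rewrite mul0r.
Qed.

Lemma sphere_to_cross_continuous : continuous sphere_to_cross.
Proof.
apply: continuous_ptws => v; apply: continuous_div.
- apply: continuous_sum => -[i b] /=; apply: continuous_mul; first exact: continuous_const.
  apply: continuous_maxr; last exact: continuous_const.
  rewrite /signed; case: b; last exact: coordinate_continuous.
  by apply: continuous_opp; exact: coordinate_continuous.
- apply: continuous_sum => i; apply: continuous_norm; exact: coordinate_continuous.
- by move=> z; rewrite gt_eqF.
Qed.

Let crd_eq z z' (c : R) : 0 < c -> (forall i, crd z i = c * crd z' i) -> z = z'.
Proof.
move=> c0 zz'; have c1 : c = 1.
  have := sumsq z; rewrite (eq_bigr (fun i => c ^+ 2 * crd z' i ^+ 2)).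
    rewrite -mulr_sumr sumsq mulr1 => /eqP; rewrite sqrf_eq1 => /orP[/eqP //|/eqP cN1].
    by move: c0; rewrite cN1 ltr0N1.
  by move=> i _; rewrite zz' exprMn.
by apply/val_inj/rowP => i; have := zz' i; rewrite c1 mul1r.
Qed.

Let signed_max (t : R) : t = Num.max t 0 - Num.max (- t) 0.
Proof.
case/orP: (le_total 0 t) => t0.
  by rewrite (max_l t0) max_r ?oppr_le0 // subr0.
by rewrite (max_r t0) max_l ?oppr_ge0 // sub0r opprK.
Qed.

Let crdE z i : crd z i =
  size1 z * (sphere_to_cross z (e i false) - sphere_to_cross z (e i true)).
Proof.
by rewrite !stcE /= -mulrBl -signed_max mulrC divfK // gt_eqF.
Qed.

(** The image determines the point up to a positive factor, which is 1 on the
    sphere. *)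
Lemma sphere_to_cross_inj : injective sphere_to_cross.
Proof.
move=> z z' zz'; apply: (@crd_eq _ _ (size1 z / size1 z')); first exact: divr_gt0.
by move=> i; rewrite crdE zz' [crd z' i]crdE mulrA divfK // gt_eqF.
Qed.

Lemma sphere_to_cross_opp z z' (sigma : V -> V) : injective sigma ->
  (forall i b, sigma (e i b) = e i (~~ b)) -> (forall i, crd z' i = - crd z i) ->
  sphere_to_cross z' = sphere_to_cross z \o sigma.
Proof.
move=> sI se zz'; apply/funext => v; rewrite /= /sphere_to_cross; congr (_ / _).
  rewrite (reindex_inj (h := fun p : 'I_n.+1 * bool => (p.1, ~~ p.2))) /=.
    apply: eq_bigr => -[i b] _ /=; rewrite zz' -(inj_eq sI) se negbK.
    by case: b; rewrite /signed ?opprK.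
  by move=> [i b] [j c] /= [-> /negb_inj ->].
by apply: eq_bigr => i _; rewrite zz' normrN.
Qed.

Let facet (s : nat -> bool) : {fset V} :=
  [fset x in [seq e k (s k) | k <- iota 0 n.+1]]%fset.

Let facetP (s : nat -> bool) v : reflect (exists i : 'I_n.+1, v = e i (s i)) (v \in facet s).
Proof.
rewrite in_fset; apply: (iffP mapP) => [[i +]|[i ->]].
  by rewrite mem_iota => /andP[_ ilt] ->; exists (Ordinal ilt).
by exists (val i) => //; rewrite mem_iota /= add0n.
Qed.

Let facet_sum (s : nat -> bool) (x : V -> R) :
  \sum_(v <- facet s) x v = \sum_(i < n.+1) x (e i (s i)).
Proof.
rewrite (perm_big [seq e k (s k) | k <- iota 0 n.+1]) /facet.
  by rewrite big_map -/(index_iota 0 n.+1) big_mkord.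
apply: uniq_perm; [exact: fset_uniq| |by move=> v; rewrite in_fset].
rewrite map_inj_in_uniq ?iota_uniq // => i j; rewrite !mem_iota !add0n.
by move=> /andP[_ il] /andP[_ jl] /(e_inj il jl)[].
Qed.

Lemma sphere_to_cross_range : range sphere_to_cross = realization K.
Proof.
apply/seteqP; split=> [_ [z _ <-]|x [A /KP[s ->] [x0 xA x1]]].
  pose s k := if insub k is Some i then crd z i < 0 else false.
  have sE i : s i = (crd z i < 0) by rewrite /s valK.
  have max0 i b : b != s i -> Num.max (signed b (crd z i)) 0 = 0.
    rewrite sE; have [|] := ltP (crd z i) 0; case: b => //= h _; rewrite max_r //.
      exact: ltW.
    by rewrite oppr_le0.
  have maxs i : Num.max (signed (s i) (crd z i)) 0 = `|crd z i|.
    rewrite sE; have [h|h] := ltP (crd z i) 0; rewrite max_l ?oppr_ge0 ?(ltW h) //.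
      by rewrite ltr0_norm.
    by rewrite ger0_norm.
  exists (facet s); first by apply/KP; exists s.
  split=> [v|v vA|].
  - rewrite mulr_ge0 ?invr_ge0 ?(ltW (size1_gt0 z)) //; apply: sumr_ge0 => p _.
    by rewrite mulr_ge0 // le_max lexx orbT.
  - have [[i [b vE]]|nv] := pselect (exists i b, v = e i b); last first.
      by apply: stc0 => i b vE; apply: nv; exists i, b.
    rewrite vE stcE max0 ?mul0r //; apply: contra vA => /eqP bE.
    by apply/facetP; exists i; rewrite vE bE.
  - rewrite facet_sum (eq_bigr (fun i => `|crd z i| / size1 z)).
      by rewrite -mulr_suml -/(size1 z) mulfV // gt_eqF.
    by move=> i _; rewrite stcE maxs.
pose y i : R := signed (s i) (x (e i (s i))).
have y2 : 0 < \sum_i y i ^+ 2.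
  rewrite lt_neqAle sumr_ge0 ?andbT 1?eq_sym; last by move=> i _; exact: sqr_ge0.
  apply/negP => /eqP/psumr_eq0P y0; move: x1; rewrite -/(facet s) facet_sum big1.
    by move/eqP; rewrite eq_sym oner_eq0.
  move=> i _; have /eqP := y0 (fun i _ => sqr_ge0 _) i isT.
  by rewrite sqrf_eq0 /y /signed; case: (s i); rewrite ?oppr_eq0 => /eqP.
pose c := (Num.sqrt (\sum_i y i ^+ 2))^-1.
have c0 : 0 < c by rewrite invr_gt0 sqrtr_gt0.
have zP : sphere_set (\row_i (c * y i)).
  rewrite /sphere_set /= (eq_bigr (fun i => c ^+ 2 * y i ^+ 2)).
    by rewrite -mulr_sumr /c exprVn sqr_sqrtr ?(ltW y2) // mulVf ?gt_eqF.
  by move=> i _; rewrite mxE exprMn.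
pose z : sphere R n := SigSub (mem_set zP).
have zE i : crd z i = c * y i by rewrite /crd /= mxE.
have normy i : `|y i| = x (e i (s i)).
  by rewrite /y /signed; case: (s i); rewrite ?normrN ger0_norm.
have sz : size1 z = c.
  rewrite /size1 (eq_bigr (fun i : 'I_n.+1 => c * x (e i (s i)))).
    by rewrite -mulr_sumr -(facet_sum s x) x1 mulr1.
  by move=> i _; rewrite zE normrM normy gtr0_norm.
exists z => //; apply/funext => v.
have [[i [b ->]]|nv] := pselect (exists i b, v = e i b); last first.
  rewrite stc0; last by move=> i b vE; apply: nv; exists i, b.
  rewrite xA //; apply/negP => /facetP[i vE]; apply: nv; by exists i, (s i).
rewrite stcE sz zE.
have [bs|bs] := eqVneq b (s i); last first.
  rewrite xA; last first.
    apply/negP => /facetP[j /(e_inj (ltn_ord _) (ltn_ord _))[/val_inj ij bj]].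
    by rewrite bj ij eqxx in bs.
  rewrite max_r ?mul0r // /y /signed.
  by case: b bs; case: (s i) => //= _; rewrite ?mulrN ?oppr_le0 ?oppr_le0 mulr_ge0 // ltW.
rewrite bs (_ : signed (s i) (c * y i) = c * x (e i (s i))).
  by rewrite max_l ?mulr_ge0 ?(ltW c0) // mulrAC mulfV ?mul1r // gt_eqF.
by rewrite /y /signed; case: (s i); rewrite ?mulrN ?opprK.
Qed.

End Cross.

(** * Circles as regular polygons *)

Section Polygon.
Variables (R : realType) (h : nat).
Hypothesis h2 : (2 <= h)%N.

(** Angles are measured in sides of the regular [2 h]-gon. *)
Definition pcos (a : R) : R := cos (a * (pi / h%:R)).
Definition psin (a : R) : R := sin (a * (pi / h%:R)).

Definition height (a x y : R) : R := y * pcos a - x * psin a.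

(** On the sector between two consecutive vertices of the polygon these are, up
    to a constant factor, the coordinates of a point in the basis formed by the
    two vertices; every other [tooth] vanishes there. *)
Definition tooth (k : nat) (x y : R) : R :=
  Num.max (Num.min (- height (k%:R + 1) x y) (height (k%:R - 1) x y)) 0.

Let h0 : h%:R != 0 :> R.
Proof. by rewrite pnatr_eq0; case: (h) h2. Qed.

Let hN1 : (1 < h.*2)%N.
Proof. by rewrite -addnn (leq_trans h2) // leq_addr. Qed.

Let hN0 : (0 < h.*2)%N.
Proof. exact: ltnW hN1. Qed.

Let turn : h.*2%:R * (pi / h%:R) = pi *+ 2 :> R.
Proof. by rewrite -mul2n natrM -mulrA [h%:R * _]mulrC divfK // mulr_natl. Qed.

Lemma pcosD2h a : pcos (a + h.*2%:R) = pcos a.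
Proof. by rewrite /pcos mulrDl turn cosD2pi. Qed.

Lemma psinD2h a : psin (a + h.*2%:R) = psin a.
Proof. by rewrite /psin mulrDl turn sinD2pi. Qed.

Let half : h%:R * (pi / h%:R) = pi :> R.
Proof. by rewrite mulrC divfK. Qed.

Lemma pcosDh a : pcos (a + h%:R) = - pcos a.
Proof. by rewrite /pcos mulrDl half cosDpi. Qed.

Lemma psinDh a : psin (a + h%:R) = - psin a.
Proof. by rewrite /psin mulrDl half sinDpi. Qed.

Lemma psinB a b : psin (a - b) = psin a * pcos b - pcos a * psin b.
Proof. by rewrite /psin mulrBl sinB. Qed.

Lemma psinN a : psin (- a) = - psin a.
Proof. by rewrite /psin mulNr sinN. Qed.

Lemma psin_ge0 d : (d <= h)%N -> 0 <= psin d%:R.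
Proof.
move=> dh; apply: sin_ge0_pi; apply/andP; split.
  by rewrite mulr_ge0 // divr_ge0 // pi_ge0.
by rewrite -[leRHS]half ler_wpM2r ?divr_ge0 ?pi_ge0 ?ler_nat.
Qed.

Lemma psin_le0 d : (h <= d <= h.*2)%N -> psin d%:R <= 0.
Proof.
move=> /andP[hd d2h]; rewrite -(subnK hd) natrD psinDh oppr_le0 psin_ge0 //.
by rewrite leq_subLR addnn.
Qed.

Lemma psin1_gt0 : 0 < psin 1.
Proof.
apply: sin_gt0_pi; rewrite mul1r divr_gt0 ?pi_gt0 ?ltr0n ?(ltn_trans _ h2) //=.
by rewrite ltr_pdivrMr ?ltr0n ?(ltn_trans _ h2) // ltr_pMr ?pi_gt0 // ltr1n.
Qed.

Lemma tooth_period k x y : tooth (k + h.*2) x y = tooth k x y.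
Proof.
by rewrite /tooth /height natrD (addrAC _ h.*2%:R 1) (addrAC _ h.*2%:R (- 1)) !(pcosD2h, psinD2h).
Qed.

Lemma toothZ k x y (c : R) : 0 <= c -> tooth k (c * x) (c * y) = c * tooth k x y.
Proof.
move=> c0; rewrite /tooth maxr_pMr // minr_pMr // mulr0 /height mulrN.
by rewrite !mulrBr !mulrA.
Qed.

Let px (k : nat) (s t : R) := s * pcos k%:R + t * pcos (k%:R + 1).
Let py (k : nat) (s t : R) := s * psin k%:R + t * psin (k%:R + 1).

Let height_p a k s t : height a (px k s t) (py k s t) =
  s * psin (k%:R - a) + t * psin (k%:R + 1 - a).
Proof. by rewrite /height /px /py !psinB; ring. Qed.

Let tooth_p k d s t : 0 <= s -> 0 <= t -> (d < h.*2)%N ->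
  tooth (k + d) (px k s t) (py k s t) =
  if d is d'.+1 then (if d' is 0 then t * psin 1 else 0) else s * psin 1.
Proof.
move=> s0 t0 dN; rewrite /tooth !height_p.
have -> : k%:R - ((k + d)%:R + 1) = - (d.+1)%:R :> R.
  by rewrite natrD -natr1; ring.
have -> : k%:R + 1 - ((k + d)%:R + 1) = - d%:R :> R by rewrite natrD; ring.
have -> : k%:R - ((k + d)%:R - 1) = 1 - d%:R :> R by rewrite natrD; ring.
have -> : k%:R + 1 - ((k + d)%:R - 1) = 2 - d%:R :> R by rewrite natrD; ring.
rewrite !psinN opprD !mulrN !opprK.
have psin0 : psin 0 = 0 by rewrite /psin mul0r sin0.
have psin2 : 0 <= psin 2 by exact: (@psin_ge0 2).
have sin1 := ltW psin1_gt0.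
case: d dN => [|[|d]] dN.
- rewrite !mulr0n !subr0 psin0 mulr0 addr0 min_l ?max_l ?mulr_ge0 //.
  by rewrite lerDl mulr_ge0.
- rewrite subrr psin0 mulr0 add0r (_ : 2 - 1 = 1); last by ring.
  by rewrite min_r ?max_l ?mulr_ge0 // lerDr mulr_ge0.
rewrite max_r //.
have -> : 1 - d.+2%:R = - d.+1%:R :> R by rewrite -(natr1 d.+1); ring.
have -> : 2 - d.+2%:R = - d%:R :> R by rewrite -(natr1 d.+1) -(natr1 d); ring.
rewrite !psinN !mulrN ge_min; have [dh|hd] := leqP d.+1 h.
  apply/orP; right; rewrite -opprD oppr_le0 addr_ge0 // mulr_ge0 // psin_ge0 //.
  exact: ltnW.
apply/orP; left; rewrite -oppr_ge0 opprD -!mulrN addr_ge0 // mulr_ge0 // oppr_ge0.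
  by apply: psin_le0; rewrite dN andbT; lia.
by apply: psin_le0; rewrite (ltnW dN) andbT; lia.
Qed.

Let sign_change (c : nat -> R) n : 0 <= c 0%N -> c n.+1 <= 0 ->
  exists k, [/\ (k < n.+1)%N, 0 <= c k & c k.+1 <= 0].
Proof.
move=> c0; elim: n => [|n IH] cn; first by exists 0%N.
have [cn0|/ltW/IH[k [kn ck ck1]]] := leP 0 (c n.+1); first by exists n.+1.
by exists k; split=> //; rewrite ltnS ltnW.
Qed.

(** The plane is the union of the [2 h] sectors: the height of a point over the
    direction [k] takes opposite values at [k] and [k + h], so it changes sign
    between two consecutive directions. *)
Lemma sector x y : exists (k : nat) (s t : R),
  [/\ (k < h.*2)%N, 0 <= s, 0 <= t, x = px k s t & y = py k s t].
Proof.
pose c k := height k%:R x y.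
have ch k : c (k + h)%N = - c k.
  by rewrite /c /height natrD pcosDh psinDh; ring.
have [k [kN ck ck1]] : exists k, [/\ (k < h.*2)%N, 0 <= c k & c k.+1 <= 0].
  have [n hn] : exists n, h = n.+1 by case: (h) h2 => // n; exists n.
  have [c0|/ltW c0] := leP 0 (c 0%N).
    have [|k [kn ck ck1]] := @sign_change c n c0.
      by rewrite -hn -[h]add0n ch oppr_le0.
    by exists k; split=> //; rewrite -addnn hn ltn_addl.
  have [||k [kn ck ck1]] := @sign_change (fun k => c (k + h)%N) n.
  - by rewrite ch oppr_ge0.
  - by rewrite -hn -[X in (X + _)%N]add0n !ch opprK.
  by exists (k + h)%N; split=> //; rewrite -addnn ltn_add2r hn.
have s1 := psin1_gt0; have s1n : psin 1 != 0 by rewrite gt_eqF.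
have cross : psin (k%:R + 1) * pcos k%:R - pcos (k%:R + 1) * psin k%:R = psin 1.
  by rewrite -psinB addrAC subrr add0r.
exists k, (- c k.+1 / psin 1), (c k / psin 1); split=> //.
- by rewrite divr_ge0 ?oppr_ge0 // ltW.
- by rewrite divr_ge0 // ltW.
- apply: (mulIf s1n); rewrite /px mulrDl (mulrAC (- c k.+1 / _)) (mulrAC (c k / _)) !divfK //.
  by rewrite -[in LHS]cross /c /height -natr1; ring.
- apply: (mulIf s1n); rewrite /py mulrDl (mulrAC (- c k.+1 / _)) (mulrAC (c k / _)) !divfK //.
  by rewrite -[in LHS]cross /c /height -natr1; ring.
Qed.

Let sum_period (f : nat -> R) : (forall k, f (k + h.*2)%N = f k) ->
  forall k, \sum_(j < h.*2) f j = \sum_(d < h.*2) f (k + d)%N.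
Proof.
have [n ->] : exists n, h.*2 = n.+1.
  by case: (h) h2 => // n _; rewrite doubleS; exists n.*2.+1.
move=> fN; elim=> [|k ->]; first by apply: eq_bigr.
rewrite big_ord_recl [RHS]big_ord_recr /= addn0 addSnnS fN addrC.
by congr (_ + _); apply: eq_bigr => d _; rewrite /= /bump /= add1n addSnnS.
Qed.

Let sum_tooth (f : nat -> R) k s t : 0 <= s -> 0 <= t ->
  (forall k, f (k + h.*2)%N = f k) ->
  \sum_(j < h.*2) tooth j (px k s t) (py k s t) * f j =
  s * psin 1 * f k + t * psin 1 * f k.+1.
Proof.
move=> s0 t0 fN.
rewrite (@sum_period (fun j => tooth j (px k s t) (py k s t) * f j) _ k).
  have [n hn] : exists n, h.*2 = n.+2.
    by case: (h) h2 => // n _; rewrite doubleS; exists n.*2.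
  have tp d : (d < n.+2)%N -> tooth (k + d) (px k s t) (py k s t) =
      if d is d'.+1 then (if d' is 0 then t * psin 1 else 0) else s * psin 1.
    by rewrite -hn; exact: tooth_p.
  rewrite hn 2!big_ord_recl /= !tp //= /bump /= addn0 addn1 big1 ?addr0 // => d _.
  by rewrite tp ?mul0r //= !ltnS.
by move=> j; rewrite tooth_period fN.
Qed.

(** On a sector both sides are linear in the coordinates with respect to the two
    vertices that bound the sector. *)
Lemma tooth_recover x y :
  x * psin 1 = \sum_(j < h.*2) tooth j x y * pcos j%:R /\
  y * psin 1 = \sum_(j < h.*2) tooth j x y * psin j%:R.
Proof.
have [k [s [t [_ s0 t0 -> ->]]]] := sector x y.
rewrite (sum_tooth (f := fun j => pcos j%:R)) //; last first.
  by move=> j; rewrite natrD pcosD2h.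
rewrite (sum_tooth (f := fun j => psin j%:R)) //; last first.
  by move=> j; rewrite natrD psinD2h.
by rewrite -natr1; split; rewrite /px /py; ring.
Qed.

Definition perimeter x y : R := \sum_(j < h.*2) tooth j x y.

Lemma tooth_ge0 k x y : 0 <= tooth k x y.
Proof. by rewrite le_max lexx orbT. Qed.

Lemma perimeter_eq0 x y : perimeter x y = 0 -> x = 0 /\ y = 0.
Proof.
move=> /psumr_eq0P p0; have s1 : psin 1 != 0 by rewrite gt_eqF // psin1_gt0.
have z (f : nat -> R) : \sum_(j < h.*2) tooth j x y * f j = 0.
  by apply: big1 => j _; rewrite p0 ?mul0r // => i _; exact: tooth_ge0.
have [] := tooth_recover x y; rewrite (z (fun j => pcos j%:R)) (z (fun j => psin j%:R)).
by split; apply: (mulIf s1); rewrite mul0r.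
Qed.

Lemma tooth_sector k s t : 0 <= s -> 0 <= t ->
  exists x y : R, [/\ tooth k x y = s, tooth k.+1 x y = t, perimeter x y = s + t &
    forall d, (1 < d < h.*2)%N -> tooth (k + d) x y = 0].
Proof.
move=> s0 t0; have s1 := psin1_gt0; have s1n : psin 1 != 0 by rewrite gt_eqF.
have s0' : 0 <= s / psin 1 by rewrite divr_ge0 // ltW.
have t0' : 0 <= t / psin 1 by rewrite divr_ge0 // ltW.
exists (px k (s / psin 1) (t / psin 1)), (py k (s / psin 1) (t / psin 1)); split.
- by have := tooth_p k s0' t0' hN0; rewrite addn0 divfK.
- by have := tooth_p k s0' t0' hN1; rewrite addn1 divfK.
- rewrite /perimeter -(eq_bigr _ (fun j _ => mulr1 _)).
  by rewrite (sum_tooth (f := fun=> 1)) // !mulr1 !divfK.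
- by move=> [|[|d]] // /andP[_ dN]; rewrite tooth_p.
Qed.

Lemma tooth_support x y : exists2 k, (k < h.*2)%N &
  perimeter x y = tooth k x y + tooth k.+1 x y /\
  forall d, (1 < d < h.*2)%N -> tooth (k + d) x y = 0.
Proof.
have [k [s [t [kN s0 t0 -> ->]]]] := sector x y; exists k => //; split.
  rewrite /perimeter -(eq_bigr _ (fun j _ => mulr1 _)).
  rewrite (sum_tooth (f := fun=> 1)) // !mulr1.
  have := tooth_p k s0 t0 hN0; have := tooth_p k s0 t0 hN1.
  by rewrite addn0 addn1 => -> ->.
by move=> [|[|d]] // /andP[_ dN]; rewrite tooth_p.
Qed.

(** The rotation by [m] sides moves every height function by [m]. *)
Lemma tooth_rotate k m x y :
  tooth (k + m) (pcos m%:R * x - psin m%:R * y) (pcos m%:R * y + psin m%:R * x) =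
  tooth k x y.
Proof.
have H a : height (a + m%:R) (pcos m%:R * x - psin m%:R * y)
    (pcos m%:R * y + psin m%:R * x) = height a x y.
  have c2 : pcos m%:R ^+ 2 + psin m%:R ^+ 2 = 1 by exact: cos2Dsin2.
  have -> : height a x y = (y * pcos a - x * psin a) * (pcos m%:R ^+ 2 + psin m%:R ^+ 2).
    by rewrite c2 mulr1.
  rewrite /height (_ : pcos (a + m%:R) = pcos a * pcos m%:R - psin a * psin m%:R).
    rewrite (_ : psin (a + m%:R) = psin a * pcos m%:R + pcos a * psin m%:R).
      by ring.
    by rewrite /psin mulrDl sinD.
  by rewrite /pcos mulrDl cosD.
by rewrite /tooth natrD (addrAC _ m%:R 1) (addrAC _ m%:R (- 1)) !H.
Qed.

Lemma perimeter_rotate m x y :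
  perimeter (pcos m%:R * x - psin m%:R * y) (pcos m%:R * y + psin m%:R * x) =
  perimeter x y.
Proof.
rewrite /perimeter; set x' := _ - _; set y' := _ + _.
rewrite (sum_period (f := fun j => tooth j x' y') _ m); last first.
  by move=> j; rewrite tooth_period.
by apply: eq_bigr => j _; rewrite addnC tooth_rotate.
Qed.

End Polygon.

(** * The three-sphere as the join of two polygons *)

Local Open Scope complex_scope.

Section ComplexContinuity.
Variable R : realType.

Lemma continuous_Re : continuous (fun z : R[i]^o => complex.Re z : R).
Proof.
move=> z U /nbhs_ballP[e /= e0 eU]; exists e%:C; first by rewrite /= ltcR.
move=> w; rewrite /ball_ /= normc_def ltcR => zw; apply: eU; apply: le_lt_trans zw.
rewrite (_ : complex.Re z - complex.Re w = complex.Re (z - w)).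
  by rewrite -sqrtr_sqr ler_wsqrtr // lerDl sqr_ge0.
by case: (z) (w) => [? ?] [].
Qed.

Lemma continuous_Im : continuous (fun z : R[i]^o => complex.Im z : R).
Proof.
move=> z U /nbhs_ballP[e /= e0 eU]; exists e%:C; first by rewrite /= ltcR.
move=> w; rewrite /ball_ /= normc_def ltcR => zw; apply: eU; apply: le_lt_trans zw.
rewrite (_ : complex.Im z - complex.Im w = complex.Im (z - w)).
  by rewrite -sqrtr_sqr ler_wsqrtr // lerDr sqr_ge0.
by case: (z) (w) => [? ?] [].
Qed.

Lemma continuous_complex (X : topologicalType) (f g : X -> R) :
  continuous f -> continuous g -> continuous (fun x => (f x +i* g x : R[i]^o)).
Proof.
move=> cf cg x U [[e e'] /=]; rewrite ltcE /= => /andP[/eqP -> e0] eU.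
suff : \forall y \near x, U (f y +i* g y) by [].
near=> y; apply: eU => /=.
have fy : `|f x - f y| < e / 2.
  by near: y; apply: cvgr_dist_lt; [exact: cf|rewrite divr_gt0].
have gy : `|g x - g y| < e / 2.
  by near: y; apply: cvgr_dist_lt; [exact: cg|rewrite divr_gt0].
rewrite (_ : _ - _ = (f x - f y)%:C + (0 +i* (g x - g y))); last first.
  by apply/eqP; rewrite eq_complex /= addr0 add0r !eqxx.
apply: (le_lt_trans (ler_normD _ _)).
rewrite !normc_def /= expr0n /= addr0 add0r !sqrtr_sqr -rmorphD ltcR.
by rewrite [e in _ < e]splitr ltrD.
Unshelve. all: by end_near. Qed.

End ComplexContinuity.

Section SphereC2.
Variable R : realType.
Implicit Types z : sphereC2 R.

Lemma sphereC2_norm z :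
  complex.Re (set_val z).1 ^+ 2 + complex.Im (set_val z).1 ^+ 2 +
  (complex.Re (set_val z).2 ^+ 2 + complex.Im (set_val z).2 ^+ 2) = 1.
Proof.
have := set_valP z; rewrite /sphereC2_set /= -!add_Re2_Im2 -rmorphD.
by move/complexI.
Qed.

Lemma sphereC2_mem (x1 y1 x2 y2 : R) :
  x1 ^+ 2 + y1 ^+ 2 + (x2 ^+ 2 + y2 ^+ 2) = 1 ->
  sphereC2_set (x1 +i* y1 : R[i]^o, x2 +i* y2 : R[i]^o).
Proof. by move=> e; rewrite /sphereC2_set /= -!add_Re2_Im2 /= -rmorphD e. Qed.

Lemma sphereC2_ext z z' :
  complex.Re (set_val z).1 = complex.Re (set_val z').1 ->
  complex.Im (set_val z).1 = complex.Im (set_val z').1 ->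
  complex.Re (set_val z).2 = complex.Re (set_val z').2 ->
  complex.Im (set_val z).2 = complex.Im (set_val z').2 -> z = z'.
Proof.
move=> e1 e2 e3 e4; suff : set_val z = set_val z' by exact: val_inj.
move: e1 e2 e3 e4; case: (set_val z) => -[a b] [c d]; case: (set_val z') => -[a' b'] [c' d'] /=.
by move=> -> -> -> ->.
Qed.

Let val_cont : continuous (fun z => set_val z : R[i]^o * R[i]^o).
Proof. exact: initial_continuous. Qed.

Lemma continuous_Re1 : continuous (fun z => complex.Re (set_val z).1 : R).
Proof.
move=> z; apply: (@continuous_comp _ _ _ (fun z => (set_val z).1 : R[i]^o)
  (fun w => complex.Re w : R)); last exact: continuous_Re.
by apply: continuous_comp; [exact: val_cont|exact: cvg_fst].
Qed.

Lemma continuous_Im1 : continuous (fun z => complex.Im (set_val z).1 : R).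
Proof.
move=> z; apply: (@continuous_comp _ _ _ (fun z => (set_val z).1 : R[i]^o)
  (fun w => complex.Im w : R)); last exact: continuous_Im.
by apply: continuous_comp; [exact: val_cont|exact: cvg_fst].
Qed.

Lemma continuous_Re2 : continuous (fun z => complex.Re (set_val z).2 : R).
Proof.
move=> z; apply: (@continuous_comp _ _ _ (fun z => (set_val z).2 : R[i]^o)
  (fun w => complex.Re w : R)); last exact: continuous_Re.
by apply: continuous_comp; [exact: val_cont|exact: cvg_snd].
Qed.

Lemma continuous_Im2 : continuous (fun z => complex.Im (set_val z).2 : R).
Proof.
move=> z; apply: (@continuous_comp _ _ _ (fun z => (set_val z).2 : R[i]^o)
  (fun w => complex.Im w : R)); last exact: continuous_Im.
by apply: continuous_comp; [exact: val_cont|exact: cvg_snd].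
Qed.

Let o4 (k : nat) (k4 : (k < 4)%N) : 'I_4 := Ordinal k4.

(** The identification of the complex plane squared with the real space of
    dimension 4 maps the unit 3-sphere onto this sphere. *)
Lemma sphereC2_compact : compact [set: sphereC2 R].
Proof.
pose f (w : sphere R 3) : R[i]^o * R[i]^o :=
  (set_val w 0 (@o4 0 isT) +i* set_val w 0 (@o4 1 isT),
   set_val w 0 (@o4 2 isT) +i* set_val w 0 (@o4 3 isT)).
have fP w : f w \in (@sphereC2_set R).
  rewrite inE; apply: sphereC2_mem; rewrite addrA.
  have := set_valP w; rewrite /sphere_set /= !big_ord_recl big_ord0 addr0 !addrA => w1.
  apply: etrans w1.
  by congr (_ ^+ 2 + _ ^+ 2 + _ ^+ 2 + _ ^+ 2); congr (set_val w _ _); apply: val_inj.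
have cf : continuous (fun w => SigSub (fP w) : sphereC2 R).
  apply: continuous_comp_initial => w.
  have cc i j := continuous_complex (@coordinate_continuous R 3 i)
    (@coordinate_continuous R 3 j).
  exact: (cvg_pair (cc _ _ w) (cc _ _ w)).
rewrite (_ : [set: _] = range (fun w => SigSub (fP w) : sphereC2 R)).
  apply: continuous_compact; first exact: continuous_subspaceT.
  exact: sphere_compact.
apply/seteqP; split=> // z _.
pose c := [:: complex.Re (set_val z).1; complex.Im (set_val z).1;
  complex.Re (set_val z).2; complex.Im (set_val z).2].
have wP : sphere_set (\row_(i < 4) nth 0 c i).
  rewrite /sphere_set /= !big_ord_recl big_ord0 addr0 !mxE /= !addrA.
  by rewrite -[RHS](sphereC2_norm z) !addrA.
exists (SigSub (mem_set wP)) => //.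
by apply: sphereC2_ext; rewrite /= !mxE.
Qed.

End SphereC2.

Section Join.
Variables (R : realType) (h : nat).
Hypothesis h2 : (2 <= h)%N.
Notation N := h.*2.
Variables (V : choiceType) (A B : nat -> V).
Hypotheses (A_eq : forall i j, A i = A j <-> i = j %[mod N])
  (B_eq : forall i j, B i = B j <-> i = j %[mod N])
  (A_neq_B : forall i j, A i <> B j).
Variable K : {fset {fset V}}.
Hypothesis KP : forall F, F \in K <-> exists k l : nat,
  F = [fset x in [:: A k; A k.+1; B l; B l.+1]]%fset.

Implicit Types z : sphereC2 R.

Let toothA j z := tooth h j (complex.Re (set_val z).1) (complex.Im (set_val z).1).
Let toothB j z := tooth h j (complex.Re (set_val z).2) (complex.Im (set_val z).2).
Let total z : R := \sum_(j < N) toothA j z + \sum_(j < N) toothB j z.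

(** The two complex coordinates are projected radially to two regular polygons.
    The two resulting points are the ends of a segment of the join, which is
    divided in proportion to the perimeters of the polygons through the
    coordinates. *)
Definition sphereC2_to_join z : {ptws V -> R} := fun v =>
  (\sum_(j < N) (v == A j)%:R * toothA j z +
   \sum_(j < N) (v == B j)%:R * toothB j z) / total z.

Let N1 : (1 < N)%N.
Proof. by rewrite -addnn (leq_trans h2) // leq_addr. Qed.

Let N0 : (0 < N)%N.
Proof. exact: ltnW. Qed.

Let tooth_mod i j (x y : R) : i = j %[mod N] -> tooth h i x y = tooth h j x y.
Proof.
have e k : tooth h k x y = tooth h (k %% N) x y.
  rewrite {1}(divn_eq k N) addnC; elim: (k %/ N)%N => [|q IH]; first by rewrite addn0.
  by rewrite mulSnr addnA tooth_period.
by move=> ij; rewrite e ij -e.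
Qed.

Let total_gt0 z : 0 < total z.
Proof.
rewrite lt_neqAle addr_ge0 ?sumr_ge0 ?andbT // => [|i _|i _]; try exact: tooth_ge0.
apply/negP => /eqP/esym/eqP; rewrite paddr_eq0 ?sumr_ge0 // => [|i _|i _]; try exact: tooth_ge0.
move=> /andP[/eqP/(perimeter_eq0 h2)[a b] /eqP/(perimeter_eq0 h2)[c d]].
by have /eqP := sphereC2_norm z; rewrite a b c d !expr0n !addr0 eq_sym oner_eq0.
Qed.

Let delta (P : nat -> V) (f : nat -> R) j :
  (forall i j, P i = P j <-> i = j %[mod N]) ->
  (forall i, f (i %% N)%N = f i) ->
  \sum_(i < N) (P j == P i)%:R * f i = f j.
Proof.
move=> P_eq fN; rewrite (bigD1 (Ordinal (ltn_pmod j N0))) //=.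
rewrite (_ : P j = P (j %% N)%N); last by apply/P_eq; rewrite modn_mod.
rewrite eqxx mul1r fN big1 ?addr0 // => i ij.
case: eqP => [/P_eq|]; last by rewrite mul0r.
rewrite modn_mod [RHS]modn_small // => ji; case/negP: ij; apply/eqP/val_inj.
by rewrite /= ji.
Qed.

Let joinA j z : sphereC2_to_join z (A j) = toothA j z / total z.
Proof.
rewrite /sphereC2_to_join (delta (f := toothA^~ z)) //; last first.
  by move=> i; apply: tooth_mod; rewrite modn_mod.
rewrite big1 ?addr0 // => i _.
by case: eqP => [/A_neq_B//|]; rewrite mul0r.
Qed.

Let joinB j z : sphereC2_to_join z (B j) = toothB j z / total z.
Proof.
rewrite /sphereC2_to_join addrC (delta (f := toothB^~ z)) //; last first.
  by move=> i; apply: tooth_mod; rewrite modn_mod.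
rewrite big1 ?addr0 // => i _.
by case: eqP => [/esym/A_neq_B//|]; rewrite mul0r.
Qed.

Lemma sphereC2_to_join0 z v : (forall j, v <> A j) -> (forall j, v <> B j) ->
  sphereC2_to_join z v = 0.
Proof.
move=> nA nB; rewrite /sphereC2_to_join !big1 ?addr0 ?mul0r // => i _.
  by case: eqP => [/nB//|]; rewrite mul0r.
by case: eqP => [/nA//|]; rewrite mul0r.
Qed.

Let continuous_tooth (f g : sphereC2 R -> R) j : continuous f -> continuous g ->
  continuous (fun z => tooth h j (f z) (g z)).
Proof.
move=> cf cg.
have ch a : continuous (fun z => height h a (f z) (g z)).
  apply: continuous_add; first by apply: continuous_mul => //; exact: continuous_const.
  by apply: continuous_opp; apply: continuous_mul => //; exact: continuous_const.
apply: continuous_maxr; last exact: continuous_const.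
by apply: continuous_minr => //; exact: continuous_opp.
Qed.

Let continuous_toothA j : continuous (toothA j).
Proof. by apply: continuous_tooth; [exact: continuous_Re1|exact: continuous_Im1]. Qed.

Let continuous_toothB j : continuous (toothB j).
Proof. by apply: continuous_tooth; [exact: continuous_Re2|exact: continuous_Im2]. Qed.

Lemma sphereC2_to_join_continuous : continuous sphereC2_to_join.
Proof.
apply: continuous_ptws => v; apply: continuous_div.
- by apply: continuous_add; apply: continuous_sum => j;
    apply: continuous_mul; by [exact: continuous_const|].
- by apply: continuous_add; apply: continuous_sum => j.
- by move=> z; rewrite gt_eqF.
Qed.

Let tooth_scale (c x y x' y' : R) : (forall j, tooth h j x y = c * tooth h j x' y') ->
  x = c * x' /\ y = c * y'.
Proof.
move=> t; have s1 : psin h (1 : R) != 0 by rewrite gt_eqF // psin1_gt0.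
have [ex ey] := tooth_recover h2 x y; have [ex' ey'] := tooth_recover h2 x' y'.
split; apply: (mulIf s1); rewrite -mulrA ?(ex, ey) ?(ex', ey') mulr_sumr;
  by apply: eq_bigr => j _; rewrite t mulrA.
Qed.

(** The teeth, which are proportional to the barycentric coordinates, recover the
    point up to a positive factor. *)
Lemma sphereC2_to_join_inj : injective sphereC2_to_join.
Proof.
move=> z z' zz'; pose c := total z / total z'.
have c0 : 0 < c by rewrite divr_gt0.
have tA j : toothA j z = c * toothA j z'.
  rewrite /c mulrAC -mulrA -joinA -zz' joinA mulrC divfK //.
  by rewrite gt_eqF.
have tB j : toothB j z = c * toothB j z'.
  rewrite /c mulrAC -mulrA -joinB -zz' joinB mulrC divfK //.
  by rewrite gt_eqF.
have [e1 e2] := tooth_scale tA; have [e3 e4] := tooth_scale tB.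
have c1 : c = 1.
  have := sphereC2_norm z; rewrite e1 e2 e3 e4 !exprMn -!mulrDr sphereC2_norm mulr1 -exprMn -/c.
  move/eqP; rewrite sqrf_eq1 => /orP[/eqP //|/eqP cN1].
  by move: c0; rewrite cN1 ltr0N1.
by apply: sphereC2_ext; rewrite ?(e1, e2, e3, e4) c1 mul1r.
Qed.

Let residue j k : exists2 d, (d < N)%N & j = (k + d)%N %[mod N].
Proof.
exists ((j + k * N.-1) %% N)%N; first by rewrite ltn_mod.
rewrite modnDmr (_ : k + (j + k * N.-1) = k * N + j)%N ?modnMDl //.
by rewrite addnCA -mulnS prednK // addnC.
Qed.

Let facet k l : {fset V} := [fset x in [:: A k; A k.+1; B l; B l.+1]]%fset.

Let succ_neq (P : nat -> V) k : (forall i j, P i = P j <-> i = j %[mod N]) ->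
  P k <> P k.+1.
Proof.
move=> P_eq /P_eq/eqP; rewrite -addn1 -[k in X in X == _]addn0 eqn_modDl mod0n.
by rewrite modn_small.
Qed.

Let facet_sum k l (x : V -> R) :
  \sum_(v <- facet k l) x v = x (A k) + x (A k.+1) + (x (B l) + x (B l.+1)).
Proof.
rewrite (perm_big [:: A k; A k.+1; B l; B l.+1]) /facet.
  by rewrite unlock /= addr0 !addrA.
apply: uniq_perm; [exact: fset_uniq| |by move=> v; rewrite in_fset].
have AB i j : (A i == B j) = false by apply/eqP/A_neq_B.
rewrite /= !inE !AB !orbF !andbT.
by apply/andP; split; apply/eqP/succ_neq.
Qed.

Let far (P : nat -> V) k d : (forall i j, P i = P j <-> i = j %[mod N]) ->
  (1 < d < N)%N -> P (k + d)%N <> P k /\ P (k + d)%N <> P k.+1.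
Proof.
move=> P_eq /andP[d1 dN]; split=> /P_eq/eqP.
  by rewrite -[k in X in _ == X]addn0 eqn_modDl mod0n modn_small // gtn_eqF // ltnW.
by rewrite -addn1 eqn_modDl !modn_small // gtn_eqF.
Qed.

Lemma sphereC2_to_join_range : range sphereC2_to_join = realization K.
Proof.
apply/seteqP; split=> [_ [z _ <-]|x [F /KP[k [l ->]] [x0 xF x1]]].
  have [k _ [Ak A0]] := tooth_support h2 (complex.Re (set_val z).1) (complex.Im (set_val z).1).
  have [l _ [Bl B0]] := tooth_support h2 (complex.Re (set_val z).2) (complex.Im (set_val z).2).
  exists (facet k l); first by apply/KP; exists k, l.
  split=> [v|v vF|].
  - rewrite divr_ge0 ?(ltW (total_gt0 z)) // addr_ge0 // sumr_ge0 // => j _;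
      by rewrite mulr_ge0 // tooth_ge0.
  - have [[j vA]|nA] := pselect (exists j, v = A j).
      have [d dN jd] := residue j k; have {vA}vA : v = A (k + d)%N by rewrite vA; apply/A_eq.
      rewrite vA joinA /toothA; move: dN vA; case: d {jd} => [|[|d]] dN vA.
      + by move: vF; rewrite vA in_fset !inE addn0 eqxx.
      + by move: vF; rewrite vA in_fset !inE addn1 eqxx orbT.
      + by rewrite A0 ?mul0r.
    have [[j vB]|nB] := pselect (exists j, v = B j).
      have [d dN jd] := residue j l; have {vB}vB : v = B (l + d)%N by rewrite vB; apply/B_eq.
      rewrite vB joinB /toothB; move: dN vB; case: d {jd} => [|[|d]] dN vB.
      + by move: vF; rewrite vB in_fset !inE addn0 eqxx !orbT.
      + by move: vF; rewrite vB in_fset !inE addn1 eqxx !orbT.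
      + by rewrite B0 ?mul0r.
    by apply: sphereC2_to_join0 => j e; [apply: nA|apply: nB]; exists j.
  - rewrite facet_sum !joinA !joinB -!mulrDl -Ak -Bl.
    by rewrite -[X in X / _]/(total z) divff // gt_eqF.
have [x1' [y1' [a0 a1 ap aF]]] := tooth_sector h2 k (x0 (A k)) (x0 (A k.+1)).
have [x2' [y2' [b0 b1 bp bF]]] := tooth_sector h2 l (x0 (B l)) (x0 (B l.+1)).
have Ax j : tooth h j x1' y1' = x (A j).
  have [d dN jd] := residue j k; rewrite (tooth_mod _ _ jd).
  rewrite (_ : A j = A (k + d)%N); last exact/A_eq.
  case: d dN {jd} => [|[|d]] dN; rewrite ?addn0 ?addn1 //.
  rewrite aF // xF // in_fset !inE !negb_or.
  have [n1 n2] := far k A_eq (d := d.+2) dN.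
  by rewrite !(introF eqP n1, introF eqP n2) /=; apply/andP; split; apply/eqP/A_neq_B.
have Bx j : tooth h j x2' y2' = x (B j).
  have [d dN jd] := residue j l; rewrite (tooth_mod _ _ jd).
  rewrite (_ : B j = B (l + d)%N); last exact/B_eq.
  case: d dN {jd} => [|[|d]] dN; rewrite ?addn0 ?addn1 //.
  rewrite bF // xF // in_fset !inE !negb_or.
  have [n1 n2] := far l B_eq (d := d.+2) dN.
  rewrite !(introF eqP n1, introF eqP n2) /= andbT.
  by apply/andP; split; apply/eqP => /esym/A_neq_B.
have sum1 : perimeter h x1' y1' + perimeter h x2' y2' = 1.
  by rewrite ap bp -facet_sum.
pose q := x1' ^+ 2 + y1' ^+ 2 + (x2' ^+ 2 + y2' ^+ 2).
have q0 : 0 < q.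
  rewrite lt_neqAle !addr_ge0 ?sqr_ge0 // andbT eq_sym; apply/negP.
  rewrite !paddr_eq0 ?addr_ge0 ?sqr_ge0 // !sqrf_eq0.
  move=> /andP[/andP[/eqP e1 /eqP e2] /andP[/eqP e3 /eqP e4]].
  have t0 j : tooth h j (0 : R) 0 = 0.
    by have := @toothZ R h j 0 0 0 (lexx _); rewrite !mul0r.
  move: sum1; rewrite /perimeter e1 e2 e3 e4 !big1 ?addr0 // => /esym/eqP.
  by rewrite oner_eq0.
pose c := (Num.sqrt q)^-1.
have c0 : 0 < c by rewrite invr_gt0 sqrtr_gt0.
have /sphereC2_mem zP : (c * x1') ^+ 2 + (c * y1') ^+ 2 +
    ((c * x2') ^+ 2 + (c * y2') ^+ 2) = 1.
  by rewrite !(exprMn _ c) -!mulrDr exprVn sqr_sqrtr ?(ltW q0) // mulVf // gt_eqF.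
pose z : sphereC2 R := SigSub (mem_set zP).
have zA j : toothA j z = c * x (A j) by rewrite /toothA /= toothZ ?(ltW c0) // Ax.
have zB j : toothB j z = c * x (B j) by rewrite /toothB /= toothZ ?(ltW c0) // Bx.
have tz : total z = c.
  have zAs : \sum_(j < N) toothA j z = c * perimeter h x1' y1'.
    by rewrite /perimeter mulr_sumr; apply: eq_bigr => j _; rewrite zA Ax.
  have zBs : \sum_(j < N) toothB j z = c * perimeter h x2' y2'.
    by rewrite /perimeter mulr_sumr; apply: eq_bigr => j _; rewrite zB Bx.
  by rewrite /total zAs zBs -mulrDr sum1 mulr1.
have cn : c != 0 by rewrite gt_eqF.
exists z => //; apply/funext => v.
have [[j ->]|nA] := pselect (exists j, v = A j); first by rewrite joinA zA tz mulrAC mulfV ?mul1r.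
have [[j ->]|nB] := pselect (exists j, v = B j); first by rewrite joinB zB tz mulrAC mulfV ?mul1r.
have -> : sphereC2_to_join z v = 0.
  by apply: sphereC2_to_join0 => j e; [apply: nA|apply: nB]; exists j.
rewrite xF // in_fset !inE; apply/negP => /or4P[] /eqP e.
- by apply: nA; exists k.
- by apply: nA; exists k.+1.
- by apply: nB; exists l.
- by apply: nB; exists l.+1.
Qed.

Lemma sphereC2_to_join_rotate z z' (m m' : nat) :
  (set_val z').1 = (pcos h m%:R +i* psin h m%:R) * (set_val z).1 ->
  (set_val z').2 = (pcos h m'%:R +i* psin h m'%:R) * (set_val z).2 ->
  forall j, sphereC2_to_join z' (A (j + m)) = sphereC2_to_join z (A j) /\
    sphereC2_to_join z' (B (j + m')) = sphereC2_to_join z (B j).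
Proof.
have mulE (a b : R) (w : R[i]) : (a +i* b) * w =
  (a * complex.Re w - b * complex.Im w) +i* (a * complex.Im w + b * complex.Re w).
  by case: w.
move=> e1 e2 j; rewrite !joinA !joinB.
have -> : total z' = total z.
  rewrite /total /toothA /toothB e1 e2 !mulE /=.
  by congr (_ + _); exact: (perimeter_rotate h2).
by rewrite /toothA /toothB e1 e2 !mulE /= !tooth_rotate.
Qed.

End Join.

(** * Lens spaces *)

Section Lens.
Variables (R : realType) (p' q r : nat).
Notation p := p'.+1.
Notation N := p.*2.
Hypotheses (p2 : (2 <= p)%N) (qr : (q * r = 1 %[mod p])%N).
Notation V := (nat * 'I_p)%type.

(** The deck translation by one moves the first polygon by two vertices and the
    second one by [2 q] vertices; [r] is the inverse of [q]. *)
Definition lens_vertexA (j : nat) : V := (nat_of_bool (odd j), inZp j./2).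
Definition lens_vertexB (j : nat) : V := ((2 + odd j)%N, inZp (j./2 * r)).

Definition lens_facets : seq (seq V) :=
  [seq [:: lens_vertexA k; lens_vertexA k.+1; lens_vertexB l; lens_vertexB l.+1] |
    k <- iota 0 2, l <- iota 0 N].

Let A := lens_vertexA.
Let B := lens_vertexB.

Let inZp_eq i j : (inZp i = inZp j :> 'I_p) <-> (i = j %[mod p])%N.
Proof. by split=> [/(congr1 val)|e] //; apply/val_inj. Qed.

Let modN_eq i j : (i = j %[mod N])%N <-> odd i = odd j /\ (i./2 = j./2 %[mod p])%N.
Proof.
have e k : (k %% N = odd k + (k./2 %% p).*2)%N.
  have kE : k = ((k./2 %/ p) * N + (odd k + (k./2 %% p).*2))%N.
    rewrite -[LHS]odd_double_half {1}(divn_eq k./2 p) doubleD addnCA -!muln2.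
    by rewrite mulnA.
  rewrite {1}kE modnMDl modn_small //.
  by have := ltn_pmod k./2 (ltn0Sn p'); case: (odd k); lia.
split=> [|[od hf]]; last by rewrite !e od hf.
rewrite !e => ij; have o := congr1 odd ij.
rewrite !oddD !odd_double !addbF !oddb in o; split=> //.
by move: ij; rewrite o => /addnI/double_inj.
Qed.

Let A_eq i j : A i = A j <-> (i = j %[mod N])%N.
Proof.
rewrite modN_eq -inZp_eq; split=> [e|[od e]]; last by rewrite /A /lens_vertexA od e.
split; last exact: (congr1 snd e).
by move: (congr1 fst e) => /=; case: (odd i); case: (odd j).
Qed.

Let B_eq i j : B i = B j <-> (i = j %[mod N])%N.
Proof.
rewrite modN_eq; split=> [e|[od e]]; last first.
  rewrite /B /lens_vertexB od; congr (_, _); apply/inZp_eq.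
  by rewrite -modnMml e modnMml.
split; first by move: (congr1 fst e) => /=; case: (odd i); case: (odd j).
have /inZp_eq {}e : inZp (i./2 * r) = inZp (j./2 * r) :> 'I_p := congr1 snd e.
have qe k : (k = k * r * q %[mod p])%N.
  by rewrite -mulnA [(r * q)%N]mulnC -modnMmr qr modnMmr muln1.
by rewrite qe -modnMml e modnMml -qe.
Qed.

Let A_neq_B i j : A i <> B j.
Proof. by case; case: (odd i); case: (odd j). Qed.

Let inZpD i j : (inZp (i + j) : 'I_p) = inZp i + inZp j.
Proof. by apply/val_inj; rewrite /= modnDm. Qed.

Let deckA g j : deck (inZp g) (A j) = A (j + 2 * g).
Proof.
rewrite /deck /A /lens_vertexA /= -inZpD oddD mul2n odd_double addbF.
by rewrite halfD odd_double andbF add0n doubleK.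
Qed.

Let deckB g j : deck (inZp g) (B j) = B (j + 2 * (q * g)).
Proof.
rewrite /deck /B /lens_vertexB /= -inZpD oddD mul2n odd_double addbF.
rewrite halfD odd_double andbF add0n doubleK; congr (_, _).
apply/inZp_eq/eqP; rewrite mulnDl eqn_modDl; apply/eqP.
by rewrite mulnAC -modnMml qr modnMml mul1n.
Qed.

Let valZp (g : 'I_p) : inZp (val g) = g.
Proof. by apply/val_inj; rewrite /= modn_small. Qed.

(** The translates of a side of the first polygon are all the sides of the same
    parity. The shift that a translation causes on the second polygon is
    compensated, because all the sides of the second polygon are listed. *)
Lemma lens_orbitsP (F : {fset V}) : F \in orbits lens_facets <->
  exists k l : nat, F = [fset x in [:: A k; A k.+1; B l; B l.+1]]%fset.
Proof.
split=> [/orbitsP[H [g [/allpairsP[[k l] /= [_ _ ->]] ->]]]|[k [l ->]]].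
  exists (k + 2 * val g)%N, (l + 2 * (q * val g))%N.
  by rewrite /translate /= -[g in LHS]valZp -!/(A _) -!/(B _) !deckA !deckB.
pose g := k./2; pose l' := ((l + 2 * (q * (p' * g))) %% N)%N.
have ll' : (l = l' + 2 * (q * g) %[mod N])%N.
  rewrite /l' modnDml (_ : l + _ + _ = (q * g) * N + l)%N ?modnMDl //.
  by rewrite -muln2; lia.
apply/orbitsP.
exists [:: A (odd k); A (odd k).+1; B l'; B l'.+1], (inZp g); split.
  apply/allpairsP; exists (nat_of_bool (odd k), l'); split; last by [].
    by case: (odd k).
  by rewrite mem_iota ltn_mod double_gt0.
rewrite /translate /= !deckA !deckB !addSn.
have -> : (odd k + 2 * g = k)%N by rewrite mul2n odd_double_half.
have -> : B (l' + 2 * (q * g)) = B l by apply/B_eq.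
suff -> : B (l' + 2 * (q * g)).+1 = B l.+1 by [].
by apply/B_eq; rewrite -addn1 -[in RHS]addn1 -modnDml -ll' modnDml.
Qed.

Let F (z : sphereC2 R) : {ptws V -> R} := sphereC2_to_join p A B z.

Let expiX (t : R) n : expi t ^+ n = expi (n%:R * t).
Proof.
elim: n => [|n IH]; first by rewrite expr0 mul0r /expi cos0 sin0.
rewrite exprS IH (_ : n.+1%:R * t = t + n%:R * t); last first.
  by rewrite -natr1 mulrDl mul1r addrC.
rewrite /expi cosD sinD; apply/eqP.
by rewrite eq_complex /= eqxx /= addrC.
Qed.

Let a : R[i] := expi (2 * pi / p%:R).
Let b : R[i] := expi (2 * pi * q%:R / p%:R).

Let aX m : a ^+ m = pcos p (2 * m)%:R +i* psin p (2 * m)%:R.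
Proof.
rewrite /a expiX /pcos /psin /expi natrM.
by rewrite (_ : m%:R * (2 * pi / p%:R) = 2 * m%:R * (pi / p%:R)) //; ring.
Qed.

Let bX m : b ^+ m = pcos p (2 * (q * m))%:R +i* psin p (2 * (q * m))%:R.
Proof.
rewrite /b expiX /pcos /psin /expi !natrM.
by rewrite (_ : m%:R * (2 * pi * q%:R / p%:R) = 2 * (q%:R * m%:R) * (pi / p%:R)) //; ring.
Qed.

Let pN : pcos p (N%:R) = 1 :> R /\ psin p (N%:R) = 0 :> R.
Proof.
have := pcosD2h p2 (0 : R); have := psinD2h p2 (0 : R); rewrite !add0r => -> ->.
by rewrite /pcos /psin mul0r cos0 sin0.
Qed.

Let a_p : a ^+ p = 1.
Proof. by rewrite aX mul2n; have [-> ->] := pN. Qed.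

Let b_p : b ^+ p = 1.
Proof.
rewrite bX mulnCA mul2n mulnC -mulnC.
elim: (q) => [|n IH]; first by rewrite mul0n /pcos /psin mul0r cos0 sin0.
by rewrite mulSnr natrD pcosD2h // psinD2h.
Qed.

Let exp_mod (c : R[i]) (k : int) : c != 0 -> c ^+ p = 1 ->
  c ^ k = c ^+ `|(k %% p)%Z|%N.
Proof.
move=> c0 cp; rewrite {1}(divz_eq k p) expfzDr // mulrC [X in _ * X](_ : _ = 1) ?mulr1.
  by rewrite exprnP gez0_abs // modz_ge0.
by rewrite mulrC -exprz_exp -exprnP cp exp1rz.
Qed.

Let F_rotate z z' m : set_val z' = (a ^+ m * (set_val z).1, b ^+ m * (set_val z).2) ->
  F z = F z' \o deck (inZp m).
Proof.
move=> e.
have rot := @sphereC2_to_join_rotate R p p2 V A B A_eq B_eq A_neq_B z z' (2 * m) (2 * (q * m)).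
have {}rot : forall j, F z' (A (j + 2 * m)) = F z (A j) /\ F z' (B (j + 2 * (q * m))) = F z (B j).
  by apply: rot; rewrite e /= ?(aX, bX).
apply/funext => v /=.
have [[j ->]|nA] := pselect (exists j, v = A j); first by rewrite deckA; case: (rot j).
have [[j ->]|nB] := pselect (exists j, v = B j); first by rewrite deckB; case: (rot j).
have mp : inZp m + inZp (p' * m) = 0 :> 'I_p.
  by rewrite -inZpD -mulSn; apply/val_inj; rewrite /= modnMr.
have nA1 j : deck (inZp m) v <> A j.
  move=> e'; apply: nA; exists (j + 2 * (p' * m))%N.
  by rewrite -deckA -e' deckD mp deck0.
have nB1 j : deck (inZp m) v <> B j.
  move=> e'; apply: nB; exists (j + 2 * (q * (p' * m)))%N.
  by rewrite -deckB -e' deckD mp deck0.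
rewrite /F (sphereC2_to_join0 p _ nA1 nB1) sphereC2_to_join0 // => j e'.
  by apply: nA; exists j.
by apply: nB; exists j.
Qed.

(** The powers of the two roots of unity rotate the two regular polygons by 2 and
    by [2 * q] sides, as the deck translations do. *)
Lemma lens_relP (x y : sphereC2 R) :
  lens_rel p q x y <-> exists g, F y = F x \o deck g.
Proof.
have back m (z z' : sphereC2 R) : F z = F z' \o deck (inZp m) ->
    F z' = F z \o deck (- inZp m).
  by move=> ->; apply/funext => v /=; rewrite deckD addNr deck0.
have a0 : a != 0 by exact: expi_neq0.
have b0 : b != 0 by exact: expi_neq0.
split=> [/asboolP[k e]|[g e]].
  exists (- inZp `|(k %% p)%Z|%N); apply: back; apply: F_rotate.
  by rewrite e -/a -/b !exp_mod.
pose m := val (- g).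
have norm1 t : `|expi t : R[i]| = 1 by rewrite normc_def /= cos2Dsin2 sqrtr1.
have wP : sphereC2_set (a ^+ m * (set_val x).1 : R[i]^o, b ^+ m * (set_val x).2 : R[i]^o).
  rewrite /sphereC2_set /= !normrM !normrX /a /b !norm1 !expr1n !mul1r.
  exact: (set_valP x).
pose w : sphereC2 R := SigSub (mem_set wP).
have xw : F x = F w \o deck (inZp m) by exact: F_rotate.
have := back _ _ _ xw; rewrite /m valZp opprK -e => /sphereC2_to_join_inj wy.
by apply/asboolP; exists m; rewrite -wy //= -!exprnP.
Qed.

Variables (L : seq (seq V)) (c : seq (seq V)).
Hypotheses (cL : flips c lens_facets = Some L) (covL : evenly_covered L).
Variables (W : choiceType) (name : nat -> W).
Hypothesis name_inj : {in flatten [seq map fst F | F <- L] &, injective name}.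

Lemma triangulates_lens :
  triangulates R (facets_of [seq [seq name v.1 | v <- F] | F <- L]) (lens_space R p q).
Proof.
apply: (@triangulates_flips_quotient _ _ _ lens_facets L c F) => //.
- exact: sphereC2_to_join_continuous.
- by apply: sphereC2_to_join_range => // G; exact: lens_orbitsP.
- exact: sphereC2_compact.
- exact: lens_relP.
Qed.

End Lens.

(** * Products of ordered complexes *)

Section Coupling.
Variable R : realType.
Implicit Types (x y : nat -> R) (c : nat -> nat -> R).

Definition mass_below x n : R := \sum_(i < n) x i.

(** If [x] and [y] cut the unit interval into consecutive pieces of lengths
    [x i] and [y j], this is the length of the intersection of the piece [i] of
    the one with the piece [j] of the other. *)
Definition overlap x y i j : R :=
  Num.min (mass_below x i.+1) (mass_below y j.+1) -
  Num.min (mass_below x i) (mass_below y j.+1) -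
  (Num.min (mass_below x i.+1) (mass_below y j) -
   Num.min (mass_below x i) (mass_below y j)).

Lemma mass_belowS x n : mass_below x n.+1 = mass_below x n + x n.
Proof. by rewrite /mass_below big_ord_recr. Qed.

Lemma mass_below0 x : mass_below x 0 = 0.
Proof. by rewrite /mass_below big_ord0. Qed.

Lemma le_mass_below x m n : (forall i, 0 <= x i) -> (m <= n)%N ->
  mass_below x m <= mass_below x n.
Proof.
move=> x0 /subnKC <-; elim: (n - m)%N => [|k IH]; first by rewrite addn0.
by rewrite addnS mass_belowS (le_trans IH) // lerDl.
Qed.

Lemma overlapC x y i j : overlap x y i j = overlap y x j i.
Proof. by rewrite /overlap !(minC (mass_below x _)); ring. Qed.

Let min_cases (a b : R) : (a <= b /\ Num.min a b = a) \/ (b <= a /\ Num.min a b = b).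
Proof.
case/orP: (le_total a b) => h; [left|right]; split=> //; first exact: min_l.
exact: min_r.
Qed.

Lemma overlap_ge0 x y i j : (forall i, 0 <= x i) -> (forall j, 0 <= y j) ->
  0 <= overlap x y i j.
Proof.
move=> /(_ i) xi /(_ j) yj; rewrite /overlap !mass_belowS.
set X := mass_below x i; set Y := mass_below y j.
have := min_cases (X + x i) (Y + y j); have := min_cases X (Y + y j).
have := min_cases (X + x i) Y; have := min_cases X Y.
by do 4!case=> -[? ->]; lra.
Qed.

Lemma overlap_neq0 x y i j : (forall i, 0 <= x i) -> (forall j, 0 <= y j) ->
  overlap x y i j != 0 -> mass_below y j < mass_below x i.+1.
Proof.
move=> /(_ i) xi /(_ j) yj; apply: contraNT; rewrite -leNgt => le.
apply/eqP; move: le; rewrite /overlap !mass_belowS.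
set X := mass_below x i; set Y := mass_below y j => le.
by rewrite !min_l; lra.
Qed.

Lemma overlap_chain x y i j i' j' : (forall i, 0 <= x i) -> (forall j, 0 <= y j) ->
  overlap x y i j != 0 -> overlap x y i' j' != 0 -> (i < i')%N -> (j <= j')%N.
Proof.
move=> x0 y0 ij ij' ii'; rewrite leqNgt; apply/negP => jj'.
have a := overlap_neq0 x0 y0 ij.
rewrite overlapC in ij'; have b := overlap_neq0 y0 x0 ij'.
have := le_mass_below x0 ii'; have := le_mass_below y0 jj'; lra.
Qed.

Lemma overlap_sum x y b i : (forall i, 0 <= x i) -> mass_below x i.+1 <= mass_below y b ->
  \sum_(j < b) overlap x y i j = x i.
Proof.
move=> x0 le; pose f j := Num.min (mass_below x i.+1) (mass_below y j) -
  Num.min (mass_below x i) (mass_below y j).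
rewrite (eq_bigr (fun j : 'I_b => f j.+1 - f j)) => [|j _]; last first.
  by rewrite /overlap /f.
rewrite -(big_mkord xpredT (fun j => f j.+1 - f j)) telescope_sumr //.
have le' : mass_below x i <= mass_below y b.
  by apply: le_trans le; exact: le_mass_below.
have g0 n : 0 <= mass_below x n by apply: sumr_ge0.
by rewrite /f mass_below0 (min_l le) (min_l le') !min_r // mass_belowS subrr subr0 addrC addKr.
Qed.

(** A coupling carried by a chain is determined by its marginals: below [i] and
    [j] it has the smaller one of the two marginal masses, because a chain cannot
    meet both complementary corners. *)
Lemma chain_coupling c a b : (forall i j, 0 <= c i j) ->
  (forall i j i' j', c i j != 0 -> c i' j' != 0 -> (i < i')%N -> (j <= j')%N) ->
  forall i j, (i < a)%N -> (j < b)%N ->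
  overlap (fun i => \sum_(j < b) c i j) (fun j => \sum_(i < a) c i j) i j = c i j.
Proof.
move=> c0 cc i j ia jb.
pose G i j := \sum_(i' < i) \sum_(j' < j) c i' j'.
have GE k l : (k <= a)%N -> (l <= b)%N ->
    Num.min (mass_below (fun i => \sum_(j < b) c i j) k)
            (mass_below (fun j => \sum_(i < a) c i j) l) = G k l.
  move=> /subnKC ak /subnKC bl; rewrite -ak -bl /mass_below.
  set a' := (a - k)%N; set b' := (b - l)%N.
  have -> : \sum_(i < k) \sum_(j < l + b') c i j =
      G k l + \sum_(i < k) \sum_(j < b') c i (l + j)%N.
    by rewrite /G -big_split; apply: eq_bigr => k' _; rewrite big_split_ord.
  have -> : \sum_(j < l) \sum_(i < k + a') c i j =
      G k l + \sum_(j < l) \sum_(i < a') c (k + i)%N j.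
    rewrite [X in X + _]exchange_big -big_split /=; apply: eq_bigr => k' _.
    by rewrite big_split_ord.
  have [[i1 [j1 [i1k cij]]]|none] := pselect (exists i1 j1, (i1 < k)%N /\ c i1 (l + j1)%N != 0).
    rewrite min_r ?lerD2l; last first.
      apply: (@le_trans _ _ 0); last by do 2!apply: sumr_ge0 => ? _.
      rewrite big1 // => j2 _; rewrite big1 // => i2 _; apply/eqP/negPn/negP => cij2.
      have := cc _ _ _ _ cij cij2 (ltn_addr _ i1k); have := ltn_ord j2; lia.
    rewrite [X in _ + X]big1 ?addr0 // => j2 _; rewrite big1 // => i2 _.
    apply/eqP/negPn/negP => cij2.
    have := cc _ _ _ _ cij cij2 (ltn_addr _ i1k); have := ltn_ord j2; lia.
  have z : \sum_(i < k) \sum_(j < b') c i (l + j)%N = 0.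
    rewrite big1 // => i1 _; rewrite big1 // => j1 _; apply/eqP/negPn/negP => cij.
    by apply: none; exists i1, j1.
  by rewrite z addr0 min_l // lerDl; do 2!apply: sumr_ge0 => ? _.
have GS k l : G k.+1 l = G k l + \sum_(j' < l) c k j' by rewrite /G big_ord_recr.
rewrite /overlap (GE i.+1 j.+1 ia jb) (GE i j.+1 (ltnW ia) jb).
rewrite (GE i.+1 j ia (ltnW jb)) (GE i j (ltnW ia) (ltnW jb)) !GS big_ord_recr /=.
move: (G i j.+1) (G i j) (\sum_(j' < j) c i j') (c i j) => u v w t; lra.
Qed.

End Coupling.

Section Product.
Variables (R : realType) (a b : nat).
Variables (FA FB : seq (seq nat)) (P : seq (seq (nat * nat))).
Variables (V : choiceType) (code : nat * nat -> V).

Definition increasing (s : seq (nat * nat)) : bool :=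
  all (fun u => all (fun v => (u.1 < v.1) ==> (u.2 <= v.2))%N s) s.

(** Each facet in [P] is a chain in the product of a facet of [FA] and a facet of
    [FB], and every chain in such a product, given by a mask, is contained in one.
    So [P] spans the staircase triangulation of the product. *)
Definition product_facets : bool :=
  [&& all (all (fun i => (i < a)%N)) FA, all (all (fun j => (j < b)%N)) FB,
    all uniq FA && all uniq FB,
    all (fun H => [&& uniq H, increasing H,
      has (fun F => all (fun v => v.1 \in F) H) FA &
      has (fun F => all (fun v => v.2 \in F) H) FB]) P &
    all (fun F => all (fun F' => all (fun m =>
      let s := mask m [seq (i, j) | i <- F, j <- F'] in
      increasing s ==> has (fun H => all (fun v => v \in H) s) P)
      (signs (size F * size F'))) FB) FA].

Hypothesis prodP : product_facets.
Hypothesis code_inj : forall i j i' j', (j < b)%N -> (j' < b)%N ->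
  code (i, j) = code (i', j') -> (i, j) = (i', j').

Let KA := facets_of FA.
Let KB := facets_of FB.
Let K := facets_of [seq map code H | H <- P].

(** The monotone coupling of two points. It is the inverse of the pair of
    simplicial projections from the triangulated product. *)
Definition product_map (x y : nat -> R) : {ptws V -> R} := fun v =>
  \sum_(p : 'I_a * 'I_b) (v == code (val p.1, val p.2))%:R * overlap x y p.1 p.2.

Let sum_bounded (F : seq nat) (x : nat -> R) n : all (fun i => (i < n)%N) F ->
  (forall i, i \notin [fset i in F]%fset -> x i = 0) ->
  \sum_(i <- [fset i in F]%fset) x i = mass_below x n.
Proof.
move=> /allP Fn xF; rewrite (@big_fset_incl _ _ _ _ _ [fset i in iota 0 n]%fset).
- rewrite (perm_big (iota 0 n)).
    by rewrite /mass_below -(big_mkord xpredT x) /index_iota subn0.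
  apply: uniq_perm; [exact: fset_uniq|exact: iota_uniq|by move=> i; rewrite in_fset].
- by apply/fsubsetP => i; rewrite !in_fset mem_iota => /Fn.
- by move=> i _; exact: xF.
Qed.

Let codeE x y i j : (i < a)%N -> (j < b)%N ->
  product_map x y (code (i, j)) = overlap x y i j.
Proof.
move=> ia jb; rewrite /product_map (bigD1 (Ordinal ia, Ordinal jb)) //= eqxx mul1r.
rewrite big1 ?addr0 // => -[i' j'] /= ne.
case: eqP => [/(code_inj jb (ltn_ord _))[e1 e2]|]; last by rewrite mul0r.
by case/eqP: ne; congr (_, _); apply/val_inj.
Qed.

Let code0 x y v : (forall i j, (i < a)%N -> (j < b)%N -> v <> code (i, j)) ->
  product_map x y v = 0.
Proof.
move=> nv; rewrite /product_map big1 // => -[i j] _ /=.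
by case: eqP => [/(nv _ _ (ltn_ord i) (ltn_ord j))//|_]; rewrite mul0r.
Qed.

Let memKA (x : {ptws nat -> R}) : realization KA x -> [/\ forall i, 0 <= x i,
  mass_below x a = 1 & exists2 F, F \in FA & forall i, i \notin F -> x i = 0].
Proof.
case/and5P: prodP => /allP Fa _ _ _ _ [_ /imfsetP[F /= FAF ->] [x0 xF x1]].
split=> //; first by rewrite -(sum_bounded (Fa _ FAF) xF).
by exists F => // i iF; apply: xF; rewrite in_fset.
Qed.

Let memKB (y : {ptws nat -> R}) : realization KB y -> [/\ forall i, 0 <= y i,
  mass_below y b = 1 & exists2 F, F \in FB & forall i, i \notin F -> y i = 0].
Proof.
case/and5P: prodP => _ /allP Fb _ _ _ [_ /imfsetP[F /= FBF ->] [x0 xF x1]].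
split=> //; first by rewrite -(sum_bounded (Fb _ FBF) xF).
by exists F => // i iF; apply: xF; rewrite in_fset.
Qed.

Let rowsE (x y : {ptws nat -> R}) : realization KA x -> realization KB y ->
  forall i, (i < a)%N -> \sum_(j < b) overlap x y i j = x i.
Proof.
move=> /memKA[x0 xa _] /memKB[y0 yb _] i ia; apply: overlap_sum => //.
by rewrite yb -xa; exact: le_mass_below.
Qed.

Let colsE (x y : {ptws nat -> R}) : realization KA x -> realization KB y ->
  forall j, (j < b)%N -> \sum_(i < a) overlap x y i j = y j.
Proof.
move=> /memKA[x0 xa _] /memKB[y0 yb _] j jb.
rewrite (eq_bigr (fun i : 'I_a => overlap y x j i)) => [|i _]; last exact: overlapC.
by apply: overlap_sum => //; rewrite xa -yb; exact: le_mass_below.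
Qed.

Let supportA (x : {ptws nat -> R}) : realization KA x -> forall i, (a <= i)%N -> x i = 0.
Proof.
case/and5P: prodP => /allP Fa _ _ _ _ /memKA[_ _ [F /Fa/allP FA' xF]] i ai.
by apply: xF; apply/negP => /FA'; rewrite ltnNge ai.
Qed.

Let supportB (y : {ptws nat -> R}) : realization KB y -> forall j, (b <= j)%N -> y j = 0.
Proof.
case/and5P: prodP => _ /allP Fb _ _ _ /memKB[_ _ [F /Fb/allP FB' yF]] j bj.
by apply: yF; apply/negP => /FB'; rewrite ltnNge bj.
Qed.

Lemma product_map_inj (x y x' y' : {ptws nat -> R}) : realization KA x -> realization KB y ->
  realization KA x' -> realization KB y' ->
  product_map x y = product_map x' y' -> x = x' /\ y = y'.
Proof.
move=> xA yB xA' yB' e.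
have oe i j : (i < a)%N -> (j < b)%N -> overlap x y i j = overlap x' y' i j.
  by move=> ia jb; rewrite -codeE // e codeE.
split; apply/funext => k.
  have [ka|ak] := ltnP k a; last by rewrite (supportA xA) // (supportA xA').
  rewrite -(rowsE xA yB ka) -(rowsE xA' yB' ka).
  by apply: eq_bigr => j _; exact: oe.
have [kb|bk] := ltnP k b; last by rewrite (supportB yB) // (supportB yB').
rewrite -(colsE xA yB kb) -(colsE xA' yB' kb).
by apply: eq_bigr => i _; exact: oe.
Qed.

Let facet_sum H (f : V -> R) : H \in P ->
  \sum_(v <- [fset v in map code H]%fset) f v = \sum_(p <- H) f (code p).
Proof.
case/and5P: prodP => _ /allP Fb _ /allP PH _ HP.
have /and4P[uH _ _ /hasP[F FF /allP HF]] := PH _ HP.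
rewrite (perm_big (map code H)); first by rewrite big_map.
apply: uniq_perm; [exact: fset_uniq| |by move=> v; rewrite in_fset].
rewrite map_inj_in_uniq // => -[i j] [i' j'] ijH ijH'; apply: code_inj.
  by apply: (allP (Fb _ FF)); exact: (HF _ ijH).
by apply: (allP (Fb _ FF)); exact: (HF _ ijH').
Qed.

Let bounded H i j : H \in P -> (i, j) \in H -> (i < a)%N /\ (j < b)%N.
Proof.
case/and5P: prodP => /allP Fa /allP Fb _ /allP PH _ HP ijH.
have /and4P[_ _ /hasP[F FF /allP HF] /hasP[F' FF' /allP HF']] := PH _ HP.
split; first by apply: (allP (Fa _ FF)); exact: (HF _ ijH).
by apply: (allP (Fb _ FF')); exact: (HF' _ ijH).
Qed.

Lemma product_map_realization (x y : {ptws nat -> R}) : realization KA x -> realization KB y ->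
  realization K (product_map x y).
Proof.
move=> xA yB; have [x0 xa [F FAF xF]] := memKA xA; have [y0 yb [F' FBF' yF]] := memKB yB.
have [/allP Fa /allP Fb /andP[/allP uA /allP uB] _ /allP masks] := and5P prodP.
have xFo i j : i \notin F -> overlap x y i j = 0.
  by move=> iF; rewrite /overlap !mass_belowS (xF i iF) addr0 !subrr.
have yFo i j : j \notin F' -> overlap x y i j = 0.
  move=> jF; rewrite overlapC /overlap !mass_belowS (yF j jF) addr0.
  by rewrite !subrr.
pose prs := [seq (i, j) | i <- F, j <- F'].
pose s := [seq p <- prs | overlap x y p.1 p.2 != 0].
have inc : increasing s.
  apply/allP => p; rewrite mem_filter => /andP[ps _].
  apply/allP => p'; rewrite mem_filter => /andP[ps' _]; apply/implyP => pp'.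
  exact: (overlap_chain x0 y0 ps ps' pp').
have smask : s = mask [seq overlap x y p.1 p.2 != 0 | p <- prs] prs by exact: filter_mask.
have signsP (m : seq bool) : m \in signs (size m).
  elim: m => [|c m IH] //; rewrite [signs _]/(allpairs cons _ (signs (size m))).
  by apply/allpairsP; exists (c, m); split=> //=; case: (c).
have /hasP[H HP /allP sH] : has (fun H => all (fun v => v \in H) s) P.
  have /allP/(_ _ FBF')/allP ms := masks _ FAF.
  have := ms [seq overlap x y p.1 p.2 != 0 | p <- prs]; rewrite /= -smask inc.
  apply; have := signsP [seq overlap x y p.1 p.2 != 0 | p <- prs].
  by rewrite size_map size_allpairs.
have oH i j : (i, j) \notin H -> overlap x y i j = 0.
  move=> ijH; apply/eqP/negPn/negP => o0; case/negP: ijH; apply: sH.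
  rewrite mem_filter o0 /=; apply/allpairsP; exists (i, j); split=> //=.
    by apply: contraNT o0 => /xFo ->.
  by apply: contraNT o0 => /yFo ->.
have o0 i j : 0 <= overlap x y i j by exact: overlap_ge0.
exists [fset v in map code H]%fset.
  by apply/imfsetP; exists (map code H) => //=; exact: map_f.
split=> [v|v vH|].
- by apply: sumr_ge0 => p _; rewrite mulr_ge0.
- have [[i [j [ia jb vE]]]|nv] := pselect (exists i j, [/\ (i < a)%N, (j < b)%N & v = code (i, j)]).
    rewrite vE codeE //; apply: oH; apply: contra vH => ijH.
    by rewrite in_fset; apply/mapP; exists (i, j).
  by apply: code0 => i j ia jb vE; apply: nv; exists i, j.
rewrite facet_sum // (eq_big_seq (fun p => overlap x y p.1 p.2)); last first.
  by move=> [i j] ijH; have [ia jb] := bounded HP ijH; rewrite codeE.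
have [/allP PH uH] : all uniq P /\ True.
  by split=> //; apply/allP => G GP; case/and5P: prodP => _ _ _ /allP/(_ _ GP)/and4P[].
have {}uH := PH _ HP.
rewrite -xa /mass_below.
rewrite (eq_bigr (fun i : 'I_a => \sum_(j < b) overlap x y i j)); last first.
  by move=> i _; rewrite rowsE.
rewrite pair_big /= (eq_bigr (fun p : 'I_a * 'I_b => overlap x y p.1 p.2)) //.
rewrite [RHS](bigID (fun p : 'I_a * 'I_b => (val p.1, val p.2) \in H)) /=.
rewrite [X in _ = _ + X]big1 ?addr0; last by move=> [i j] /= /oH.
pose pr (p : 'I_a * 'I_b) := (val p.1, val p.2).
have pr_inj : injective pr.
  by move=> [i j] [i' j'] [] /val_inj -> /val_inj ->.
rewrite -(big_map pr (fun p => p \in H) (fun p => overlap x y p.1 p.2)).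
rewrite -[RHS]big_filter.
apply: perm_big; apply: uniq_perm => //.
  by rewrite filter_uniq // map_inj_uniq // index_enum_uniq.
move=> [i j]; rewrite mem_filter; have [ijH|//] := boolP ((i, j) \in H).
have [ia jb] := bounded HP ijH; apply/esym/mapP.
by exists (Ordinal ia, Ordinal jb) => //; exact: mem_index_enum.
Qed.

(** The marginals of a point of the product have this point as their coupling,
    since its support is a chain. *)
Lemma product_map_surj (z : {ptws V -> R}) : realization K z ->
  exists x y : {ptws nat -> R}, [/\ realization KA x, realization KB y & product_map x y = z].
Proof.
move=> [_ /imfsetP[_ /= /mapP[H HP ->] ->] [z0 zH z1]].
have [/allP Fa /allP Fb /andP[/allP uA /allP uB] /allP PH _] := and5P prodP.
have /and4P[uH /allP inc /hasP[F FF /allP HF] /hasP[F' FF' /allP HF']] := PH _ HP.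
pose c i j := if (i, j) \in H then z (code (i, j)) else 0.
have c0 i j : 0 <= c i j by rewrite /c; case: ifP.
have cH i j : c i j != 0 -> (i, j) \in H by rewrite /c; case: ifP => //; rewrite eqxx.
have cc i j i' j' : c i j != 0 -> c i' j' != 0 -> (i < i')%N -> (j <= j')%N.
  by move=> /cH/inc/allP ij /cH/ij/implyP.
pose x i := \sum_(j < b) c i j; pose y j := \sum_(i < a) c i j.
have x0 i : 0 <= x i by apply: sumr_ge0.
have y0 j : 0 <= y j by apply: sumr_ge0.
have xF i : i \notin F -> x i = 0.
  move=> iF; apply: big1 => j _; apply/eqP/negPn/negP => /cH/HF /= ijF.
  by rewrite ijF in iF.
have yF j : j \notin F' -> y j = 0.
  move=> jF; apply: big1 => i _; apply/eqP/negPn/negP => /cH/HF' /= ijF.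
  by rewrite ijF in jF.
have sumc : \sum_(i < a) \sum_(j < b) c i j = 1.
  rewrite -z1 facet_sum // pair_big /=.
  rewrite (bigID (fun p : 'I_a * 'I_b => (val p.1, val p.2) \in H)) /=.
  rewrite [X in _ + X]big1 ?addr0; last by move=> [i j] /= /negbTE ijH; rewrite /c ijH.
  pose pr (p : 'I_a * 'I_b) := (val p.1, val p.2).
  have pr_inj : injective pr.
    by move=> [i j] [i' j'] [] /val_inj -> /val_inj ->.
  rewrite (eq_bigr (fun p => z (code (pr p)))); last by move=> [i j] /= ijH; rewrite /c ijH.
  rewrite -(big_map pr (fun p => p \in H) (fun p => z (code p))).
  rewrite -[LHS]big_filter.
  apply: perm_big; apply: uniq_perm => //.
    by rewrite filter_uniq // map_inj_uniq // index_enum_uniq.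
  move=> [i j]; rewrite mem_filter; have [ijH|//] := boolP ((i, j) \in H).
  have [ia jb] := bounded HP ijH; apply/mapP.
  by exists (Ordinal ia, Ordinal jb) => //; exact: mem_index_enum.
have xA : realization KA (x : {ptws nat -> R}).
  exists [fset i in F]%fset; first by apply/imfsetP; exists F.
  have xF' i : i \notin [fset i in F]%fset -> x i = 0 by rewrite in_fset; exact: xF.
  by split=> //; rewrite (sum_bounded (Fa _ FF) xF').
have yB : realization KB (y : {ptws nat -> R}).
  exists [fset j in F']%fset; first by apply/imfsetP; exists F'.
  have yF' j : j \notin [fset j in F']%fset -> y j = 0 by rewrite in_fset; exact: yF.
  by split=> //; rewrite (sum_bounded (Fb _ FF') yF') /mass_below exchange_big.
exists x, y; split=> //; apply/funext => v.
have [[i [j [ia jb ->]]]|nv] := pselect (exists i j, [/\ (i < a)%N, (j < b)%N & v = code (i, j)]).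
  rewrite codeE // (chain_coupling (c := c)) // /c; case: ifPn => // ijH.
  apply/esym/zH; rewrite in_fset; apply: contra ijH => /mapP[[i' j'] ijH' /code_inj e].
  by rewrite e //; have [] := bounded HP ijH'.
rewrite code0 ?zH //; last by move=> i j ia jb vE; apply: nv; exists i, j.
rewrite in_fset; apply/negP => /mapP[[i j] ijH vE]; apply: nv; exists i, j.
by have [] := bounded HP ijH.
Qed.

Variables (X Y : topologicalType) (f : X -> {ptws nat -> R}) (g : Y -> {ptws nat -> R}).
Hypotheses (cX : compact [set: X]) (cY : compact [set: Y]).
Hypotheses (fc : continuous f) (fi : injective f) (fK : range f = realization KA).
Hypotheses (gc : continuous g) (gi : injective g) (gK : range g = realization KB).

Definition product_param (w : X * Y) : {ptws V -> R} := product_map (f w.1) (g w.2).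

Let fin x : realization KA (f x). Proof. by rewrite -fK; exists x. Qed.
Let gin y : realization KB (g y). Proof. by rewrite -gK; exists y. Qed.

Lemma product_param_continuous : continuous product_param.
Proof.
have fc1 i : continuous (fun w : X * Y => f w.1 i).
  move=> w; apply: (@continuous_comp _ _ _ (fun w : X * Y => f w.1) (fun x => x i)).
    by apply: continuous_comp; [exact: cvg_fst|exact: fc].
  exact: ptws_eval_continuous.
have gc1 j : continuous (fun w : X * Y => g w.2 j).
  move=> w; apply: (@continuous_comp _ _ _ (fun w : X * Y => g w.2) (fun y => y j)).
    by apply: continuous_comp; [exact: cvg_snd|exact: gc].
  exact: ptws_eval_continuous.
have min_cont k l : continuous (fun w : X * Y =>
    Num.min (mass_below (f w.1) k) (mass_below (g w.2) l)).
  by apply: continuous_minr; apply: continuous_sum => i.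
apply: continuous_ptws => v; apply: continuous_sum => p.
apply: continuous_mul; first exact: continuous_const.
apply: continuous_add; first by apply: continuous_add => //; exact: continuous_opp.
by apply: continuous_opp; apply: continuous_add => //; exact: continuous_opp.
Qed.

Lemma product_param_inj : injective product_param.
Proof.
move=> [x y] [x' y'] /(product_map_inj (fin x) (gin y) (fin x') (gin y'))[/fi -> /gi ->].
by [].
Qed.

Lemma product_param_range : range product_param = realization K.
Proof.
apply/seteqP; split=> [_ [[x y] _ <-]|z /product_map_surj[x [y []]]].
  exact: product_map_realization.
by rewrite -fK -gK => -[x' _ <-] [y' _ <-] <-; exists (x', y').
Qed.

End Product.

(** * Naming the vertices *)

Lemma facets_ofP (V : choiceType) (L : seq (seq V)) (A : {fset V}) :
  reflect (exists2 F, F \in L & A = [fset x in F]%fset) (A \in facets_of L).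
Proof. exact: (iffP (imfsetP _ _ _ _)). Qed.

Section FacetLists.
Variables (V W : choiceType).

Lemma facets_of_cat (L L' : seq (seq V)) :
  (facets_of L `|` facets_of L')%fset = facets_of (L ++ L').
Proof.
apply/fsetP => A; rewrite in_fsetU.
apply/orP/facets_ofP => [[/facets_ofP[F FL ->]|/facets_ofP[F FL ->]]|[F]].
- by exists F; rewrite ?mem_cat ?FL.
- by exists F; rewrite ?mem_cat ?FL ?orbT.
- by rewrite mem_cat => /orP[FL|FL] ->; [left|right]; apply/facets_ofP; exists F.
Qed.

Lemma relabel_facets (f : V -> W) (L : seq (seq V)) :
  relabel f (facets_of L) = facets_of (map (map f) L).
Proof.
have imE (F : seq V) : [fset f x | x in [fset x in F]%fset]%fset = [fset y in map f F]%fset.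
  apply/fsetP => y; rewrite in_fset.
  apply/imfsetP/mapP => [[x /= + ->]|[x xF ->]]; first by rewrite in_fset; exists x.
  by exists x => //=; rewrite in_fset.
apply/fsetP => A; apply/imfsetP/facets_ofP => [[A' /= A'L ->]|].
  have /facets_ofP[F FL ->] : A' \in facets_of L := A'L.
  by exists (map f F); [exact: map_f|exact: imE].
move=> [_ /mapP[F FL ->] ->]; exists [fset x in F]%fset; last by rewrite imE.
by apply/facets_ofP; exists F.
Qed.

Lemma eq_facets_of (L L' : seq (seq V)) : L =i L' -> facets_of L = facets_of L'.
Proof.
move=> LL; apply/fsetP => A.
by apply/facets_ofP/facets_ofP => -[F FL ->]; exists F; rewrite ?LL // -LL.
Qed.

Definition included (L L' : seq (seq nat)) : bool :=
  all (fun F => has (fun F' => all (mem F) F' && all (mem F') F) L') L.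

Lemma facets_of_included (f : nat -> V) (L L' : seq (seq nat)) :
  included L L' -> included L' L ->
  facets_of (map (map f) L) = facets_of (map (map f) L').
Proof.
have sub l l' A : included l l' -> A \in facets_of (map (map f) l) ->
    A \in facets_of (map (map f) l').
  move=> /allP ll /facets_ofP[_ /mapP[F Fl ->] ->].
  have /hasP[F' F'l /andP[/allP F'F /allP FF']] := ll _ Fl.
  apply/facets_ofP; exists (map f F'); first exact: map_f.
  apply/fsetP => v; rewrite !in_fset.
  by apply/mapP/mapP => -[k kF ->]; exists k => //; [exact: FF'|exact: F'F].
by move=> i1 i2; apply/fsetP => A; apply/idP/idP; apply: sub.
Qed.

End FacetLists.

Section Certificate.
Variables (R : realType) (p : nat) (M : topologicalType).
Notation V := (nat * 'I_p.+1)%type.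

(** Vertices are written as numbers [i * p.+1 + g] in the certificates. *)
Definition decode (c : nat) : V := ((c %/ p.+1)%N, inZp c).

(** The inclusions compare facets as sets.  The table must be injective on the
    names that survive the flips, for it would identify vertices otherwise. *)
Definition certifies (L0 : seq (seq V)) (c : seq (seq nat)) (table : seq nat)
    (K : seq (seq nat)) : bool :=
  if flips (map (map decode) c) L0 is Some L then
    let ids := undup (flatten [seq map fst F | F <- L]) in
    let K' := [seq [seq nth 0 table v.1 | v <- F] | F <- L] in
    [&& evenly_covered L, uniq (map (nth 0%N table) ids), included K' K & included K K']
  else false.

(** The statement leaves the names of the vertices open, so one computation serves
    all the values of the indices [m] and [n]. *)
Definition models (K : seq (seq nat)) := forall (W : choiceType) (name : nat -> W),
  {in flatten K &, injective name} ->
  triangulates R (facets_of (map (map name) K)) M.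

Lemma certified L0 c table K :
  (forall L (W : choiceType) (name : nat -> W),
    flips (map (map decode) c) L0 = Some L -> evenly_covered L ->
    {in flatten [seq map fst F | F <- L] &, injective name} ->
    triangulates R (facets_of [seq [seq name v.1 | v <- F] | F <- L]) M) ->
  certifies L0 c table K -> models K.
Proof.
move=> flipsM; rewrite /certifies; case E : (flips _ _) => [L|] //.
move=> /and4P[covL tinj K'K KK'] W name name_inj.
rewrite -(facets_of_included _ K'K KK') -map_comp.
rewrite (eq_map (g := fun F => [seq name (nth 0%N table v.1) | v <- F])); last first.
  by move=> F; rewrite /= -map_comp.
apply: (flipsM _ _ (name \o nth 0%N table) E covL) => i j iL jL /= ij.
have inK k : k \in flatten [seq map fst F | F <- L] -> nth 0%N table k \in flatten K.
  move=> /flattenP[_ /mapP[F FL ->] kF].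
  have /hasP[F' F'K /andP[_ /allP sub]] :=
    allP K'K _ (map_f (fun F => [seq nth 0%N table v.1 | v <- F]) FL).
  apply/flattenP; exists F' => //; apply: sub.
  by case/mapP: kF => v vF ->; apply: map_f.
have {}ij := name_inj _ _ (inK _ iL) (inK _ jL) ij.
have iu : i \in undup (flatten [seq map fst F | F <- L]) by rewrite mem_undup.
have ju : j \in undup (flatten [seq map fst F | F <- L]) by rewrite mem_undup.
rewrite -(nth_index 0%N iu) -(nth_index 0%N ju).
congr (nth _ _ _); apply/eqP.
rewrite -(nth_uniq 0%N _ _ tinj) ?size_map ?index_mem //.
by rewrite !(nth_map 0%N) ?index_mem // !nth_index // ij.
Qed.

End Certificate.

(** The invariant [f] tells the groups apart. *)
Lemma uniq_flatten (T : eqType) (U : eqType) (f : T -> U) (groups : seq (U * seq T)) :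
  uniq (map fst groups) -> all (fun g => uniq g.2 && all (fun x => f x == g.1) g.2) groups ->
  uniq (flatten (map snd groups)).
Proof.
elim: groups => [|[t s] groups IH] //= /andP[tg ug] /andP[/andP[us /allP fs] ag].
rewrite cat_uniq us IH // andbT /=; apply/hasPn => x /flattenP[_ /mapP[g gg ->] xg].
apply/negP => /fs /eqP ft; move/allP: ag => /(_ _ gg) /andP[_ /allP/(_ _ xg)/eqP fg].
by case/mapP: tg; exists g; rewrite // -ft -fg.
Qed.

(** * The complexes T_j and T_(j,n) *)

(** The common form of [T4], [T5] and [T6].  The indices are natural numbers, so
    that the vertices may be replaced by numerical codes. *)
Definition ring_facets (V : Type) (u v w : V) (q z : nat -> V) : seq (seq V) :=
  flatten [seq
    let s k := ((i + k) %% 7)%N in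
    [:: [:: w; u; z i; z (s 1)];
        [:: w; z i; z (s 1); q (s 2)];
        [:: w; z (s 6); q i; q (s 1)];
        [:: v; w; q i; q (s 1)];
        [:: v; q i; z (s 1); z (s 2)];
        [:: v; q i; q (s 1); z (s 2)];
        [:: u; v; z i; z (s 1)];
        [:: z (s 6); q i; q (s 1); z (s 2)];
        [:: z (s 5); z (s 6); q i; z (s 1)];
        [:: z (s 6); q i; z (s 1); z (s 2)]] | i <- iota 0 7]%N.

Definition ring_facets_Z7 (u v w : vertex) (q z : 'Z_7 -> vertex) (i : 'Z_7) :=
  [:: tet w u (z i) (z (i + 1));
      tet w (z i) (z (i + 1)) (q (i + 2));
      tet w (z (i - 1)) (q i) (q (i + 1));
      tet v w (q i) (q (i + 1));
      tet v (q i) (z (i + 1)) (z (i + 2));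
      tet v (q i) (q (i + 1)) (z (i + 2));
      tet u v (z i) (z (i + 1));
      tet (z (i - 1)) (q i) (q (i + 1)) (z (i + 2));
      tet (z (i - 2)) (z (i - 1)) (q i) (z (i + 1));
      tet (z (i - 1)) (q i) (z (i + 1)) (z (i + 2))].

Lemma natr_mod7 k : ((k %% 7)%N%:R : 'Z_7) = k%:R.
Proof. by rewrite !Zp_nat; apply: val_inj; rewrite /= modn_mod. Qed.

(** The index may be shifted, which is the symmetry of order 7. *)
Lemma ring_facets_shift u v w (q z : 'Z_7 -> vertex) (d : 'Z_7) :
  facets_of (flatten [seq ring_facets_Z7 u v w q z i | i <- enum 'Z_7]) =
  facets_of (ring_facets u v w (fun k => q (k%:R + d)) (fun k => z (k%:R + d))).
Proof.
have -> : ring_facets u v w (fun k => q (k%:R + d)) (fun k => z (k%:R + d)) =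
    flatten [seq ring_facets_Z7 u v w q z (k%:R + d) | k <- iota 0 7].
  congr flatten; apply: eq_map => k; rewrite /ring_facets_Z7 /tet !natr_mod7 !natrD.
  have -> : 6%:R = -1 :> 'Z_7 by apply/val_inj.
  have -> : 5%:R = -2 :> 'Z_7 by apply/val_inj.
  by rewrite ![_ + _ + d]addrAC.
have e : enum 'Z_7 =i [seq k%:R + d | k <- iota 0 7].
  move=> i; rewrite mem_enum; apply/esym/mapP; exists (val (i - d)).
    by rewrite mem_iota leq0n add0n; exact: (ltn_ord (i - d)).
  by rewrite natr_Zp subrK.
apply: eq_facets_of => F.
apply/flattenP/flattenP => -[_ /mapP[i iI ->] Fi].
  move: iI; rewrite e => /mapP[k kI ik]; exists (ring_facets_Z7 u v w q z i) => //.
  by rewrite ik; apply: (map_f (fun k => ring_facets_Z7 u v w q z (k%:R + d))).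
by exists (ring_facets_Z7 u v w q z (i%:R + d)) => //; apply: map_f; rewrite mem_enum.
Qed.

Definition qrs (e n : nat) (i : 'Z_7) : vertex :=
  match e with 0 => qv n i | 1 => rv n i | _ => sv n i end%N.

(** Multiplication by 2 or 4 has an inverse modulo 7, so a relabelling can be
    undone by shifting the cyclic index. The offset [b] is therefore free. *)
Lemma T456E e n (b : 'Z_7) : (e < 3)%N -> exists d : 'Z_7,
  T (4 + e) n = facets_of (ring_facets (uv (4 + e) n) (vv (4 + e) n) (wv (4 + e) n)
    (fun k => qrs e n (k%:R + d)) (fun k => zv (2 ^+ e * k%:R + b))).
Proof.
have rel j (a : 'Z_7) q' : relabel (relabel_vertex j n a q') (T4 0) =
    facets_of (flatten [seq ring_facets_Z7 (uv j n) (vv j n) (wv j n) q'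
      (fun i => zv (a * i + n%:R)) i | i <- enum 'Z_7]).
  by rewrite relabel_facets map_flatten -map_comp.
case: e => [|[|[|e]]] // _.
- exists b; rewrite [LHS](ring_facets_shift (uv 4 n) (vv 4 n) (wv 4 n) (qv n) zv b).
  by congr (facets_of (ring_facets _ _ _ _ _)); apply/funext => k; rewrite mul1r.
- exists (4 * (b - n%:R)); rewrite [LHS]rel (ring_facets_shift _ _ _ _ _ (4 * (b - n%:R))).
  congr (facets_of (ring_facets _ _ _ _ _)); apply/funext => k.
  rewrite mulrDr mulrA (_ : 2 * 4 = 1); last by apply/val_inj.
  by rewrite mul1r -addrA subrK.
- exists (2 * (b - n%:R)); rewrite [LHS]rel (ring_facets_shift _ _ _ _ _ (2 * (b - n%:R))).
  congr (facets_of (ring_facets _ _ _ _ _)); apply/funext => k.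
  rewrite mulrDr mulrA (_ : 4 * 2 = 1); last by apply/val_inj.
  rewrite mul1r -addrA subrK; congr (zv (_ * _ + _)); by apply/val_inj.
Qed.

(** The codes are positions in this list: 0 to 6 for the integers modulo 7, then
    7, 8, 9 for [u], [v], [w] and 10 to 16 for [q], and from 17 on the vertices
    that occur only in the other complex of a union. *)
Definition ring_names (z : nat -> vertex) (u v w : vertex) (q : nat -> vertex)
    (rest : seq vertex) : seq vertex :=
  map z (iota 0 7) ++ [:: u; v; w] ++ map q (iota 0 7) ++ rest.

Definition ring_code : seq (seq nat) := (ring_facets 7 8 9 (addn 10) id)%N.
(** The second complex has its multiplier on the integers modulo 7 divided by that
    of the first complex; the quotient is [c]. *)
Definition ring_code2 (c : nat) : seq (seq nat) :=
  (ring_facets 17 18 19 (addn 20) (fun k => (c * k) %% 7))%N.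

Definition noname : vertex := zv 0.

Lemma map_ring_code z u v w q rest :
  map (map (nth noname (ring_names z u v w q rest))) ring_code = ring_facets u v w q z.
Proof. by []. Qed.

Lemma map_ring_code2 c z u v w q u' v' w' q' : c \in [:: 1; 2]%N ->
  map (map (nth noname (ring_names z u v w q ([:: u'; v'; w'] ++ map q' (iota 0 7)))))
    (ring_code2 c) = ring_facets u' v' w' q' (fun k => z ((c * k) %% 7)%N).
Proof. by rewrite !inE => /orP[] /eqP ->. Qed.

(** Everything but the residue modulo 7. *)
Definition vertex_kind (v : vertex) : nat * nat * nat := (vertex_encode v).1.

Definition affine (e : nat) (b : 'Z_7) (k : nat) : vertex := zv (2 ^+ e * k%:R + b).

Lemma natr7_inj : {in iota 0 7 &, injective (fun k => k%:R : 'Z_7)}.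
Proof.
move=> i j; rewrite !mem_iota /= !add0n => i7 j7; rewrite !Zp_nat => /(congr1 val) /=.
by rewrite !modn_small.
Qed.

Lemma affine_uniq e b : uniq (map (affine e b) (iota 0 7)).
Proof.
rewrite map_inj_in_uniq // => i j i7 j7 ij; apply: natr7_inj => //.
pose index v := if v is zv x then x else 0.
move/(congr1 index): ij => /= /addIr ij.
have e1 : 4 ^+ e * 2 ^+ e = 1 :> 'Z_7.
  by rewrite -exprMn (_ : 4 * 2 = 1) ?expr1n //; apply/val_inj.
by move/(congr1 ( *%R (4 ^+ e))): ij; rewrite !mulrA e1 !mul1r.
Qed.

Lemma qrs_uniq e n d : uniq [seq qrs e n (k%:R + d) | k <- iota 0 7].
Proof.
rewrite map_inj_in_uniq // => i j i7 j7 ij; apply: natr7_inj => //.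
pose index v := match v with qv _ x | rv _ x | sv _ x => x | _ => 0 end.
by apply: (@addIr _ d); case: e ij => [|[|e]] /(congr1 index).
Qed.

Lemma qrs_kind e n i : (e < 3)%N -> vertex_kind (qrs e n i) = ((4 + e)%N, n, 0%N).
Proof. by case: e => [|[|[|e]]]. Qed.

Definition named_groups e n b d (rest : seq (nat * nat * nat * seq vertex)) :=
  [:: ((0, 0, 0)%N, map (affine e b) (iota 0 7));
      ((1, 4 + e, n)%N, [:: uv (4 + e) n]); ((2, 4 + e, n)%N, [:: vv (4 + e) n]);
      ((3, 4 + e, n)%N, [:: wv (4 + e) n]);
      ((4 + e, n, 0)%N, [seq qrs e n (k%:R + d) | k <- iota 0 7])] ++ rest.

Lemma ring_names_uniq e n b d rest : (e < 3)%N ->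
  uniq (map fst (named_groups e n b d rest)) ->
  all (fun g => uniq g.2 && all (fun x => vertex_kind x == g.1) g.2) rest ->
  uniq (ring_names (affine e b) (uv (4 + e) n) (vv (4 + e) n) (wv (4 + e) n)
    (fun k => qrs e n (k%:R + d)) (flatten (map snd rest))).
Proof.
move=> e3 ug ar.
have -> : ring_names (affine e b) (uv (4 + e) n) (vv (4 + e) n) (wv (4 + e) n)
    (fun k => qrs e n (k%:R + d)) (flatten (map snd rest)) =
    flatten (map snd (named_groups e n b d rest)) by [].
apply: (uniq_flatten (f := vertex_kind)) => //.
rewrite all_cat ar andbT; apply/and5P; split.
- by rewrite affine_uniq; apply/allP => _ /mapP[k _ ->].
- by rewrite /= /vertex_kind /= eqxx.
- by rewrite /= /vertex_kind /= eqxx.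
- by rewrite /= /vertex_kind /= eqxx.
- by rewrite andbT qrs_uniq; apply/allP => _ /mapP[k _ ->]; rewrite /= qrs_kind.
Qed.

Lemma nth_affine e b u v w q rest k : (k < 7)%N ->
  nth noname (ring_names (affine e b) u v w q rest) k = affine e b k.
Proof. by do 7!(case: k => [//|k]). Qed.

Lemma affine_mod c e e' b k : c%:R * 2 ^+ e = 2 ^+ e' :> 'Z_7 ->
  affine e b ((c * k) %% 7) = affine e' b k.
Proof.
by move=> ce; rewrite /affine natr_mod7 natrM mulrA [2 ^+ e * _]mulrC ce.
Qed.

Lemma nth_names_inj (ns : seq vertex) (K : seq (seq nat)) : uniq ns ->
  all (all (fun k => (k < size ns)%N)) K ->
  {in flatten K &, injective (nth noname ns)}.
Proof.
move=> uns /allP Kn i j /flattenP[F FK iF] /flattenP[F' FK' jF'] /eqP.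
by rewrite nth_uniq ?(allP (Kn _ FK) _ iF) ?(allP (Kn _ FK') _ jF') // => /eqP.
Qed.

(** Only the quotient [c] of the two multipliers matters, since the naming of the
    codes contains the multiplier of the first complex. *)
Lemma triangulates_two_rings (R : realType) (M : topologicalType) c e n e' n' :
  models R M (ring_code ++ ring_code2 c) -> c \in [:: 1; 2]%N -> (e < 3)%N -> (e' < 3)%N ->
  c%:R * 2 ^+ e = 2 ^+ e' :> 'Z_7 -> (e, n) != (e', n') ->
  triangulates R (T (4 + e) n `|` T (4 + e') n')%fset M.
Proof.
move=> KM c12 e3 e3' ce en.
have [d ->] := T456E n 0 e3; have [d' ->] := T456E n' 0 e3'.
pose rest := [:: ((1, 4 + e', n')%N, [:: uv (4 + e') n']);
  ((2, 4 + e', n')%N, [:: vv (4 + e') n']); ((3, 4 + e', n')%N, [:: wv (4 + e') n']);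
  ((4 + e', n', 0)%N, [seq qrs e' n' (k%:R + d') | k <- iota 0 7])].
pose ns := ring_names (affine e 0) (uv (4 + e) n) (vv (4 + e) n) (wv (4 + e) n)
    (fun k => qrs e n (k%:R + d)) (flatten (map snd rest)).
have uns : uniq ns.
  apply: ring_names_uniq => //.
    rewrite /= !inE !xpair_eqE !eqn_add2l !eqxx /=.
    by move: en; rewrite xpair_eqE; case: e e3 {ce ns d} => [|[|[|e]]] //;
      case: e' e3' {d' rest} => [|[|[|e']]] // _ _ /negbTE /= ->.
  apply/and5P; split=> //; try by rewrite /= /vertex_kind /= eqxx.
  by rewrite qrs_uniq; apply/allP => _ /mapP[k _ ->]; rewrite /= qrs_kind.
rewrite facets_of_cat.
rewrite -(map_ring_code (affine e 0) (uv (4 + e) n) (vv (4 + e) n) (wv (4 + e) n)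
    (fun k => qrs e n (k%:R + d)) (flatten (map snd rest))).
rewrite (_ : ring_facets (uv (4 + e') n') _ _ _ _ = map (map (nth noname ns)) (ring_code2 c)).
  rewrite -map_cat; apply: KM; apply: nth_names_inj => //.
  by move: c12; rewrite !inE => /orP[] /eqP ->.
rewrite [RHS](map_ring_code2 _ _ _ _ _ _ _ _ (fun k => qrs e' n' (k%:R + d')) c12).
by congr ring_facets; apply/funext => k; rewrite (affine_mod _ _ ce).
Qed.

(** In [codes1], [codes10] and [codes10'], for [T1], [T1_0] and [T1_0'], the codes
    17, 18 and 19 stand for [u], [v] and [w]. *)
Definition codes1 : seq (seq nat) :=
  [:: [:: 0; 1; 2; 3]; [:: 1; 2; 3; 4]; [:: 2; 3; 4; 5]; [:: 3; 4; 5; 6];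
      [:: 0; 4; 5; 6]; [:: 0; 1; 5; 6]; [:: 0; 1; 2; 6]]%N.

Definition codes10 : seq (seq nat) :=
  [:: [:: 17; 0; 1; 2]; [:: 17; 0; 1; 3]; [:: 17; 0; 2; 3]; [:: 17; 1; 2; 4];
      [:: 17; 1; 3; 4]; [:: 17; 2; 3; 5]; [:: 17; 2; 4; 5];
      [:: 18; 3; 4; 6]; [:: 18; 3; 5; 6]; [:: 18; 0; 4; 5]; [:: 18; 0; 4; 6];
      [:: 18; 0; 1; 5]; [:: 18; 1; 5; 6]; [:: 18; 0; 1; 2]; [:: 18; 0; 2; 6];
      [:: 18; 1; 2; 6];
      [:: 17; 18; 3; 4]; [:: 17; 18; 3; 5]; [:: 17; 18; 4; 5]]%N.

Definition same_set (F F' : seq nat) : bool := all (mem F) F' && all (mem F') F.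

Definition codes10' : seq (seq nat) :=
  [seq F <- codes10 | ~~ has (same_set F) [:: [:: 17; 0; 1; 2]; [:: 18; 0; 1; 2]]] ++
  [:: [:: 17; 19; 0; 1]; [:: 17; 19; 0; 2]; [:: 17; 19; 1; 2];
      [:: 18; 19; 0; 1]; [:: 18; 19; 0; 2]; [:: 18; 19; 1; 2]]%N.

Definition ball_codes : seq nat := iota 0 7 ++ [:: 17; 18; 19]%N.

Definition ball_vertex (j m : nat) (b : 'Z_7) (k : nat) : vertex :=
  if (k < 7)%N then affine j b k
  else if k == 17%N then uv j.+1 m else if k == 18%N then vv j.+1 m else wv j.+1 m.

Lemma facets_of_setD (V : choiceType) (f : nat -> V) (L L' : seq (seq nat)) :
  {in flatten (L ++ L') &, injective f} ->
  (facets_of (map (map f) L) `\` facets_of (map (map f) L'))%fset =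
  facets_of (map (map f) [seq F <- L | ~~ has (same_set F) L']).
Proof.
move=> f_inj; have same F F' : F \in L -> F' \in L' ->
    ([fset x in map f F] == [fset x in map f F'])%fset = same_set F F'.
  move=> FL FL'.
  have sub G G' : G \in L ++ L' -> G' \in L ++ L' ->
      {subset map f G <= map f G'} -> all (mem G') G.
    move=> GL GL' s; apply/allP => k kG.
    have /mapP[k' k'G /f_inj ->] := s _ (map_f f kG) => //.
      by apply/flattenP; exists G.
    by apply/flattenP; exists G'.
  have FLL : F \in L ++ L' by rewrite mem_cat FL.
  have FLL' : F' \in L ++ L' by rewrite mem_cat FL' orbT.
  apply/eqP/andP => [/fsetP e|[/allP s1 /allP s2]].
    by split; apply: sub => // x; have := e x; rewrite !in_fset => ->.
  apply/fsetP => x; rewrite !in_fset.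
  by apply/mapP/mapP => -[k kF ->]; exists k => //; [exact: s2|exact: s1].
apply/fsetP => A; rewrite in_fsetD.
apply/andP/facets_ofP => [[nA /facets_ofP[_ /mapP[F FL ->] AE]]|].
  exists (map f F) => //; rewrite AE in nA; apply: map_f; rewrite mem_filter FL andbT.
  apply: contra nA => /hasP[F' FL']; rewrite -same // => /eqP ->.
  by apply/facets_ofP; exists (map f F'); rewrite ?map_f.
move=> [_ /mapP[F + ->] ->]; rewrite mem_filter => /andP[nF FL]; split; last first.
  by apply/facets_ofP; exists (map f F); rewrite ?map_f.
apply: contra nF => /facets_ofP[_ /mapP[F' FL' ->] /eqP]; rewrite same // => ?.
by apply/hasP; exists F'.
Qed.

Lemma uniq_map_inj (S S' : eqType) (f : S -> S') (s : seq S) :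
  uniq (map f s) -> {in s &, injective f}.
Proof.
elim: s => [|x s IH] //= /andP[xs us] i j; rewrite !inE.
move=> /predU1P[->|is_] /predU1P[->|js] // e; last exact: IH.
- by case/negP: xs; rewrite e map_f.
- by case/negP: xs; rewrite -e map_f.
Qed.

Lemma T1_0E : T1_0 = facets_of (map (map (ball_vertex 0 0 0)) codes10).
Proof.
rewrite /T1_0 /codes10 /= /ball_vertex /= /affine.
by rewrite !(mul1r, addr0).
Qed.

Lemma T1_0'E : T1_0' = facets_of (map (map (ball_vertex 0 0 0)) codes10').
Proof.
rewrite /codes10' map_cat -facets_of_cat -facets_of_setD -?T1_0E; last first.
  have /uniq_map_inj inj : uniq (map (ball_vertex 0 0 0) ball_codes) by [].
  have /allP sub : all (mem ball_codes)
      (flatten (codes10 ++ [:: [:: 17; 0; 1; 2]; [:: 18; 0; 1; 2]]%N)) by [].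
  by move=> i j /sub ib /sub jb; exact: inj.
have zE (i : 'Z_7) : 2 ^+ 0 * i + 0 = i by rewrite mul1r addr0.
by rewrite /T1_0' /= /ball_vertex /= /affine !zE.
Qed.

Lemma T123E j m : (j < 3)%N -> T j.+1 m =
  facets_of (map (map (ball_vertex j m m%:R)) (if (m <= 6)%N then codes10 else codes10')).
Proof.
move=> j3; have -> : T j.+1 m = relabel (relabel_vertex j.+1 m (2 ^+ j) (qv m))
    (if (m <= 6)%N then T1_0 else T1_0') by case: j j3 => [|[|[|j]]].
case: (m <= 6)%N; rewrite ?T1_0E ?T1_0'E relabel_facets -map_comp;
congr facets_of; apply: eq_map => F; rewrite /= -map_comp; apply: eq_map => k;
rewrite /= /ball_vertex; case: ifP => _; try by do 2?case: ifP.
all: by rewrite /affine /= mul1r addr0.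
Qed.

Definition mult (c k : nat) : nat := if (k < 7)%N then ((c * k) %% 7)%N else k.

Definition codes2 : seq (seq nat) :=
  [:: [:: 0; 2; 4; 6]; [:: 1; 2; 4; 6]; [:: 1; 3; 4; 6]; [:: 1; 3; 5; 6];
      [:: 0; 1; 3; 5]; [:: 0; 2; 3; 5]; [:: 0; 2; 4; 5]]%N.

Definition codes3 : seq (seq nat) :=
  [:: [:: 0; 1; 4; 5]; [:: 1; 2; 4; 5]; [:: 1; 2; 5; 6]; [:: 2; 3; 5; 6];
      [:: 0; 2; 3; 6]; [:: 0; 3; 4; 6]; [:: 0; 1; 3; 4]]%N.

Definition solid_torus (j : nat) : {fset {fset vertex}} :=
  match j with 0 => T1 | 1 => T2 | _ => T3 end%N.

Lemma solid_torusE j : (j < 3)%N ->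
  solid_torus j = facets_of (map (map (ball_vertex j 0 0)) codes1).
Proof.
move=> j3; have -> : map (map (ball_vertex j 0 0)) codes1 =
    map (map zn) (map (map (mult (2 ^ j))) codes1).
  rewrite -map_comp; apply/eq_in_map => F FC; rewrite /= -map_comp; apply/eq_in_map => k kF.
  have /allP/(_ _ FC)/allP/(_ _ kF) k7 : all (all (fun k => k < 7)%N) codes1 by [].
  rewrite /ball_vertex /mult /= k7 /affine /zn natr_mod7 natrM natrX addr0.
  by [].
case: j j3 => [|[|[|j]]] j3; last exact: (False_ind _ (notF j3)).
- exact: (@facets_of_included _ zn codes1 (map (map (mult (2 ^ 0))) codes1) isT isT).
- exact: (@facets_of_included _ zn codes2 (map (map (mult (2 ^ 1))) codes1) isT isT).
- exact: (@facets_of_included _ zn codes3 (map (map (mult (2 ^ 2))) codes1) isT isT).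
Qed.

(** Dividing all the multipliers by that of the second complex leaves [c] on the
    first one. *)
Lemma triangulates_ball_ring (R : realType) (M : topologicalType) C c e j m n b :
  models R M (map (map (mult c)) C ++ ring_code) ->
  all (all (fun k => k \in ball_codes)) C -> (e < 3)%N -> (j < 3)%N ->
  c%:R * 2 ^+ e = 2 ^+ j :> 'Z_7 ->
  triangulates R (facets_of (map (map (ball_vertex j m b)) C) `|` T (4 + e) n)%fset M.
Proof.
move=> KM Cb e3 j3 ce; have [d ->] := T456E n b e3.
pose rest := [:: ((1, j.+1, m)%N, [:: uv j.+1 m]); ((2, j.+1, m)%N, [:: vv j.+1 m]);
  ((3, j.+1, m)%N, [:: wv j.+1 m])].
pose ns := ring_names (affine e b) (uv (4 + e) n) (vv (4 + e) n) (wv (4 + e) n)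
    (fun k => qrs e n (k%:R + d)) (flatten (map snd rest)).
have uns : uniq ns.
  apply: ring_names_uniq => //; last by rewrite /= /vertex_kind /= !eqxx.
  rewrite /= !inE !xpair_eqE !andbT !orbF /=.
  by case: e e3 {ce ns d} => [|[|[|e]]] //; case: j j3 {rest} => [|[|[|j]]].
have -> : map (map (ball_vertex j m b)) C = map (map (nth noname ns)) (map (map (mult c)) C).
  rewrite -map_comp; apply/eq_in_map => F FC; rewrite /= -map_comp; apply/eq_in_map => k kF.
  have := allP (allP Cb _ FC) _ kF; rewrite mem_cat => /orP[|].
    rewrite mem_iota /= add0n /ball_vertex /mult => k7.
    by rewrite k7 nth_affine ?ltn_mod // (affine_mod _ _ ce).
  by rewrite !inE => /or3P[] /eqP ->.
rewrite -(map_ring_code (affine e b) (uv (4 + e) n) (vv (4 + e) n) (wv (4 + e) n)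
    (fun k => qrs e n (k%:R + d)) (flatten (map snd rest))).
rewrite facets_of_cat -map_cat; apply: KM; apply: nth_names_inj => //.
rewrite all_cat andbC; apply/andP; split; first by [].
rewrite all_map; apply/allP => F FC; rewrite /= all_map; apply/allP => k kF.
have := allP (allP Cb _ FC) _ kF; rewrite mem_cat => /orP[|]; last first.
  by rewrite !inE => /or3P[] /eqP ->.
rewrite mem_iota /= add0n /mult => k7.
by rewrite k7; apply: (@ltn_trans 7); rewrite ?ltn_mod.
Qed.

Lemma triangulates_pair (R : realType) (M : topologicalType) c :
  {in [:: codes1; codes10; codes10'], forall C,
    models R M (map (map (mult c)) C ++ ring_code)} ->
  forall e j m n, (e < 3)%N -> (j < 3)%N -> c%:R * 2 ^+ e = 2 ^+ j :> 'Z_7 ->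
  triangulates R (solid_torus j `|` T (4 + e) n)%fset M /\
  triangulates R (T j.+1 m `|` T (4 + e) n)%fset M.
Proof.
move=> KM e j m n e3 j3 ce; rewrite solid_torusE // T123E //; split.
  by apply: (triangulates_ball_ring (c := c)) => //; apply: KM; rewrite inE eqxx.
by case: ifP => _; apply: (triangulates_ball_ring (c := c)) => //; apply: KM;
  rewrite !inE eqxx ?orbT.
Qed.

(** * The certificates *)

Section Certificates.
Local Open Scope nat_scope.

(** Each list of flips first simplifies the model and then retraces backwards the
    flips that simplify the target.  The lists whose names end in [uv] lead on
    from [T1], [T2] or [T3] to the complex with the vertices [u] and [v], those
    whose names end in [w] replace two facets by six around [w]. *)
Definition S3_flips : seq (seq nat) :=
  [:: [:: 0; 1; 3]; [:: 1; 3]; [:: 1; 4]; [:: 0; 3]; [:: 3]; [:: 4]; [:: 5]; [:: 0; 1; 2; 7; 8];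
      [:: 0; 2; 6; 7; 9]; [:: 0; 2; 7]; [:: 0; 1; 7; 8; 10]; [:: 1; 2; 6; 7; 11]; [:: 0; 7; 8];
      [:: 2; 7; 8; 9; 12]; [:: 2; 6; 7]; [:: 2; 7; 9]; [:: 1; 2; 7; 8; 13]; [:: 2; 7; 11];
      [:: 1; 2; 7; 12; 14]; [:: 0; 1; 6; 7; 15]; [:: 1; 7; 8]; [:: 2; 7; 8; 13; 16];
      [:: 7; 8; 9]; [:: 0; 1; 7; 15; 17]; [:: 7; 8; 10]; [:: 2; 7; 12]; [:: 1; 6; 7];
      [:: 1; 7; 15]; [:: 7; 8; 12]; [:: 1; 7; 11]; [:: 1; 7; 17]; [:: 1; 7; 12];
      [:: 1; 7; 10; 13; 18]; [:: 7; 12; 14]; [:: 1; 7; 13]; [:: 0; 7; 12]; [:: 2; 7; 13];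
      [:: 7; 10; 13]; [:: 0; 7; 17]; [:: 7; 13; 18]; [:: 7; 8; 13; 16; 19]; [:: 0; 7; 15];
      [:: 7; 13; 16]; [:: 7; 12; 13]; [:: 0; 7; 13]; [:: 0; 13; 14]; [:: 12; 13; 17];
      [:: 6; 7; 13]; [:: 0; 12; 13]; [:: 12; 13; 19]; [:: 13; 16; 19]; [:: 6; 13; 14];
      [:: 6; 12; 13]; [:: 6; 13; 16]; [:: 8; 13; 16]; [:: 2; 13; 16]; [:: 13; 16]].

Definition S3_flips_uv : seq (seq nat) :=
  [:: [:: 1; 2; 8; 13; 20]; [:: 2; 8; 13]; [:: 0; 1; 2; 6; 21]; [:: 0; 1; 2]; [:: 0; 1; 6];
      [:: 8; 13; 15]; [:: 0; 6; 15]; [:: 6; 13; 15]].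

Definition S3_flips_w : seq (seq nat) :=
  [:: [:: 1; 2; 8; 21; 22]; [:: 1; 2; 8]].

Definition S3_table : seq nat :=
  [:: 6; 0; 1; 0; 0; 0; 5; 9; 2; 10; 11; 16; 8; 3; 7; 4; 13; 15; 12; 14; 17; 18; 19].

Definition L31_flips : seq (seq nat) :=
  [:: [:: 0; 5; 6; 11; 12]; [:: 0; 5; 11]; [:: 3; 6; 9]; [:: 3; 9]; [:: 0; 3; 8; 11; 15];
      [:: 0; 3; 11]; [:: 0; 6; 11]; [:: 0; 11]; [:: 3; 8; 11; 15; 18]; [:: 3; 8; 15];
      [:: 3; 8; 11]; [:: 0; 5; 7]; [:: 3; 8]; [:: 3; 11; 18]; [:: 3; 11]; [:: 0; 5; 8; 12; 21];
      [:: 0; 5; 8; 21; 26]; [:: 0; 8; 12]; [:: 9; 19]; [:: 6; 13; 16; 22; 28]; [:: 6; 13; 16];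
      [:: 0; 6; 15]; [:: 6; 9; 13]; [:: 0; 5; 8]; [:: 0; 8; 17]; [:: 0; 8; 10]; [:: 0; 3; 15];
      [:: 6; 13; 28]; [:: 0; 8; 15]; [:: 0; 15]; [:: 6; 13]; [:: 0; 8]; [:: 0; 3; 7]; [:: 3; 7];
      [:: 0; 5; 9; 12; 32]; [:: 0; 5; 12]; [:: 0; 5; 21]; [:: 0; 21; 26]; [:: 0; 21];
      [:: 0; 5; 32]; [:: 0; 5; 9; 26; 35]; [:: 0; 10; 17]; [:: 0; 5; 9]; [:: 0; 5; 20];
      [:: 0; 5]; [:: 6; 9; 16]; [:: 9; 13; 16]; [:: 9; 13]; [:: 0; 9; 20; 35; 38]; [:: 9; 16];
      [:: 15; 18; 33]; [:: 0; 20; 35]; [:: 0; 5; 35]; [:: 0; 5]; [:: 18; 33]; [:: 6; 15; 27];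
      [:: 6; 15]; [:: 0; 9; 12; 32; 39]; [:: 0; 3; 12]; [:: 0; 3; 13]; [:: 0; 3; 10; 18; 44];
      [:: 0; 12; 32]; [:: 3; 13]; [:: 0; 12; 18]; [:: 0; 12]; [:: 3; 10; 24]; [:: 9; 26];
      [:: 0; 10; 18]; [:: 0; 7; 9; 20; 46]; [:: 3; 10; 30]; [:: 3; 30]; [:: 0; 3; 10];
      [:: 0; 10; 26]; [:: 0; 10; 22]; [:: 0; 7; 9]; [:: 0; 10]; [:: 0; 7; 28]; [:: 6; 11; 19];
      [:: 6; 12; 18]; [:: 6; 11]; [:: 6; 18]; [:: 0; 9; 20]; [:: 0; 6; 9; 28; 49];
      [:: 0; 6; 28]; [:: 0; 20; 46]; [:: 0; 7; 26]; [:: 6; 27]; [:: 0; 20]; [:: 0; 6; 9];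
      [:: 0; 6; 39]; [:: 0; 6]; [:: 6; 22; 28]; [:: 6; 25; 28]; [:: 6; 25]; [:: 6; 28]].

Definition L31_flips_uv : seq (seq nat) :=
  [:: [:: 6; 16; 19; 22; 51]; [:: 6; 19; 22]; [:: 3; 12; 15; 18; 54]; [:: 12; 15; 18];
      [:: 3; 12; 15]; [:: 6; 22; 24]; [:: 3; 12; 24]; [:: 3; 6; 24]].

Definition L31_flips_w : seq (seq nat) :=
  [:: [:: 15; 18; 21; 54; 57]; [:: 15; 18; 21]].

Definition L31_table : seq nat :=
  [:: 9; 3; 6; 8; 5; 0; 2; 4; 1; 16; 13; 12; 11; 14; 7; 10; 15; 17; 18; 19].

Definition RP3_flips : seq (seq nat) :=
  [:: [:: 0; 3; 5; 6; 9]; [:: 0; 3; 5]; [:: 0; 3; 7]; [:: 0; 3]; [:: 2; 4; 6; 8; 10];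
      [:: 0; 4; 7; 9; 13]; [:: 4; 7; 9; 13; 15]; [:: 0; 2; 4; 7; 16]; [:: 2; 6; 8; 10; 18];
      [:: 0; 2; 7; 16; 20]; [:: 0; 4; 7]; [:: 0; 7; 16]; [:: 0; 5; 7; 9; 23]; [:: 0; 2; 7];
      [:: 0; 5; 7]; [:: 2; 6; 8]; [:: 4; 6; 8]; [:: 4; 7; 9]; [:: 0; 7; 9]; [:: 6; 8; 22];
      [:: 6; 8; 12]; [:: 6; 8]; [:: 0; 7]; [:: 2; 5; 7; 8; 24]; [:: 2; 7; 8; 24; 26];
      [:: 2; 5; 7]; [:: 2; 7; 8]; [:: 2; 4; 7]; [:: 2; 5; 8]; [:: 2; 7; 26]; [:: 2; 7];
      [:: 2; 5; 18; 24; 28]; [:: 2; 5; 18]; [:: 6; 10; 12]; [:: 10; 12]; [:: 2; 5; 6];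
      [:: 2; 5; 24]; [:: 2; 5]; [:: 4; 9; 19]; [:: 0; 5; 20]; [:: 8; 14; 18]; [:: 8; 18];
      [:: 4; 25; 29]; [:: 0; 5; 9; 23; 31]; [:: 24; 28]; [:: 0; 5; 23]; [:: 0; 5; 28];
      [:: 0; 5]; [:: 8; 10; 14]; [:: 4; 8; 22]; [:: 4; 7; 8]; [:: 2; 4; 6; 10; 33];
      [:: 4; 6; 10]; [:: 4; 6; 22]; [:: 4; 8; 30]; [:: 4; 6; 21]; [:: 4; 8]; [:: 4; 6; 25];
      [:: 0; 20; 28]; [:: 4; 6; 9]; [:: 4; 6]; [:: 0; 13; 23]; [:: 8; 22; 30]; [:: 2; 16; 20];
      [:: 2; 18; 24]].

Definition RP3_flips_uv : seq (seq nat) :=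
  [:: [:: 8; 10; 22; 24; 34]; [:: 8; 10; 22]; [:: 2; 10; 20; 24; 36]; [:: 2; 10; 24];
      [:: 2; 20; 24]; [:: 0; 9; 23]; [:: 0; 2; 20]; [:: 0; 20; 23]].

Definition RP3_flips_w : seq (seq nat) :=
  [:: [:: 8; 10; 24; 36; 38]; [:: 8; 10; 24]].

Definition RP3_table : seq nat :=
  [:: 2; 3; 8; 9; 1; 4; 10; 16; 11; 15; 6; 5; 0; 12; 14; 13; 7; 17; 18; 19].

Definition L72_flips : seq (seq nat) :=
  [:: [:: 0; 7; 20; 23; 28]; [:: 7; 20; 23]; [:: 0; 28]; [:: 0; 7; 16; 26; 35]; [:: 0; 7; 16];
      [:: 0; 16; 23]; [:: 0; 16]; [:: 28]; [:: 0; 7; 23]; [:: 0; 23]; [:: 7; 16; 23];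
      [:: 0; 7; 20]; [:: 0; 20]; [:: 0; 15; 22]; [:: 7; 14; 21]; [:: 7; 14]; [:: 7; 24];
      [:: 7; 23]; [:: 0; 22]; [:: 7; 17]; [:: 7; 16]; [:: 0; 13; 41]; [:: 7; 15; 22];
      [:: 0; 15]; [:: 7; 15]; [:: 0; 21; 36]; [:: 0; 41]; [:: 7; 22]; [:: 7; 41];
      [:: 7; 27; 35]; [:: 21; 36]; [:: 0; 7; 27]; [:: 7; 35]; [:: 0; 35]; [:: 0; 20; 27];
      [:: 0; 27]; [:: 0; 18; 21]; [:: 7; 20; 36]; [:: 0; 17]; [:: 14; 37]; [:: 0; 21];
      [:: 0; 13; 24]; [:: 7; 36]; [:: 0; 13; 36]; [:: 14; 24; 36]; [:: 14; 24]; [:: 7; 18; 37];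
      [:: 0; 10; 14]; [:: 7; 18]; [:: 14; 40]; [:: 7; 25; 37]; [:: 7; 37]; [:: 0; 14; 21];
      [:: 0; 14]; [:: 0; 10; 21]; [:: 7; 25]; [:: 0; 10; 15; 24; 28]; [:: 0; 27; 36];
      [:: 14; 23; 39]; [:: 0; 21; 36]; [:: 21; 37]; [:: 14; 36]; [:: 0; 15; 24]; [:: 21; 36];
      [:: 7; 32]; [:: 28]; [:: 0; 10]; [:: 0; 18; 36]; [:: 0; 36]; [:: 14; 39]; [:: 7; 36];
      [:: 35]; [:: 0; 13; 20; 27; 29]; [:: 7; 14; 21]; [:: 0; 13; 20]; [:: 7; 14];
      [:: 0; 20; 27]; [:: 0; 20]; [:: 0; 7; 26]; [:: 0; 26]; [:: 14; 27; 30]; [:: 14; 30];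
      [:: 0; 7; 15; 21; 39]; [:: 0; 15; 21]; [:: 0; 7; 21]; [:: 0; 21]; [:: 7; 26; 29];
      [:: 21; 31]; [:: 7; 18; 24]; [:: 7; 24]; [:: 0; 7; 18; 27; 42]; [:: 0; 18; 27];
      [:: 0; 7; 27]; [:: 0; 27]; [:: 0; 13; 18]; [:: 0; 13; 29]; [:: 0; 13]; [:: 0; 29];
      [:: 0; 12; 17]; [:: 0; 17]; [:: 7; 19; 29]; [:: 14; 31]; [:: 7; 20; 27]; [:: 7; 20];
      [:: 14; 21; 45]; [:: 14; 21]; [:: 7; 19; 21; 43; 53]; [:: 0; 12; 25]; [:: 14; 23; 45];
      [:: 0; 12]; [:: 7; 19; 43]; [:: 14; 45]; [:: 7; 21; 43]; [:: 7; 18; 52]; [:: 21; 43];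
      [:: 14; 55]; [:: 0; 7; 19]; [:: 0; 7; 27]; [:: 0; 27]; [:: 0; 11; 19]; [:: 7; 15; 39];
      [:: 7; 15]; [:: 7; 18; 27]; [:: 0; 11; 15]; [:: 7; 18]; [:: 7; 27; 29]; [:: 21; 30; 44];
      [:: 0; 7; 35]; [:: 21; 30]; [:: 7; 21; 53]; [:: 0; 48; 50]; [:: 0; 25; 50]; [:: 7; 35];
      [:: 7; 26; 43]; [:: 0; 50]; [:: 0; 16]; [:: 0; 11; 24]; [:: 0; 11]; [:: 7; 27];
      [:: 14; 32]; [:: 0; 19]; [:: 0; 25; 39]; [:: 0; 39; 49]; [:: 0; 39; 42]; [:: 7; 26];
      [:: 14; 27; 44]; [:: 0; 39]; [:: 14; 44]; [:: 0; 18; 24; 38; 56]; [:: 0; 24; 38];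
      [:: 0; 21; 35]; [:: 0; 21]; [:: 0; 7]; [:: 0; 18; 38]; [:: 0; 18; 24; 56; 63]; [:: 0; 38];
      [:: 14; 27; 59; 66; 73]; [:: 0; 24; 48]; [:: 7; 19; 21; 39; 81]; [:: 14; 23; 41];
      [:: 0; 15; 24]; [:: 7; 15; 21]; [:: 21; 60; 67]; [:: 14; 23]; [:: 0; 18; 24];
      [:: 0; 24; 56]; [:: 14; 73]; [:: 0; 24; 63]; [:: 7; 15]; [:: 0; 24; 35]; [:: 0; 24; 70];
      [:: 0; 24]; [:: 7; 39; 42]; [:: 0; 13; 48]; [:: 7; 42]; [:: 21; 35; 45; 52; 87];
      [:: 7; 19; 53; 81; 95]; [:: 21; 45; 52]; [:: 35; 45; 52]; [:: 42; 49];
      [:: 0; 15; 49; 77; 98]; [:: 0; 25; 34; 48; 105]; [:: 0; 15; 49]; [:: 14; 55; 90];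
      [:: 21; 39; 74]; [:: 7; 19; 53]; [:: 14; 55; 83]; [:: 14; 55; 104]; [:: 35; 70];
      [:: 0; 25; 48]; [:: 14; 55]; [:: 0; 34; 48]; [:: 0; 48]; [:: 21; 31; 44]; [:: 21; 44];
      [:: 14; 27; 38; 66; 114]; [:: 21; 39; 67]; [:: 21; 31; 81]; [:: 28; 78]; [:: 21; 39; 81];
      [:: 21; 39; 115]; [:: 21; 39]; [:: 7; 21; 53]; [:: 0; 13; 52]; [:: 7; 30; 53]; [:: 7; 53];
      [:: 0; 13; 28; 56; 119]; [:: 21; 31; 53; 108; 129]; [:: 7; 15; 39; 115; 136];
      [:: 0; 63; 70]; [:: 63; 70]; [:: 0; 13; 28]; [:: 7; 15; 39]; [:: 7; 39; 52];
      [:: 28; 50; 105]; [:: 0; 52; 94]; [:: 28; 48; 105]; [:: 35; 52; 87]; [:: 49; 84];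
      [:: 21; 31; 108]; [:: 0; 52]; [:: 56; 119]; [:: 21; 30; 53]; [:: 0; 13; 42; 94; 140];
      [:: 0; 42; 94]; [:: 35; 55; 60]; [:: 28; 42; 51]; [:: 28; 105]; [:: 42; 51; 106];
      [:: 35; 55]; [:: 0; 35; 94]; [:: 0; 94]; [:: 21; 31; 53]; [:: 0; 28; 42]; [:: 0; 13; 18];
      [:: 21; 53; 74]; [:: 7; 15; 136]; [:: 7; 15]; [:: 0; 18; 56]; [:: 7; 29; 43];
      [:: 14; 38; 48]; [:: 21; 53]; [:: 0; 18]; [:: 21; 31; 45; 122; 150]; [:: 42; 51];
      [:: 21; 31; 45]; [:: 28; 51; 79; 106; 156]; [:: 14; 27; 41; 51; 167];
      [:: 7; 21; 30; 81; 171]; [:: 28; 42; 119]; [:: 28; 42]; [:: 21; 30; 81]; [:: 35; 45; 87];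
      [:: 28; 51; 79]; [:: 7; 30; 81]; [:: 28; 79; 106]; [:: 21; 31; 60]; [:: 35; 45];
      [:: 28; 79]; [:: 0; 34; 56]; [:: 28; 57]; [:: 0; 13; 28; 56; 175]; [:: 7; 29; 57];
      [:: 7; 29; 52]; [:: 0; 13; 28]; [:: 7; 29]; [:: 0; 25; 34; 49; 182]; [:: 0; 25; 34];
      [:: 28; 51; 106]; [:: 21; 35; 139]; [:: 21; 139]; [:: 28; 51; 175]; [:: 28; 51];
      [:: 21; 30; 108]; [:: 14; 27; 41]; [:: 14; 41; 51]; [:: 21; 30; 52]; [:: 21; 30];
      [:: 14; 41; 48]; [:: 21; 74; 129]; [:: 14; 41; 59]; [:: 70; 132]; [:: 0; 15; 35];
      [:: 21; 31; 74]; [:: 0; 34; 105]; [:: 0; 34]; [:: 21; 74]; [:: 14; 41]].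

Definition L72_table : seq nat :=
  [:: 0; 4; 18; 1; 8; 19; 5; 3; 6; 22; 11; 2; 25; 20; 26; 9; 23; 16; 7; 24; 21; 10; 14; 17; 13;
      15; 12].

Definition S2S1_flips : seq (seq nat) :=
  [:: [:: 4; 6; 14]; [:: 5; 7; 15]; [:: 4; 6]; [:: 5; 15]; [:: 0; 16; 18]; [:: 4; 14];
      [:: 6; 10]; [:: 16; 18]; [:: 13; 15]; [:: 5; 7]; [:: 13; 14; 22]; [:: 7; 11]; [:: 13; 14];
      [:: 4; 10]; [:: 13; 18]; [:: 12; 14]; [:: 0; 14]; [:: 1; 15]; [:: 4; 16]; [:: 4; 18];
      [:: 13; 17]; [:: 6]; [:: 3; 15]; [:: 2; 14]; [:: 17; 18]; [:: 7]; [:: 4; 19; 23];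
      [:: 13; 19]; [:: 0; 15]; [:: 16]; [:: 13; 22]; [:: 13]; [:: 12; 15]; [:: 15]; [:: 4; 11];
      [:: 14]; [:: 4; 19]; [:: 17]; [:: 4; 23]; [:: 4]; [:: 0; 8; 23]; [:: 12; 19];
      [:: 0; 8; 12]; [:: 20; 22]; [:: 5; 10]; [:: 1; 9; 18]; [:: 9; 18]; [:: 8; 11; 23];
      [:: 8; 11]; [:: 9; 19]; [:: 5; 9; 23]; [:: 9; 23]; [:: 3; 11; 19]; [:: 3; 11];
      [:: 1; 18; 22]; [:: 1; 18]; [:: 3]; [:: 1; 5; 21]; [:: 9; 11]; [:: 1; 5; 23]; [:: 11; 21];
      [:: 1; 5; 22]; [:: 21; 23]; [:: 21]; [:: 9]; [:: 1; 5; 22]; [:: 2; 19]; [:: 0; 11; 23];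
      [:: 0; 11]; [:: 0; 20; 23]; [:: 8; 19]; [:: 1; 11; 23]; [:: 11; 23]; [:: 11];
      [:: 10; 18; 22]; [:: 0; 2]; [:: 1; 10; 22]; [:: 1; 10]; [:: 1; 22; 23]; [:: 1; 22];
      [:: 0; 12; 20]; [:: 12; 20]; [:: 1; 19; 23]; [:: 5; 20]; [:: 0; 1; 23]; [:: 8; 20];
      [:: 20]; [:: 5; 18; 22]; [:: 5; 18]; [:: 5; 22; 23]; [:: 0; 2; 23]; [:: 0; 2];
      [:: 22; 23]; [:: 8; 10; 22]; [:: 2; 18]; [:: 8; 12; 18]; [:: 12; 18]; [:: 5; 19; 23];
      [:: 5; 23]; [:: 1; 2; 23]; [:: 2; 23]; [:: 0; 8; 22]; [:: 18; 23]; [:: 18];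
      [:: 1; 5; 10; 19; 24]; [:: 1; 10; 19]; [:: 2; 12]; [:: 8; 10; 22]; [:: 8; 10];
      [:: 1; 5; 10]; [:: 1; 5]; [:: 8; 12; 23]; [:: 8; 23]; [:: 2; 5; 19]; [:: 5; 19];
      [:: 0; 2; 10; 22; 25]; [:: 2; 10; 22; 25; 26]; [:: 2; 10; 25; 26; 27]; [:: 2; 10; 22];
      [:: 2; 10; 19]; [:: 2; 10; 26]; [:: 2; 10; 25]; [:: 0; 2; 10]; [:: 1; 10; 19];
      [:: 0; 2; 5]; [:: 1; 10; 26]; [:: 2; 22; 25]; [:: 2; 10; 24]; [:: 1; 10; 24]; [:: 2; 25];
      [:: 1; 19; 23]; [:: 0; 10; 22]; [:: 0; 10]; [:: 10; 19; 22; 26; 28];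
      [:: 10; 19; 22; 24; 29]; [:: 10; 22; 24; 29; 30]; [:: 0; 1; 12]; [:: 1; 8; 12; 19; 31];
      [:: 1; 10; 12]; [:: 2; 10]; [:: 0; 1; 19]; [:: 10; 19; 22]; [:: 10; 22; 24; 30; 32];
      [:: 0; 1; 23; 24; 33]; [:: 1; 10]; [:: 0; 2; 27]; [:: 1; 8; 19]; [:: 0; 8; 12];
      [:: 19; 22; 24]; [:: 1; 8; 12]; [:: 19; 22; 29]; [:: 10; 24; 29]; [:: 10; 19; 24];
      [:: 2; 22; 24]; [:: 19; 23; 24]; [:: 1; 8; 24; 31; 34]; [:: 19; 22]; [:: 10; 22; 29];
      [:: 2; 5; 22]; [:: 1; 19; 24]; [:: 0; 1; 23]; [:: 12; 19; 23]; [:: 0; 1; 24]; [:: 10; 29];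
      [:: 8; 12; 19]; [:: 22; 24; 30]; [:: 8; 12]; [:: 19; 23]; [:: 0; 25; 26]; [:: 0; 25];
      [:: 0; 1]; [:: 22; 26; 27]; [:: 0; 5; 8]; [:: 23; 30]; [:: 1; 2; 19]; [:: 10; 24; 30];
      [:: 1; 19]; [:: 2; 22; 29]; [:: 22; 26; 28]; [:: 0; 8; 19]; [:: 22; 27]; [:: 1; 12; 23];
      [:: 0; 10; 19]; [:: 1; 8; 31]; [:: 0; 19; 24]; [:: 1; 8; 22]; [:: 1; 8]; [:: 26; 28];
      [:: 12; 19; 31]; [:: 0; 19; 27]; [:: 0; 24; 30]; [:: 0; 19]; [:: 19; 24; 30]; [:: 24; 30];
      [:: 2; 10; 22]; [:: 2; 22; 26]; [:: 2; 22]; [:: 10; 12; 19]; [:: 12; 19]; [:: 22; 29; 30];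
      [:: 29; 30; 32]; [:: 0; 8; 22]; [:: 29; 30]; [:: 2; 10]; [:: 1; 23; 24]; [:: 2; 26; 27];
      [:: 2; 27]; [:: 0; 22; 26]; [:: 2; 5; 8]; [:: 10; 19]; [:: 22; 26]; [:: 5; 8; 27];
      [:: 0; 2]; [:: 1; 12; 22]; [:: 1; 12]; [:: 0; 8; 27]; [:: 0; 24; 27];
      [:: 0; 10; 24; 32; 35]; [:: 10; 24; 32]; [:: 0; 24; 32]; [:: 1; 5; 27]; [:: 24; 32; 35];
      [:: 24; 27; 32]; [:: 24; 32]; [:: 1; 24; 34]; [:: 1; 22; 31]; [:: 8; 22; 28];
      [:: 1; 23; 27]; [:: 22; 28; 29]; [:: 28; 29; 32]; [:: 24; 34]; [:: 8; 34]; [:: 1; 22; 23];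
      [:: 0; 10; 24]; [:: 10; 12; 26; 30; 36]; [:: 1; 22; 27]; [:: 1; 22]; [:: 5; 27; 30];
      [:: 10; 23; 24]; [:: 12; 26; 30]; [:: 2; 5]; [:: 22; 29; 32]; [:: 29; 32];
      [:: 10; 12; 30]; [:: 10; 24]; [:: 12; 30]; [:: 0; 8; 33]; [:: 0; 8]; [:: 1; 27; 31];
      [:: 26; 27; 31; 34; 37]; [:: 26; 27; 31]; [:: 34; 37]; [:: 12; 27; 31]; [:: 26; 37];
      [:: 12; 22; 31]; [:: 5; 12; 31]; [:: 12; 31]; [:: 5; 23; 27]; [:: 10; 19; 23; 27; 38];
      [:: 26; 27; 31]; [:: 27; 31]; [:: 27; 28; 30]; [:: 0; 5; 27]; [:: 5; 27]; [:: 27; 30];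
      [:: 10; 23; 27]; [:: 12; 23; 27]; [:: 26; 27; 34]; [:: 12; 22; 23]; [:: 12; 23];
      [:: 12; 26; 37]; [:: 12; 37]; [:: 26; 34]; [:: 2; 19; 24]; [:: 19; 26; 31];
      [:: 1; 31; 33; 34; 39]; [:: 1; 23]; [:: 1; 33; 34]; [:: 8; 19; 24]; [:: 19; 24];
      [:: 1; 31; 33]; [:: 1; 33; 39]; [:: 5; 26; 31]; [:: 26; 31]; [:: 10; 26; 30];
      [:: 5; 24; 29]; [:: 1; 33]; [:: 5; 33]; [:: 1; 19; 24]; [:: 5; 29]; [:: 2; 24];
      [:: 2; 8; 26]; [:: 23; 27]; [:: 2; 8]; [:: 5; 26; 27]; [:: 19; 28; 32]; [:: 5; 27];
      [:: 8; 28; 29]; [:: 19; 32]; [:: 0; 22; 28]; [:: 27; 28; 32]; [:: 28; 32]; [:: 8; 29];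
      [:: 8; 24; 27]; [:: 8; 24; 33]; [:: 24; 27]; [:: 8; 24]; [:: 2; 19; 29; 31; 40];
      [:: 19; 29; 31]; [:: 2; 19; 29]; [:: 5; 26; 30]; [:: 19; 29]; [:: 0; 24; 33];
      [:: 24; 31; 33]; [:: 5; 30]; [:: 19; 24; 39]; [:: 0; 23; 24]; [:: 19; 24]; [:: 0; 24];
      [:: 23; 24; 35]; [:: 12; 26; 37]; [:: 12; 37]; [:: 23; 24]; [:: 26; 30]; [:: 22; 28; 30];
      [:: 22; 28]; [:: 24; 33]; [:: 22; 30]; [:: 0; 22; 23]; [:: 27; 28; 29]; [:: 24; 26; 35];
      [:: 24; 35]; [:: 2; 28; 29]; [:: 2; 29]; [:: 28; 29]; [:: 22; 23]].

Definition S2S1_table : seq nat :=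
  [:: 19; 8; 13; 0; 0; 1; 0; 0; 7; 0; 18; 0; 22; 0; 0; 0; 0; 0; 0; 2; 0; 0; 0; 20; 16; 17; 4; 3;
      5; 15; 24; 9; 25; 6; 11; 26; 23; 12; 21; 10; 14].

Definition S3_model : seq (seq (nat * 'I_1)) :=
  cross_facets 4 (fun i (s : bool) => ((i + 4 * s)%N, ord0)).

(** Opposite facets, both of which are listed, have the same orbit. *)
Definition RP3_model : seq (seq (nat * 'I_2)) :=
  cross_facets 4 (fun i (s : bool) => (i, inZp s)).

Definition polytope_facets (n : nat) : seq (seq nat) :=
  cross_facets n (fun i (s : bool) => (2 * i + s)%N).

(** A monotone lattice path goes along [F] up to its entry [m] at the first vertex
    of [F'], and continues from this entry at the second vertex. *)
Definition staircases (F F' : seq nat) : seq (seq (nat * nat)) :=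
  [seq [seq (v, nth 0 F' 0) | v <- take m.+1 F] ++ [seq (v, nth 0 F' 1) | v <- drop m F] |
    m <- iota 0 (size F)]%N.

Definition prism_facets : seq (seq (nat * nat)) :=
  flatten [seq staircases F F' | F <- polytope_facets 3, F' <- polytope_facets 2].

Definition prism_code (v : nat * nat) : nat * 'I_1 := ((4 * v.1 + v.2)%N, ord0).

Definition S2S1_model : seq (seq (nat * 'I_1)) := map (map prism_code) prism_facets.

Lemma prism_product : product_facets 6 4 (polytope_facets 3) (polytope_facets 2) prism_facets.
Proof. by vm_compute. Qed.

Lemma S3_certified :
  certifies S3_model S3_flips S3_table
    (map (map (mult 1)) codes1 ++ ring_code).
Proof. by vm_compute. Qed.

Lemma S3_certified_uv :
  certifies S3_model (S3_flips ++ S3_flips_uv) S3_table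
    (map (map (mult 1)) codes10 ++ ring_code).
Proof. by vm_compute. Qed.

Lemma S3_certified_w :
  certifies S3_model (S3_flips ++ S3_flips_uv ++ S3_flips_w) S3_table
    (map (map (mult 1)) codes10' ++ ring_code).
Proof. by vm_compute. Qed.

Lemma L31_certified :
  certifies (lens_facets 2 1) L31_flips L31_table
    (map (map (mult 2)) codes1 ++ ring_code).
Proof. by vm_compute. Qed.

Lemma L31_certified_uv :
  certifies (lens_facets 2 1) (L31_flips ++ L31_flips_uv) L31_table
    (map (map (mult 2)) codes10 ++ ring_code).
Proof. by vm_compute. Qed.

Lemma L31_certified_w :
  certifies (lens_facets 2 1) (L31_flips ++ L31_flips_uv ++ L31_flips_w) L31_table
    (map (map (mult 2)) codes10' ++ ring_code).
Proof. by vm_compute. Qed.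

Lemma RP3_certified :
  certifies RP3_model RP3_flips RP3_table
    (map (map (mult 4)) codes1 ++ ring_code).
Proof. by vm_compute. Qed.

Lemma RP3_certified_uv :
  certifies RP3_model (RP3_flips ++ RP3_flips_uv) RP3_table
    (map (map (mult 4)) codes10 ++ ring_code).
Proof. by vm_compute. Qed.

Lemma RP3_certified_w :
  certifies RP3_model (RP3_flips ++ RP3_flips_uv ++ RP3_flips_w) RP3_table
    (map (map (mult 4)) codes10' ++ ring_code).
Proof. by vm_compute. Qed.

Lemma L72_certified : certifies (lens_facets 6 4) L72_flips L72_table (ring_code ++ ring_code2 2).
Proof. by vm_compute. Qed.

Lemma S2S1_certified : certifies S2S1_model S2S1_flips S2S1_table (ring_code ++ ring_code2 1).
Proof. by vm_compute. Qed.

End Certificates.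

(** * The models realize the manifolds *)

Lemma orbits_cross (G : finZmodType) n (e : nat -> bool -> nat * G) :
  (forall g, exists t, forall i b, deck g (e i b) = e i (b (+) t)) ->
  forall A, A \in orbits (cross_facets n e) <->
    exists s : nat -> bool, A = [fset x in [seq e i (s i) | i <- iota 0 n]]%fset.
Proof.
move=> dE A; split=> [/orbitsP[F [g [/cross_facetsP[s ->] ->]]]|[s ->]].
  have [t te] := dE g; exists (fun i => s i (+) t); rewrite /translate -map_comp.
  by rewrite (eq_map (g := fun i => e i (s i (+) t))) // => i; exact: te.
apply/orbitsP; exists [seq e i (s i) | i <- iota 0 n], 0; split.
  by apply/cross_facetsP; exists s.
by rewrite /translate -map_comp (eq_map (g := fun i => e i (s i))) // => i; exact: deck0.
Qed.

Section Models.
Variables (R : realType) (K : seq (seq nat)) (c : seq (seq nat)) (table : seq nat).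

Lemma models_sphere3 : certifies S3_model c table K -> models R (sphere R 3) K.
Proof.
apply: certified => L W name cL covL name_inj.
pose e i (s : bool) : nat * 'I_1 := ((i + 4 * s)%N, ord0).
have e_inj i j a b : (i < 4)%N -> (j < 4)%N -> e i a = e j b -> i = j /\ a = b.
  by move=> i4 j4 [+]; case: a; case: b => /=; lia.
apply: (triangulates_flips (F0 := sphere_to_cross e) _ _ cL covL name_inj).
- exact: sphere_to_cross_continuous.
- apply: sphere_to_cross_range => //; apply: orbits_cross => g; exists false => i b.
  by rewrite addbF (ord1 g) deck0.
- by move=> h; apply/val_inj; case: h => -[].
- exact: sphere_compact.
- exact: sphere_to_cross_inj.
Qed.

Lemma models_projective3 : certifies RP3_model c table K -> models R (projective_space R 3) K.
Proof.
apply: certified => L W name cL covL name_inj.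
pose e i (s : bool) : nat * 'I_2 := (i, inZp s).
have e_inj i j a b : (i < 4)%N -> (j < 4)%N -> e i a = e j b -> i = j /\ a = b.
  move=> _ _ ij; split; first exact: (congr1 fst ij).
  by move: (congr1 (fun v => val v.2) ij); case: a {ij}; case: b.
have I2 (g : 'I_2) : exists b : bool, g = inZp b.
  by exists (val g != 0%N); apply/val_inj; case: g => -[|[|]].
have eD i (a b : bool) : deck (inZp b) (e i a) = e i (a (+) b).
  by congr (_, _); apply/val_inj; case: a; case: b.
pose F := sphere_to_cross (R := R) (n := 3) e.
have F_opp z z' : set_val z' = - set_val z -> F z' = F z \o deck (inZp true).
  move=> zz'; apply: sphere_to_cross_opp => [|i b|i]; first last.
  - by rewrite zz' mxE.
  - by rewrite eD addbT.
  - exact: deck_inj.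
apply: (triangulates_flips_quotient (F0 := F) _ _ cL covL name_inj).
- exact: sphere_to_cross_continuous.
- apply: sphere_to_cross_range => //; apply: orbits_cross => g.
  by have [b ->] := I2 g; exists b => i a; exact: eD.
- exact: sphere_compact.
move=> x y; have F_inj : injective F by exact: sphere_to_cross_inj.
have deck0' : F x \o deck (inZp false) = F x.
  by apply/funext => v; rewrite /= (_ : inZp _ = 0) ?deck0 //; apply/val_inj.
rewrite [equiv _ _ _]/(antipodal x y) /antipodal.
split=> [/orP[/eqP/val_inj ->|/eqP/F_opp yx]|[g]].
- by exists (inZp false).
- by exists (inZp true).
have [[] ->] := I2 g; last by rewrite deck0' => /F_inj ->; rewrite eqxx.
have wP : sphere_set (- set_val x).
  by apply: etrans (set_valP x); apply: eq_bigr => i _; rewrite mxE sqrrN.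
pose w : sphere R 3 := SigSub (mem_set wP).
have <- : F w = F x \o deck (inZp true) by exact: F_opp.
by move=> /F_inj ->; rewrite eqxx orbT.
Qed.

Lemma models_lens p q r : (2 <= p.+1)%N -> (q * r = 1 %[mod p.+1])%N ->
  certifies (lens_facets p r) c table K -> models R (lens_space R p.+1 q) K.
Proof.
move=> p2 qr; apply: certified => L W name cL covL name_inj.
exact: (triangulates_lens R p2 qr cL covL name_inj).
Qed.

Lemma models_sphere2_sphere1 : certifies S2S1_model c table K ->
  models R (sphere R 2 * sphere R 1)%type K.
Proof.
apply: certified => L W name cL covL name_inj.
pose e i (s : bool) := (2 * i + s)%N.
have e_inj n i j a b : (i < n)%N -> (j < n)%N -> e i a = e j b -> i = j /\ a = b.
  by move=> _ _; rewrite /e; case: a; case: b => /=; lia.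
have KP n A : A \in facets_of (polytope_facets n) <->
    exists s : nat -> bool, A = [fset x in [seq e i (s i) | i <- iota 0 n]]%fset.
  split=> [/facets_ofP[_ /cross_facetsP[s ->] ->]|[s ->]]; first by exists s.
  apply/facets_ofP; exists [seq e i (s i) | i <- iota 0 n] => //.
  by apply/cross_facetsP; exists s.
have code_inj i j i' j' : (j < 4)%N -> (j' < 4)%N ->
    prism_code (i, j) = prism_code (i', j') -> (i, j) = (i', j').
  by move=> j4 j4' [] ijE; congr (_, _); lia.
pose f := sphere_to_cross (R := R) (n := 2) e; pose g := sphere_to_cross (R := R) (n := 1) e.
have fK : range f = realization (facets_of (polytope_facets 3)).
  by apply: sphere_to_cross_range; [exact: e_inj|exact: KP].
have gK : range g = realization (facets_of (polytope_facets 2)).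
  by apply: sphere_to_cross_range; [exact: e_inj|exact: KP].
have fc : continuous f by exact: sphere_to_cross_continuous.
have gc : continuous g by exact: sphere_to_cross_continuous.
have fi : injective f by apply: sphere_to_cross_inj; exact: e_inj.
have gi : injective g by apply: sphere_to_cross_inj; exact: e_inj.
apply: (triangulates_flips (F0 := product_param 6 4 prism_code f g) _ _ cL covL name_inj).
- exact: product_param_continuous.
- rewrite (product_param_range prism_product code_inj fK gK); congr realization.
  apply/fsetP => A; apply/facets_ofP/orbitsP => [[F FM ->]|[F [h [FM ->]]]].
    exists F, 0; split=> //; rewrite /translate.
    by rewrite (eq_map (g := id)) ?map_id // => v; exact: deck0.
  exists F => //; rewrite /translate (eq_map (g := id)) ?map_id // => v.
  by rewrite (ord1 h) deck0.
- by move=> h; apply/val_inj; case: h => -[].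
- by rewrite -setXTT; apply: compact_setX; exact: sphere_compact.
- exact: (product_param_inj prism_product code_inj fi fK gi gK).
Qed.

End Models.

(** * The triangulated manifolds *)

Local Close Scope ring_scope.
Local Close Scope classical_set_scope.
Theorem corollary3p10 (R : realType) :
  (forall m n : nat,
    triangulates R (T1 `|` T 4 n)%fset (sphere R 3) /\
    triangulates R (T 1 m `|` T 4 n)%fset (sphere R 3) /\
    triangulates R (T2 `|` T 5 n)%fset (sphere R 3) /\
    triangulates R (T 2 m `|` T 5 n)%fset (sphere R 3) /\
    triangulates R (T3 `|` T 6 n)%fset (sphere R 3) /\
    triangulates R (T 3 m `|` T 6 n)%fset (sphere R 3)) /\
  (forall m n : nat,
    triangulates R (T2 `|` T 4 n)%fset (lens_space R 3 1) /\
    triangulates R (T 2 m `|` T 4 n)%fset (lens_space R 3 1) /\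
    triangulates R (T3 `|` T 5 n)%fset (lens_space R 3 1) /\
    triangulates R (T 3 m `|` T 5 n)%fset (lens_space R 3 1) /\
    triangulates R (T1 `|` T 6 n)%fset (lens_space R 3 1) /\
    triangulates R (T 1 m `|` T 6 n)%fset (lens_space R 3 1)) /\
  (forall m n : nat,
    triangulates R (T3 `|` T 4 n)%fset (projective_space R 3) /\
    triangulates R (T 3 m `|` T 4 n)%fset (projective_space R 3) /\
    triangulates R (T1 `|` T 5 n)%fset (projective_space R 3) /\
    triangulates R (T 1 m `|` T 5 n)%fset (projective_space R 3) /\
    triangulates R (T2 `|` T 6 n)%fset (projective_space R 3) /\
    triangulates R (T 2 m `|` T 6 n)%fset (projective_space R 3)) /\
  (forall m n : nat,
    triangulates R (T 4 m `|` T 5 n)%fset (lens_space R 7 2) /\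
    triangulates R (T 4 m `|` T 6 n)%fset (lens_space R 7 2) /\
    triangulates R (T 5 m `|` T 6 n)%fset (lens_space R 7 2)) /\
  (forall j m n : nat, (4 <= j <= 6)%N -> m <> n ->
    triangulates R (T j m `|` T j n)%fset (sphere R 2 * sphere R 1)%type).
Proof.
have S3 : {in [:: codes1; codes10; codes10'], forall C,
    models R (sphere R 3) (map (map (mult 1)) C ++ ring_code)}.
  move=> C; rewrite !inE => /or3P[] /eqP ->;
    [exact: models_sphere3 S3_certified|exact: models_sphere3 S3_certified_uv|
     exact: models_sphere3 S3_certified_w].
have lens3 K c table : certifies (lens_facets 2 1) c table K -> models R (lens_space R 3 1) K.
  exact: models_lens.
have L31 : {in [:: codes1; codes10; codes10'], forall C,
    models R (lens_space R 3 1) (map (map (mult 2)) C ++ ring_code)}.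
  move=> C; rewrite !inE => /or3P[] /eqP ->;
    [exact: lens3 L31_certified|exact: lens3 L31_certified_uv|exact: lens3 L31_certified_w].
have RP3 : {in [:: codes1; codes10; codes10'], forall C,
    models R (projective_space R 3) (map (map (mult 4)) C ++ ring_code)}.
  move=> C; rewrite !inE => /or3P[] /eqP ->;
    [exact: models_projective3 RP3_certified|exact: models_projective3 RP3_certified_uv|
     exact: models_projective3 RP3_certified_w].
have L72 : models R (lens_space R 7 2) (ring_code ++ ring_code2 2).
  exact: (@models_lens R _ _ _ 6 2 4 isT (erefl _) L72_certified).
have S2S1 := models_sphere2_sphere1 R S2S1_certified.
(* The multiplier of [T_(j + 1)] is [2 ^+ j], and [2 ^+ e] is the multiplier of
   [T (4 + e) n].  The quotient [c] is 1, 2 or 4 for the three manifolds. *)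
have powers c e j : val (c%:R * 2 ^+ e : 'Z_7)%R = val (2 ^+ j : 'Z_7)%R ->
  (c%:R * 2 ^+ e = 2 ^+ j :> 'Z_7)%R by exact: val_inj.
split=> [m n|].
  have [? ?] := triangulates_pair S3 m n (isT : 0 < 3) (isT : 0 < 3) (powers 1 0 0 erefl).
  have [? ?] := triangulates_pair S3 m n (isT : 1 < 3) (isT : 1 < 3) (powers 1 1 1 erefl).
  have [? ?] := triangulates_pair S3 m n (isT : 2 < 3) (isT : 2 < 3) (powers 1 2 2 erefl).
  by [].
split=> [m n|].
  have [? ?] := triangulates_pair L31 m n (isT : 0 < 3) (isT : 1 < 3) (powers 2 0 1 erefl).
  have [? ?] := triangulates_pair L31 m n (isT : 1 < 3) (isT : 2 < 3) (powers 2 1 2 erefl).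
  have [? ?] := triangulates_pair L31 m n (isT : 2 < 3) (isT : 0 < 3) (powers 2 2 0 erefl).
  by [].
split=> [m n|].
  have [? ?] := triangulates_pair RP3 m n (isT : 0 < 3) (isT : 2 < 3) (powers 4 0 2 erefl).
  have [? ?] := triangulates_pair RP3 m n (isT : 1 < 3) (isT : 0 < 3) (powers 4 1 0 erefl).
  have [? ?] := triangulates_pair RP3 m n (isT : 2 < 3) (isT : 1 < 3) (powers 4 2 1 erefl).
  by [].
split=> [m n|j m n j46 mn].
  have rings e k e' k' := @triangulates_two_rings R _ 2 e k e' k' L72 isT.
  split; first exact: (rings 0 m 1 n isT isT (powers 2 0 1 erefl) isT).
  split; last exact: (rings 1 m 2 n isT isT (powers 2 1 2 erefl) isT).
  by rewrite fsetUC; exact: (rings 2 n 0 m isT isT (powers 2 2 0 erefl) isT).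
have [e e3 ->] : exists2 e, e < 3 & j = 4 + e by exists (j - 4); lia.
apply: (triangulates_two_rings S2S1) => //; first by rewrite mul1r.
by rewrite xpair_eqE eqxx; apply/eqP.
Qed.
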